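(* Let $n\ge 1$. The set of isomorphism classes of $n$-dimensional toric varieties of Catalan type corresponds bijectively, via the correspondence induced by $X(\Sigma_T)\mapsto \mathcal{B}_T$ ($T$ a triangulation of the convex $(n+2)$-gon), to the set of unordered binary trees with $n$ vertices. The same holds for the set of isomorphism classes of $n$-dimensional toric Richardson varieties of Catalan type. The cardinality of the set of unordered binary trees with $n$ vertices is the Wedderburn--Etherington number $b_{n+1}$.
   Context: Triangulations. Let $\mathsf{P}_{n+2}$ be a convex $(n+2)$-gon with vertices labelled $0,1,\dots,n+1$ in counterclockwise order. A triangulation $T$ of $\mathsf{P}_{n+2}$ is a decomposition into $n$ triangles by $n-1$ diagonals not crossing in their interiors; $T$ is also regarded as the set of all edges of these triangles (sides and chosen diagonals). Put $e=\{0,n+1\}$, the distinguished edge. Left and right trees. Define $F\colon T\setminus\{e\}\to\{\mathsf{L},\mathsf{R}\}$ recursively: for a triangulated polygon with distinguished edge $g$ (starting with $\mathsf{P}_{n+2}$ and $g=e$), the unique triangle containing $g$ has two other edges $f_{\mathsf{L}}(g),f_{\mathsf{R}}(g)$, named so that $f_{\mathsf{L}}(g),f_{\mathsf{R}}(g),g$ are placed counterclockwise; set $F(f_{\mathsf{L}}(g))=\mathsf{L}$, $F(f_{\mathsf{R}}(g))=\mathsf{R}$. Removing $g$ leaves two triangulated polygons (possibly single edges) with one common vertex and with distinguished edges $f_{\mathsf{L}}(g)$ and $f_{\mathsf{R}}(g)$; repeat for each of them that is not a single edge. The left tree $\mathcal{T}_T^{\mathsf{L}}$ has vertex set $\{0,\dots,n\}$,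 root $0$ and edge set $F^{-1}(\mathsf{L})$; the right tree $\mathcal{T}_T^{\mathsf{R}}$ has vertex set $\{1,\dots,n+1\}$, root $n+1$ and edge set $F^{-1}(\mathsf{R})$. For each $1\le k\le n$ there is exactly one edge $\{k_{\mathsf{L}},k\}$ of $\mathcal{T}_T^{\mathsf{L}}$ with $k_{\mathsf{L}}<k$ and exactly one edge $\{k,k_{\mathsf{R}}\}$ of $\mathcal{T}_T^{\mathsf{R}}$ with $k<k_{\mathsf{R}}$; this defines $k_{\mathsf{L}},k_{\mathsf{R}}$. Vectors and fan. Let $N=\mathbb{Z}^{n+1}/\mathbb{Z}(1,\dots,1)$ and let $\varpi_i\in N$ be the image of $\sum_{k=1}^i e_k$ ($0\le i\le n+1$), so $\varpi_0=\varpi_{n+1}=0$. Put $\mathbf{v}_k=\varpi_k-\varpi_{k_{\mathsf{R}}}$ and $\mathbf{w}_k=\varpi_{k_{\mathsf{L}}}-\varpi_k$ for $k\in[n]=\{1,\dots,n\}$. $\Sigma_T$ is the complete non-singular fan in $N\otimes\mathbb{R}$ consisting of the cones $\operatorname{Cone}(Q)$ for subsets $Q\subset\{\mathbf{v}_k,\mathbf{w}_k\mid k\in[n]\}$ with $\{\mathbf{v}_i,\mathbf{w}_i\}\not\subset Q$ for all $i\in[n]$. $X(\Sigma_T)$ is the corresponding toric variety over $\mathbb{C}$. A fan or toric variety is of Catalan type if it is (isomorphic to) $\Sigma_T$, respectively $X(\Sigma_T)$, for some polygon triangulation $T$. Binary trees. A binary tree is either empty or has a root vertex, a left subtree and a right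 subtree, both binary trees. $\mathcal{B}_T$ is the binary tree with $n$ vertices whose vertices are the triangles of $T$, whose root is the triangle containing $e$, and in which the left (right) child of a triangle with distinguished edge $g$ is the other triangle containing $f_{\mathsf{L}}(g)$ (respectively $f_{\mathsf{R}}(g)$), if any. An unordered binary tree is an isomorphism class of binary trees as rooted trees (left/right ordering forgotten): two binary trees are isomorphic as unordered rooted trees if there is a bijection of vertices sending root to root and inducing a bijection of edges. Richardson varieties. Let $G=\mathrm{GL}_{m+1}(\mathbb{C})$, $B$ the upper triangular matrices, $\mathbb{T}$ the diagonal matrices, $w_0$ the longest element of $\mathfrak{S}_{m+1}$. For $v\le w$ in the Bruhat order on $\mathfrak{S}_{m+1}$, the Richardson variety is $X^v_w=X_w\cap w_0X_{w_0v}\subset G/B$, where $X_w=\overline{BwB/B}$. It is a toric Richardson variety if it is a toric variety with respect to the $\mathbb{T}$-action (i.e. contains a dense $\mathbb{T}$-orbit); it is of Catalan type if it is of Catalan type as a toric variety. Wedderburn--Etherington numbers: $b_1=1$, $b_{2m-1}=\sum_{i=1}^{m-1}b_ib_{2m-i-1}$ for $m\ge2$, and $b_{2m}=\frac{b_m(b_m+1)}{2}+\sum_{i=1}^{m-1}b_ib_{2m-i}$ for $m\ge 1$. *)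

(* Defs.v *)
From HB Require Import structures.
From mathcomp Require Import all_boot all_order all_algebra all_fingroup.
From mathcomp Require Import all_classical all_reals.
From mathcomp Require Import complex.

Set Implicit Arguments.
Unset Strict Implicit.
Unset Printing Implicit Defensive.

Import Order.TTheory GRing.Theory Num.Theory.

Local Open Scope classical_set_scope.
Local Open Scope ring_scope.

(** * Algebraic varieties as spaces with functions *)

(* A variety over an algebraically closed field is handled as a set of closed
   points with its Zariski topology and its sheaf of K-valued regular functions.
   A function on an open set U is given by a total function, of which only the
   values on U are meaningful; [regular U] is used for open U only. *)
Record space (K : fieldType) := Space {
  point :> Type;
  is_open : (point -> Prop) -> Prop;
  regular : (point -> Prop) -> (point -> K) -> Prop }.

Section Spaces.
Variable K : fieldType.
Implicit Types X Y : space K.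

Inductive polyfun (P : Type) (S : (P -> K) -> Prop) : (P -> K) -> Prop :=
| Polyfun_const c : polyfun S (fun=> c)
| Polyfun_coord f : S f -> polyfun S f
| Polyfun_add f g : polyfun S f -> polyfun S g -> polyfun S (fun p => f p + g p)
| Polyfun_mul f g : polyfun S f -> polyfun S g -> polyfun S (fun p => f p * g p).

(* The Zariski structure on a set P whose coordinate functions are the elements
   of S: basic open sets are non-vanishing loci of polynomials in the
   coordinates and regular functions are locally quotients of such. *)
Definition zariski (P : Type) (S : (P -> K) -> Prop) : space K :=
  @Space K P
    (fun A => forall p, A p -> exists h, [/\ polyfun S h, h p != 0 &
       forall q, h q != 0 -> A q])
    (fun U f => forall p, U p -> exists g h,
       [/\ polyfun S g, polyfun S h, h p != 0 &
           forall q, U q -> h q != 0 -> f q = g q / h q]).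

(* The final structure for a family of maps; it serves both for gluing charts
   and for the quotient of a variety by a group. *)
Definition final_space (I : Type) (X : I -> space K) (P : Type)
    (pi : forall i, X i -> P) : space K :=
  @Space K P
    (fun A => forall i, is_open (fun p : X i => A (pi i p)))
    (fun U f => forall i,
       regular (fun p : X i => U (pi i p)) (fun p => f (pi i p))).

(* For a closed subset Z this is the reduced closed subvariety. *)
Definition subspace X (Z : X -> Prop) : space K :=
  @Space K {x : X | Z x}
    (fun B => exists2 A : X -> Prop, is_open A & forall z, B z <-> A (sval z))
    (fun B f => forall z, B z -> exists A g,
       [/\ is_open A, A (sval z), regular A g &
           forall y, B y -> A (sval y) -> f y = g (sval y)]).

Definition morphism_of_spaces X Y (f : X -> Y) : Prop :=
  forall V : Y -> Prop, is_open V ->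
    is_open (fun x => V (f x)) /\
    forall g, regular V g -> regular (fun x => V (f x)) (fun x => g (f x)).

Definition closure_in X (A : X -> Prop) : X -> Prop :=
  fun x => forall U : X -> Prop, is_open U -> U x -> exists2 y, U y & A y.

Definition is_closed X (A : X -> Prop) : Prop := is_open (fun x => ~ A x).

Definition irreducible_closed X (Z : X -> Prop) : Prop :=
  [/\ is_closed Z, exists x, Z x &
      forall A B : X -> Prop, is_closed A -> is_closed B ->
        (forall x, Z x -> A x \/ B x) ->
        (forall x, Z x -> A x) \/ (forall x, Z x -> B x)].

Definition irreducible_chain X (d : nat) (Z : nat -> X -> Prop) : Prop :=
  (forall i, (i <= d)%N -> irreducible_closed (Z i)) /\
  (forall i, (i < d)%N -> (forall x, Z i x -> Z i.+1 x) /\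
                          exists x, Z i.+1 x /\ ~ Z i x).

Definition krull_dim X (d : nat) : Prop :=
  (exists Z : nat -> X -> Prop, irreducible_chain d Z) /\
  (forall k (Z : nat -> X -> Prop), irreducible_chain k Z -> (k <= d)%N).

End Spaces.

(** * Varieties with the action of a torus *)

(* [torus] is the image of the acting torus in the group of self-maps of the
   variety, so that the torus need not act effectively. *)
Record tspace (K : fieldType) := TSpace {
  tvar :> space K;
  torus : (tvar -> tvar) -> Prop }.

(* Isomorphism of toric varieties: an isomorphism of varieties that conjugates
   one torus into the other. *)
Definition toric_iso (K : fieldType) (X Y : tspace K) : Prop :=
  exists (f : X -> Y) (g : Y -> X),
    [/\ cancel f g, cancel g f, morphism_of_spaces f, morphism_of_spaces g &
        forall s : Y -> Y, torus s <-> torus (fun x => g (s (f x)))].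

(** * Toric variety of a fan in N_R, where N = Z^(n+1) / Z(1,...,1) *)

Section ToricVariety.
Variables (R : realType) (n : nat).
Local Notation C := (R[i]).

(* A subset of N_R is represented by its preimage in R^(n+1), which is invariant
   under translation by R(1,...,1); an element of N by any representative in
   Z^(n+1); and M, the dual of N, by the vectors of Z^(n+1) with zero sum. *)
Definition NR_set := 'rV[R]_n.+1 -> Prop.

Definition dualM (m : 'rV[int]_n.+1) : Prop := \sum_j m 0 j = 0.

Definition pairing (m : 'rV[int]_n.+1) (u : 'rV[R]_n.+1) : R :=
  \sum_j (m 0 j)%:~R * u 0 j.

Definition Cone (Q : seq 'rV[int]_n.+1) : NR_set := fun u =>
  exists (c : 'rV[int]_n.+1 -> R) (t : R), (forall q, 0 <= c q) /\
    u = \sum_(q <- Q) c q *: map_mx intr q + const_mx t.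

(* The semigroup of lattice points of the dual cone. *)
Definition dual_semigroup (s : NR_set) (m : 'rV[int]_n.+1) : Prop :=
  dualM m /\ forall u, s u -> 0 <= pairing m u.

(* Points of the affine toric variety U_s: homomorphisms from the semigroup
   [dual_semigroup s] to (C, * ), extended by 0 to Z^(n+1). *)
Definition affine_point (s : NR_set) (phi : 'rV[int]_n.+1 -> C) : Prop :=
  [/\ phi 0 = 1,
      forall m m', dual_semigroup s m -> dual_semigroup s m' ->
        phi (m + m') = phi m * phi m' &
      forall m, ~ dual_semigroup s m -> phi m = 0].

Definition affine_toric (s : NR_set) : space C :=
  @zariski C {phi | affine_point s phi}
    (fun f => exists2 m, dual_semigroup s m & forall p, f p = sval p m).

Variable Sigma : NR_set -> Prop.

(* (s, phi) and (s', phi') are glued when they come from a common point of the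
   affine toric variety of the intersection of s and s'. *)
Definition glued (p p' : NR_set * ('rV[int]_n.+1 -> C)) : Prop :=
  exists psi, [/\ affine_point (fun u => p.1 u /\ p'.1 u) psi,
    forall m, dual_semigroup p.1 m -> psi m = p.2 m &
    forall m, dual_semigroup p'.1 m -> psi m = p'.2 m].

Definition chart_point (p : NR_set * ('rV[int]_n.+1 -> C)) : Prop :=
  Sigma p.1 /\ affine_point p.1 p.2.

Definition glue_class p : NR_set * ('rV[int]_n.+1 -> C) -> Prop :=
  fun p' => chart_point p' /\ glued p p'.

Definition toric_point :=
  {P : NR_set * ('rV[int]_n.+1 -> C) -> Prop |
    exists p, chart_point p /\ P = glue_class p}.

Definition chart (s : {s | Sigma s}) (phi : affine_toric (sval s)) :
    toric_point :=
  exist _ (glue_class (sval s, sval phi))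
    (ex_intro _ (sval s, sval phi)
       (conj (conj (svalP s) (svalP phi)) erefl)).

(* T_N = Hom(M, C^* ) *)
Definition torus_point (t : 'rV[int]_n.+1 -> C) : Prop :=
  t 0 = 1 /\ forall m m', dualM m -> dualM m' -> t (m + m') = t m * t m'.

Definition toric_variety : tspace C :=
  @TSpace C (final_space chart)
    (fun f => exists2 t, torus_point t & forall x p,
       sval (f x) p <-> exists2 phi, sval x (p.1, phi) &
                          p.2 = (fun m => t m * phi m)).

End ToricVariety.

(** * Binary trees *)

Inductive bintree := Empty | Node of bintree & bintree.

Fixpoint nb_vertices (t : bintree) : nat :=
  if t is Node l r then (nb_vertices l + nb_vertices r).+1 else 0%N.

(* A vertex is identified with the path from the root to it: [false] stands for
   a left child, [true] for a right child. *)
Fixpoint vertex (t : bintree) (p : seq bool) : bool :=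
  match t, p with
  | Empty, _ => false
  | Node _ _, [::] => true
  | Node l r, b :: p' => vertex (if b then r else l) p'
  end.

Definition adjacent (p q : seq bool) : Prop :=
  exists b, q = rcons p b \/ p = rcons q b.

Definition unordered_iso (t t' : bintree) : Prop :=
  exists f : seq bool -> seq bool,
    [/\ set_bij [set p | vertex t p] [set p | vertex t' p] f, f [::] = [::] &
        forall p q, vertex t p -> vertex t q ->
          (adjacent p q <-> adjacent (f p) (f q))].

Definition unordered_class (t : bintree) : set bintree :=
  [set t' | unordered_iso t t'].

Definition unordered_bintrees (n : nat) : set (set bintree) :=
  [set U | exists2 t, nb_vertices t = n & U = unordered_class t].

(** * Polygon triangulations *)

Section Triangulation.
Variable n : nat.

(* The edge {a, b} with a < b is represented by the pair (a, b). *)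
Local Notation edge := ('I_n.+2 * 'I_n.+2)%type.

Definition polygon_sides : {set edge} :=
  [set x : edge | (x.1.+1 == x.2 :> nat) || ((x.1 == 0 :> nat) && (x.2 == n.+1 :> nat))].

Definition crossing (x y : edge) : bool :=
  [&& (x.1 < y.1)%N, (y.1 < x.2)%N & (x.2 < y.2)%N].

Definition triangulation (T : {set edge}) : Prop :=
  [/\ polygon_sides \subset T,
      forall x, x \in T -> (x.1 < x.2)%N,
      forall x y, x \in T -> y \in T -> ~~ crossing x y &
      #|T :\: polygon_sides| = n.-1].

Variable T : {set edge}.

(* The third vertex of the triangle containing the distinguished edge {a, b} of
   the polygon with vertices a, a+1, ..., b; None if that is a single edge. *)
Definition apex (a b : 'I_n.+2) : option 'I_n.+2 :=
  [pick c : 'I_n.+2 | [&& (a < c)%N, (c < b)%N, (a, c) \in T & (c, b) \in T]].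

Inductive side := SideL | SideR.

(* The values of F on the edges of the polygon a, ..., b other than {a, b}.
   As labels increase counterclockwise, {a, c}, {c, b}, {a, b} are placed
   counterclockwise. The natural number bounds the depth of the recursion, for
   which the number n of triangles suffices. *)
Fixpoint labelling (k : nat) (a b : 'I_n.+2) (x : edge) (s : side) : Prop :=
  if k is k'.+1 then
    if apex a b is Some c then
      [\/ x = (a, c) /\ s = SideL, x = (c, b) /\ s = SideR,
          labelling k' a c x s | labelling k' c b x s]
    else False
  else False.

Definition F : edge -> side -> Prop := labelling n ord0 ord_max.

Definition left_parent (k : 'I_n.+2) : 'I_n.+2 :=
  odflt ord0 [pick j : 'I_n.+2 | (j < k)%N && `[< F (j, k) SideL >]].

Definition right_parent (k : 'I_n.+2) : 'I_n.+2 :=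
  odflt ord_max [pick j : 'I_n.+2 | (k < j)%N && `[< F (k, j) SideR >]].

Definition varpi (i : 'I_n.+2) : 'rV[int]_n.+1 := \row_(j < n.+1) (j < i)%:R.

Definition v_vect (k : 'I_n.+2) : 'rV[int]_n.+1 :=
  varpi k - varpi (right_parent k).

Definition w_vect (k : 'I_n.+2) : 'rV[int]_n.+1 :=
  varpi (left_parent k) - varpi k.

Definition in_range (k : 'I_n.+2) : bool := (0 < k < n.+1)%N.

Definition catalan_fan (R : realType) : NR_set R n -> Prop :=
  fun s => exists Q : seq 'rV[int]_n.+1,
    [/\ forall q, q \in Q ->
          exists2 k, in_range k & q = v_vect k \/ q = w_vect k,
        forall k, in_range k -> ~~ ((v_vect k \in Q) && (w_vect k \in Q)) &
        s = Cone Q].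

Fixpoint triangle_tree_rec (k : nat) (a b : 'I_n.+2) : bintree :=
  if k is k'.+1 then
    if apex a b is Some c then
      Node (triangle_tree_rec k' a c) (triangle_tree_rec k' c b)
    else Empty
  else Empty.

Definition triangle_tree : bintree := triangle_tree_rec n ord0 ord_max.

End Triangulation.

Definition catalan_variety (R : realType) (n : nat)
    (T : {set 'I_n.+2 * 'I_n.+2}) : tspace R[i] :=
  toric_variety (catalan_fan T (R := R)).

Definition catalan_type (R : realType) (X : tspace R[i]) : Prop :=
  exists m (T : {set 'I_m.+2 * 'I_m.+2}),
    [/\ (0 < m)%N, triangulation T & toric_iso X (catalan_variety R T)].

(** * Richardson varieties *)

Definition inversions (m : nat) (s : 'S_m) : nat :=
  #|[set x : 'I_m * 'I_m | (x.1 < x.2)%N && (s x.2 < s x.1)%N]|.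

Definition bruhat_step (m : nat) (u v : 'S_m) : bool :=
  [exists i, [exists j,
    (v == (tperm i j * u)%g) && (inversions u < inversions v)%N]].

Definition bruhat_le (m : nat) (u v : 'S_m) : bool :=
  connect (@bruhat_step m) u v.

Definition longest (m : nat) : 'S_m := perm (@rev_ord_inj m).

Section FlagVariety.
Variables (R : realType) (m : nat).
Local Notation C := (R[i]).
Local Notation mat := 'M[C]_m.+1.

Definition GL : space C :=
  @zariski C {g : mat | g \in unitmx}
    (fun f => exists i j, forall g, f g = sval g i j).

Definition borel (b : mat) : Prop :=
  b \in unitmx /\ forall i j : 'I_m.+1, (j < i)%N -> b i j = 0.

Definition diagonal_torus (t : mat) : Prop := t \in unitmx /\ is_diag_mx t.

Definition coset (g : mat) : mat -> Prop :=
  fun h => exists2 b, borel b & h = g *m b.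

Definition flag :=
  {P : mat -> Prop | exists g : GL, P = coset (sval g)}.

Definition flag_proj (g : GL) : flag :=
  exist _ (coset (sval g)) (ex_intro _ g erefl).

Definition flag_variety : space C :=
  @final_space C unit (fun=> GL) flag (fun=> flag_proj).

(* y = g x for the action of G on G/B *)
Definition translate (g : mat) (x y : flag_variety) : Prop :=
  forall h, sval y h <-> exists2 h', sval x h' & h = g *m h'.

(* The matrix sending the basis vector e_j to e_(w j). *)
Definition wmat (w : 'S_m.+1) : mat := \matrix_(i, j) (i == w j)%:R.

Definition schubert (w : 'S_m.+1) : flag_variety -> Prop :=
  closure_in (fun x : flag_variety =>
    exists b (g : GL), [/\ borel b, sval g = b *m wmat w & x = flag_proj g]).

(* The product of permutations in the library is (s * t) i = t (s i), so the
   composite w_0 v is written v * w_0. *)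
Definition richardson_set (v w : 'S_m.+1) : flag_variety -> Prop :=
  fun x => schubert w x /\
    exists2 y, schubert (v * longest m.+1)%g y &
               translate (wmat (longest m.+1)) y x.

Definition richardson (v w : 'S_m.+1) : tspace C :=
  @TSpace C (subspace (richardson_set v w))
    (fun f => exists2 t, diagonal_torus t &
       forall x, translate t (sval x) (sval (f x))).

End FlagVariety.

Definition has_dense_orbit (K : fieldType) (X : tspace K) : Prop :=
  exists x : X, forall y : X,
    closure_in (fun z : X => exists2 f : X -> X, torus f & z = f x) y.

Definition toric_richardson (R : realType) (X : tspace R[i]) : Prop :=
  exists m (v w : 'S_m.+1),
    [/\ bruhat_le v w, X = richardson R v w & has_dense_orbit X].

(* f induces a bijection from the set of isomorphism classes of members of D
   to A. *)
Definition classifies (K : fieldType) (A : set (set bintree))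
    (D : tspace K -> Prop) (f : tspace K -> set bintree) : Prop :=
  [/\ forall X, D X -> A (f X),
      forall X Y, D X -> D Y -> (f X = f Y <-> toric_iso X Y) &
      forall U, A U -> exists2 X, D X & f X = U].

(** * Wedderburn-Etherington numbers *)

(* The value at k >= 2 in terms of the values b at smaller indices. *)
Definition we_step (b : nat -> nat) (k : nat) : nat :=
  ((if odd k then 0 else (b k./2 * (b k./2).+1) %/ 2)
   + \sum_(1 <= i < uphalf k) b i * b (k - i))%N.

Fixpoint we_table (k : nat) : seq nat :=
  match k with
  | 0 => [:: 0]
  | 1 => [:: 0; 1]
  | k'.+1 => let s := we_table k' in rcons s (we_step (nth 0 s) k)
  end%N.

Definition wedderburn_etherington (k : nat) : nat := nth 0%N (we_table k) k.

Lemma size_we_table k : size (we_table k) = k.+1.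
Proof. by elim: k => // -[|k] // IH; rewrite /= size_rcons -[X in size X]/(we_table k.+1) IH. Qed.

Lemma nth_we_table k i : (i <= k)%N ->
  nth 0%N (we_table k) i = wedderburn_etherington i.
Proof.
elim: k => [|k IH]; first by rewrite leqn0 => /eqP ->.
rewrite leq_eqVlt => /predU1P[-> // | ik]; rewrite -IH //.
case: k {IH} ik => [|k] ik; first by case: i ik.
by rewrite -[we_table k.+2]/(rcons (we_table k.+1) _) nth_rcons size_we_table ik.
Qed.

Lemma wedderburn_etheringtonE k : (1 < k)%N ->
  wedderburn_etherington k = we_step wedderburn_etherington k.
Proof.
case: k => [|[|k]] // _; rewrite {1}/wedderburn_etherington.
rewrite -[we_table k.+2]/(rcons (we_table k.+1) _) nth_rcons size_we_table.
rewrite ltnn eqxx -[X in we_step X _]/(nth 0%N (we_table k.+1)) /we_step.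
have hk : (k./2 <= k)%N by rewrite leq_half_double -addnn leqW ?leq_addr.
congr (_ + _)%N; first by rewrite !nth_we_table //= ltnS.
apply: eq_big_nat => i /andP[i0 ik]; rewrite !nth_we_table //.
  by rewrite leq_subLR -addn1 addnC leq_add2r.
have hk' : (uphalf k <= k)%N by rewrite uphalfE leq_half_double ltnS -addnn leq_addr.
by move: ik; rewrite /= ltnS => /leq_trans -> //; rewrite (leq_trans hk').
Qed.

Lemma wedderburn_etherington1 : wedderburn_etherington 1 = 1%N.
Proof. by []. Qed.

Lemma wedderburn_etherington_odd m : (2 <= m)%N ->
  wedderburn_etherington (2 * m - 1) =
  (\sum_(1 <= i < m) wedderburn_etherington i *
                     wedderburn_etherington (2 * m - i - 1))%N.
Proof.
case: m => [|m] // m1; have -> : (2 * m.+1 - 1 = m.*2.+1)%N by rewrite mul2n subn1.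
rewrite wedderburn_etheringtonE; last by rewrite ltnS double_gt0.
rewrite /we_step oddS odd_double add0n uphalfE -doubleS doubleK.
by apply: eq_bigr => i _; rewrite mul2n subnAC subn1.
Qed.

Lemma wedderburn_etherington_even m : (1 <= m)%N ->
  wedderburn_etherington (2 * m) =
  (wedderburn_etherington m * (wedderburn_etherington m).+1 %/ 2 +
   \sum_(1 <= i < m) wedderburn_etherington i *
                     wedderburn_etherington (2 * m - i))%N.
Proof.
move=> m0; rewrite wedderburn_etheringtonE; last by case: m m0 => // m _; rewrite mul2n doubleS.
by rewrite /we_step mul2n odd_double doubleK uphalf_double.
Qed.

(* Main.v *)
(* A binary tree t with n vertices has a Cox ring with two coordinates z q 0 and
   z q 1 for every vertex q; no such pair vanishes simultaneously, and a torus
   (K^* )^n acts with weights read off from the tree. The quotient is a tower of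
   projective lines, and [presents] says that a variety is this quotient. It
   depends on the tree only up to exchange of left and right. The unordered tree
   is recovered from the boundary divisors D(q,b) = {z q b = 0}, which come in
   disjoint pairs, one for each vertex: q is the child of p on the side c exactly
   when, on the complement of all divisors but D(q,0), D(q,1) and D(p,c), the union
   of D(q,b) and D(p,c) is the zero set of a regular function but D(q,b) is not.

   The toric variety of a triangulation T is such a quotient for the tree of T, as
   the rays of its fan are minus the sums of the basis vectors over the leaves
   below a child of a vertex. So is the Richardson variety of v <= w, where v lists
   0 and then the inorder numbers of the vertices in preorder, and w the numbers n
   and v(l) - 1. For z in the Cox space and a node y let u_y be the vector whose
   coordinate at a leaf j is the product of the coordinates z on the path from y to
   j, so that u_q = z q 0 u_(q0) + z q 1 u_(q1). The l-th space of the flag of z is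
   spanned by the root vector and the vectors of the children of the first l
   vertices. Conversely, the rank conditions of the Richardson variety leave room
   for one line only, in a suitable space of the flag, of vectors supported below a
   given node, and these lines give z back. *)

From HB Require Import structures.
From mathcomp Require Import all_boot all_order all_algebra all_fingroup.
From mathcomp Require Import all_classical all_reals.
From mathcomp Require Import complex.
From mathcomp Require Import zify ring.
Require Import Defs.

Set Implicit Arguments.
Unset Strict Implicit.
Unset Printing Implicit Defensive.

Import Order.TTheory GRing.Theory Num.Theory.

(** * Spaces with functions *)

(** The two kinds of variety have unrelated constructions, glued semigroup homomorphisms and a
    closed set of cosets, so no map between them is written down. [presents] fixes points, topology,
    regular functions and torus by the Cox space, hence two varieties presented by equivalent trees
    are isomorphic. Conversely, an isomorphism is only known to respect open sets, regular functions
    and the torus. Closures of torus orbits show that it permutes the boundary divisors. Whether a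
    function with prescribed zeros exists is a matter of weights: two paths from the same node have
    products of equal weight, and their quotient is a function; where no such quotient serves, there
    is a projective line on which the function would have a single zero, which is impossible. The
    permutations v and w are made so that column l of the tree matrix starts at row v(l) when the
    columns stand for right children and ends at row w(l) when they stand for left children. The
    dimension is bounded above by counting monomials, since n + 1 functions of n variables are
    dependent, and below by a chain of orbit closures. *)

Section Zariski.
Local Open Scope ring_scope.
Variables (K : fieldType) (P : Type) (S : (P -> K) -> Prop).
Local Notation Z := (zariski S).
Implicit Types (U V W : Z -> Prop) (f g h : P -> K).

Lemma zariski_openT : is_open (fun _ : Z => True).
Proof.
by move=> p _; exists (fun=> 1); split=> //; [exact: Polyfun_const | exact: oner_neq0].
Qed.

Lemma zariski_open_local U :
  (forall p, U p -> exists V, [/\ is_open V, V p & forall q, V q -> U q]) ->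
  is_open U.
Proof.
move=> loc p Up; have [V [oV Vp VU]] := loc p Up.
have [h [ph hp hV]] := oV p Vp.
by exists h; split=> // q /hV /VU.
Qed.

Lemma zariski_open_neq0 h : polyfun S h -> is_open (fun p : Z => h p != 0).
Proof. by move=> ph p hp; exists h. Qed.

Lemma regular_local U f :
  (forall p, U p -> exists W, [/\ is_open W, W p & regular (fun q => U q /\ W q) f]) ->
  regular U f.
Proof.
move=> loc p Up; have [W [oW Wp rf]] := loc p Up.
have [h0 [ph0 h0p h0W]] := oW p Wp.
have [g [h [pg ph hp fE]]] := rf p (conj Up Wp).
(* Multiplying both terms by [h0] confines the non-vanishing locus of the denominator to [W]. *)
exists (fun q => g q * h0 q), (fun q => h q * h0 q); split; try exact: Polyfun_mul.
  by rewrite mulf_neq0.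
move=> q Uq; rewrite mulf_eq0 negb_or => /andP[hq h0q].
by rewrite -mulf_div divff // mulr1; apply: fE => //; split=> //; apply: h0W.
Qed.

Lemma regular_eq U f g : (forall p, U p -> f p = g p) -> regular U f -> regular U g.
Proof.
move=> fg rf p Up; have [a [b [pa pb bp fE]]] := rf p Up.
by exists a, b; split=> // q Uq bq; rewrite -fg // fE.
Qed.

Lemma regularS U V f : (forall p, V p -> U p) -> regular U f -> regular V f.
Proof.
move=> VU rf p Vp; have [a [b [pa pb bp fE]]] := rf p (VU p Vp).
by exists a, b; split=> // q /VU; apply: fE.
Qed.

Lemma regular_poly U g : polyfun S g -> regular U g.
Proof.
move=> pg p _; exists g, (fun=> 1); split=> //.
- exact: Polyfun_const.
- exact: oner_neq0.
- by move=> q _ _; rewrite divr1.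
Qed.

Lemma regular_cst U c : regular U (fun=> c).
Proof. exact/regular_poly/Polyfun_const. Qed.

Lemma regularD U f g : regular U f -> regular U g -> regular U (fun p => f p + g p).
Proof.
move=> rf rg p Up.
have [a [b [pa pb bp fE]]] := rf p Up; have [c [d [pc pd dp gE]]] := rg p Up.
exists (fun q => a q * d q + c q * b q), (fun q => b q * d q); split.
- by apply: Polyfun_add; apply: Polyfun_mul.
- exact: Polyfun_mul.
- by rewrite mulf_neq0.
- move=> q Uq; rewrite mulf_eq0 negb_or => /andP[bq dq].
  by rewrite fE // gE // addf_div.
Qed.

Lemma regularM U f g : regular U f -> regular U g -> regular U (fun p => f p * g p).
Proof.
move=> rf rg p Up.
have [a [b [pa pb bp fE]]] := rf p Up; have [c [d [pc pd dp gE]]] := rg p Up.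
exists (fun q => a q * c q), (fun q => b q * d q); split; try exact: Polyfun_mul.
  by rewrite mulf_neq0.
move=> q Uq; rewrite mulf_eq0 negb_or => /andP[bq dq].
by rewrite fE // gE // mulf_div.
Qed.

Lemma regularV U f :
  (forall p, U p -> f p != 0) -> regular U f -> regular U (fun p => (f p)^-1).
Proof.
move=> f0 rf p Up; have [a [b [pa pb bp fE]]] := rf p Up.
have ap : a p != 0 by have := f0 p Up; rewrite fE // mulf_eq0 negb_or => /andP[].
(* The common factor [b] makes the new denominator vanish wherever [b] does, where the formula for
   [f] says nothing. *)
exists (fun q => b q * b q), (fun q => a q * b q); split; try exact: Polyfun_mul.
  by rewrite mulf_neq0.
move=> q Uq; rewrite mulf_eq0 negb_or => /andP[aq bq].
by rewrite fE // invf_div -mulf_div divff // mulr1.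
Qed.

Lemma regular_sum U (I : Type) (s : seq I) (F : I -> P -> K) :
  (forall i, regular U (F i)) -> regular U (fun p => \sum_(i <- s) F i p).
Proof.
move=> rF; elim: s => [|i s IH].
  by apply: regular_eq (regular_cst 0) => p _; rewrite big_nil.
by apply: regular_eq (regularD (rF i) IH) => p _; rewrite big_cons.
Qed.

Lemma regular_open_neq0 U f :
  is_open U -> regular U f -> is_open (fun p : Z => U p /\ f p != 0).
Proof.
move=> oU rf p [Up fp]; have [a [b [pa pb bp fE]]] := rf p Up.
have [h [ph hp hU]] := oU p Up.
have ap : a p != 0 by move: fp; rewrite fE // mulf_eq0 negb_or => /andP[].
exists (fun q => a q * (b q * h q)); split.
- by apply: Polyfun_mul => //; apply: Polyfun_mul.
- by rewrite !mulf_neq0.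
- move=> q; rewrite !mulf_eq0 !negb_or => /and3P[aq bq hq].
  by split; [exact: hU | rewrite fE ?mulf_neq0 ?invr_eq0 //; exact: hU].
Qed.

Lemma polyfun_prod (I : Type) (s : seq I) (F : I -> P -> K) :
  (forall i, polyfun S (F i)) -> polyfun S (fun p => \prod_(i <- s) F i p).
Proof.
move=> pF; elim: s => [|i s IH].
  have -> : (fun p => \prod_(i <- [::]) F i p) = fun=> 1.
    by apply/funext => p; rewrite big_nil.
  exact: Polyfun_const.
have -> : (fun p => \prod_(j <- i :: s) F j p) =
          fun p => F i p * \prod_(j <- s) F j p.
  by apply/funext => p; rewrite big_cons.
exact: Polyfun_mul.
Qed.

Lemma polyfun_sum (I : Type) (s : seq I) (F : I -> P -> K) :
  (forall i, polyfun S (F i)) -> polyfun S (fun p => \sum_(i <- s) F i p).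
Proof.
move=> pF; elim: s => [|i s IH].
  have -> : (fun p => \sum_(i <- [::]) F i p) = fun=> 0.
    by apply/funext => p; rewrite big_nil.
  exact: Polyfun_const.
have -> : (fun p => \sum_(j <- i :: s) F j p) =
          fun p => F i p + \sum_(j <- s) F j p.
  by apply/funext => p; rewrite big_cons.
exact: Polyfun_add.
Qed.

End Zariski.

Section ZariskiMaps.
Local Open Scope ring_scope.
Variables (K : fieldType) (P Q : Type) (S : (P -> K) -> Prop) (S' : (Q -> K) -> Prop).
Variables (phi : P -> Q) (U : zariski S -> Prop).
Hypothesis phi_regular : forall c, S' c -> regular U (fun p => c (phi p)).

Lemma regular_polyfun_comp g : polyfun S' g -> regular U (fun p => g (phi p)).
Proof.
elim=> [c | f Sf | f h _ rf _ rh | f h _ rf _ rh].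
- exact: regular_cst.
- exact: phi_regular.
- exact: regularD.
- exact: regularM.
Qed.

(** [phi] is controlled on [U] only: the maps between the Cox space, [GL] and the affine charts are
    total functions that are meaningful on an open subset. *)
Lemma local_preimage_open (V : zariski S' -> Prop) :
  is_open U -> is_open V -> is_open (fun p : zariski S => U p /\ V (phi p)).
Proof.
move=> oU oV; apply: zariski_open_local => p [Up Vp].
have [h [ph hp hV]] := oV _ Vp.
exists (fun q => U q /\ h (phi q) != 0); split=> //.
  exact: regular_open_neq0 oU (regular_polyfun_comp ph).
by move=> q [Uq hq]; split=> //; apply: hV.
Qed.

Lemma local_pullback_regular (V : zariski S' -> Prop) f :
  is_open U -> regular V f ->
  regular (fun p : zariski S => U p /\ V (phi p)) (fun p => f (phi p)).
Proof.
move=> oU rf; apply: regular_local => p [Up Vp].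
have [g [h [pg ph hp fE]]] := rf _ Vp.
exists (fun q => U q /\ h (phi q) != 0); split=> //.
  exact: regular_open_neq0 oU (regular_polyfun_comp ph).
apply: (@regular_eq _ _ _ _ (fun q => g (phi q) * (h (phi q))^-1)).
  by move=> q [[_ Vq] [_ hq]]; rewrite fE.
apply: regularM.
  by apply: regularS (regular_polyfun_comp pg) => q [[]].
apply: regularV; first by move=> q [_ []].
by apply: regularS (regular_polyfun_comp ph) => q [[]].
Qed.

End ZariskiMaps.

Lemma polyfun_comp (K : fieldType) (P Q : Type) (S : (P -> K) -> Prop)
    (S' : (Q -> K) -> Prop) (phi : P -> Q) g :
  (forall c, S' c -> polyfun S (fun p => c (phi p))) ->
  polyfun S' g -> polyfun S (fun p => g (phi p)).
Proof.
move=> pc; elim=> [c | f Sf | f h _ rf _ rh | f h _ rf _ rh].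
- exact: Polyfun_const.
- exact: pc.
- exact: Polyfun_add.
- exact: Polyfun_mul.
Qed.

Lemma poly_map_morphism (K : fieldType) (P Q : Type) (S : (P -> K) -> Prop)
    (S' : (Q -> K) -> Prop) (phi : zariski S -> zariski S') :
  (forall c, S' c -> polyfun S (fun p => c (phi p))) -> morphism_of_spaces phi.
Proof.
move=> pc V oV.
have reg c : S' c -> regular (fun _ : zariski S => True) (fun p => c (phi p)).
  by move=> /pc; apply: regular_poly.
split.
  have -> : (fun x => V (phi x)) = (fun x => True /\ V (phi x)).
    by apply/funext => x; apply/propext; split=> // -[].
  exact: (@local_preimage_open K P Q S S' phi (fun=> True) reg V (@zariski_openT K P S) oV).
move=> g rg.
by apply: regularS (@local_pullback_regular K P Q S S' phi (fun=> True) reg V g (@zariski_openT K P S) rg) => p.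
Qed.

(** * Binary trees *)

Section Trees.
Implicit Types (t l r : bintree) (p q : seq bool) (b : bool).

Fixpoint subtree t q {struct q} : bintree :=
  match q, t with
  | [::], _ => t
  | b :: q', Node l r => subtree (if b then r else l) q'
  | _ :: _, Empty => Empty
  end.

Lemma subtree_rcons t q b :
  subtree t (rcons q b) =
  if subtree t q is Node l r then (if b then r else l) else Empty.
Proof. by elim: q t => [|a q IH] [|l r] //=. Qed.

Lemma vertexE t q : vertex t q = if subtree t q is Node _ _ then true else false.
Proof. by elim: q t => [|b q IH] [|l r] //=; rewrite IH. Qed.

Lemma vertex_rcons t q b : vertex t (rcons q b) -> vertex t q.
Proof. by rewrite !vertexE subtree_rcons; case: subtree. Qed.

(** Induction from the leaves upwards, on the size of the subtree. Every path that is not a vertex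
    is a base case, so a recursive function only needs its value off the tree and its equation at a
    vertex. *)
Lemma path_ind t (P : seq bool -> Prop) :
  (forall q, ~~ vertex t q -> P q) ->
  (forall q, vertex t q -> (forall b, P (rcons q b)) -> P q) ->
  forall q, P q.
Proof.
move=> P0 P1 q; have [m] := ubnP (nb_vertices (subtree t q)).
elim: m q => // m IH q; case Et: (subtree t q) => [|l r] /= qm.
  by apply: P0; rewrite vertexE Et.
apply: P1 => [|b]; first by rewrite vertexE Et.
apply: IH; rewrite subtree_rcons Et; rewrite -ltnS; case: b; apply: leq_trans qm.
  by rewrite !ltnS leq_addl.
by rewrite !ltnS leq_addr.
Qed.

Fixpoint vertices t : seq (seq bool) :=
  if t is Node l r then
    [::] :: map (cons false) (vertices l) ++ map (cons true) (vertices r)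
  else [::].

Lemma mem_vertices t q : (q \in vertices t) = vertex t q.
Proof.
elim: t q => [|l IHl r IHr] //= q; rewrite inE mem_cat.
case: q => [|b q] //=.
apply/orP/idP => [[] /mapP[p]|vq].
- by rewrite IHl => vp [-> ->].
- by rewrite IHr => vp [-> ->].
- by case: b vq => vq; [right | left]; apply: map_f; rewrite ?IHl ?IHr.
Qed.

Lemma uniq_vertices t : uniq (vertices t).
Proof.
elim: t => [|l IHl r IHr] //=; rewrite mem_cat cat_uniq !map_inj_uniq.
- rewrite IHl IHr /= andbT; apply/andP; split.
    by apply/norP; split; apply/mapP => -[].
  by apply/hasPn => p /mapP[p1 _ ->]; apply/mapP => -[p2 _ []].
- by move=> p p' [].
- by move=> p p' [].
Qed.

Lemma size_vertices t : size (vertices t) = nb_vertices t.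
Proof. by elim: t => [|l IHl r IHr] //=; rewrite size_cat !size_map IHl IHr. Qed.

Definition nb_leaves t := (nb_vertices t).+1.

(* [lo t q] and [hi t q] delimit the leaves below q, numbered from left to
   right; [mid t q] is the inorder number, counted from 1, of the vertex q. *)
Fixpoint lo t q {struct q} : nat :=
  match q, t with
  | b :: q', Node l r => if b then nb_leaves l + lo r q' else lo l q'
  | _, _ => 0
  end.
Definition hi t q := lo t q + nb_leaves (subtree t q).
Definition mid t q := lo t (rcons q true).

Lemma lo_left t q : vertex t q -> lo t (rcons q false) = lo t q.
Proof.
elim: q t => [|b q IH] [|l r] //= vq.
by case: b vq => vq; rewrite IH.
Qed.

Lemma mid_add t q : vertex t q ->
  mid t q = lo t q + nb_leaves (subtree t (rcons q false)).
Proof.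
rewrite /mid; elim: q t => [|b q IH] [|l r] //= vq; first by rewrite addn0 add0n.
by case: b vq => vq; rewrite IH // ?addnA.
Qed.

Lemma hi_left t q : vertex t q -> hi t (rcons q false) = mid t q.
Proof. by move=> vq; rewrite /hi lo_left // mid_add. Qed.

Lemma lo_right t q : lo t (rcons q true) = mid t q. Proof. by []. Qed.

Lemma hi_right t q : vertex t q -> hi t (rcons q true) = hi t q.
Proof.
move=> vq; rewrite /hi lo_right mid_add // !subtree_rcons.
move: vq; rewrite vertexE; case: subtree => // l r _.
by rewrite -addnA /nb_leaves /= addnS addSn addnS.
Qed.

Lemma hi_leaf t q : ~~ vertex t q -> hi t q = (lo t q).+1.
Proof. by rewrite vertexE /hi; case: subtree => //= _; rewrite /nb_leaves addn1. Qed.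

Lemma lo_lt_hi t q : lo t q < hi t q.
Proof. by rewrite /hi /nb_leaves addnS ltnS leq_addr. Qed.

Lemma lo_lt_mid t q : vertex t q -> lo t q < mid t q.
Proof. by move=> vq; rewrite -hi_left // -lo_left // lo_lt_hi. Qed.

Lemma mid_lt_hi t q : vertex t q -> mid t q < hi t q.
Proof. by move=> vq; rewrite -hi_right // -lo_right lo_lt_hi. Qed.

Lemma lo_root t : lo t [::] = 0. Proof. by case: t. Qed.

Lemma hi_root t : hi t [::] = nb_leaves t. Proof. by rewrite /hi lo_root. Qed.

Lemma mid_cons l r b q :
  mid (Node l r) (b :: q) = if b then nb_leaves l + mid r q else mid l q.
Proof. by case: b. Qed.

Lemma mid_root l r : mid (Node l r) [::] = nb_leaves l.
Proof. by rewrite mid_add. Qed.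

Lemma hi_le t q : vertex t q -> hi t q <= nb_leaves t.
Proof.
elim: q t => [|b q IH] t vq; first by rewrite hi_root.
case: t vq => //= l r; rewrite /hi /=.
case: b => vq; have := IH _ vq; rewrite /hi /nb_leaves /=; lia.
Qed.

Lemma mid_bounds t q : vertex t q -> 0 < mid t q <= nb_vertices t.
Proof.
move=> vq; rewrite (leq_ltn_trans _ (lo_lt_mid vq)) //=.
by rewrite -ltnS (leq_trans (mid_lt_hi vq)) // hi_le.
Qed.

Lemma mid_inj t : {in vertex t &, injective (mid t)}.
Proof.
elim: t => [|l IHl r IHr] // [|b q] [|b' q'] //=; rewrite !unfold_in /=.
- move=> _ vq'; rewrite mid_root mid_cons; case: b' vq' => /mid_bounds; rewrite /nb_leaves; lia.
- move=> vq _; rewrite mid_root mid_cons; case: b vq => /mid_bounds; rewrite /nb_leaves; lia.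
move=> vq vq'; rewrite !mid_cons; case: b b' vq vq' => [] [] vq vq'.
- by move/addnI/IHr => ->.
- by move: (mid_bounds vq) (mid_bounds vq'); rewrite /nb_leaves; lia.
- by move: (mid_bounds vq) (mid_bounds vq'); rewrite /nb_leaves; lia.
- by move/IHl => ->.
Qed.

Lemma mid_surj t k : 0 < k <= nb_vertices t -> exists2 q, vertex t q & mid t q = k.
Proof.
elim: t k => [|l IHl r IHr] k /=; first by lia.
move=> kt; case: (ltngtP k (nb_leaves l)) => [kl|lk|->].
- have [|q vq qk] := IHl k; first by rewrite /nb_leaves in kl; lia.
  by exists (false :: q).
- have [|q vq qk] := IHr (k - nb_leaves l); first by rewrite /nb_leaves in lk *; lia.
  by exists (true :: q) => //; rewrite mid_cons qk; lia.
- by exists [::]; rewrite ?mid_root.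
Qed.

End Trees.

Section Walks.
Local Open Scope ring_scope.
Variable K : comNzRingType.
Implicit Types (t T : bintree) (q : seq bool) (z : seq bool -> bool -> K)
  (d : seq bool -> bool).

Fixpoint walk_from z d T q : K :=
  if T is Node l r then
    z q (d q) * walk_from z d (if d q then r else l) (rcons q (d q))
  else 1.

(* The product of the coordinates along the path that starts at q and chooses
   the child d p at each vertex p. *)
Definition walk t z d q := walk_from z d (subtree t q) q.

Lemma walk_vertex t z d q :
  vertex t q -> walk t z d q = z q (d q) * walk t z d (rcons q (d q)).
Proof. by rewrite /walk vertexE subtree_rcons; case: subtree. Qed.

Lemma walk_leaf t z d q : ~~ vertex t q -> walk t z d q = 1.
Proof. by rewrite /walk vertexE; case: subtree. Qed.

Definition toward t (j : nat) q := (mid t q <= j)%N.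

Definition below t (j : nat) q := (lo t q <= j < hi t q)%N.

Lemma below_child t j q b : vertex t q ->
  below t j (rcons q b) = below t j q && (b == toward t j q).
Proof.
rewrite /below /toward => vq; have := lo_lt_mid vq; have := mid_lt_hi vq.
case: b; rewrite ?lo_right ?hi_right ?lo_left ?hi_left //; case: (leqP (mid t q) j); lia.
Qed.

Lemma below_root t j : below t j [::] = (j < nb_leaves t)%N.
Proof. by rewrite /below lo_root hi_root. Qed.

(** These are the coordinates of the vector u_q of the overview. [toward t j] leads to the leaf j
    only from the nodes above it, whence the test [below]. *)
Definition leaf_coord t z q j : K := if below t j q then walk t z (toward t j) q else 0.

Lemma leaf_coord_vertex t z q j : vertex t q ->
  leaf_coord t z q j =
  z q false * leaf_coord t z (rcons q false) j + z q true * leaf_coord t z (rcons q true) j.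
Proof.
move=> vq; rewrite /leaf_coord !below_child // walk_vertex //.
case: below => /=; last by rewrite !mulr0 addr0.
by case: toward => /=; rewrite mulr0 ?add0r ?addr0.
Qed.

Lemma leaf_coord_leaf t z q j : ~~ vertex t q -> leaf_coord t z q j = (j == lo t q)%:R.
Proof.
move=> vq; rewrite /leaf_coord walk_leaf // /below hi_leaf // ltnS -eqn_leq eq_sym.
by case: eqP.
Qed.

End Walks.

(** * Isomorphism of unordered trees *)

Section TreeEquivalence.
Implicit Types (t l r : bintree) (p q : seq bool) (b : bool).

Fixpoint tree_eqv t t' : bool :=
  match t, t' with
  | Empty, Empty => true
  | Node l r, Node l' r' =>
      (tree_eqv l l' && tree_eqv r r') || (tree_eqv l r' && tree_eqv r l')
  | _, _ => false
  end.

(** The bijection acts on all paths, leaves included, because weights and coordinates are attached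
    to paths; [e p] tells whether the children of p are exchanged. *)
Lemma tree_eqv_path_map t t' : tree_eqv t t' ->
  exists (mu nu : seq bool -> seq bool) (e : seq bool -> bool),
    [/\ cancel mu nu, cancel nu mu, mu [::] = [::],
        forall p b, mu (rcons p b) = rcons (mu p) (b (+) e p) &
        forall p, vertex t' (mu p) = vertex t p].
Proof.
elim: t t' => [|l IHl r IHr] [|l' r'] //=.
  by exists id, id, (fun=> false); split=> // p b; rewrite addbF.
case/orP => /andP[/IHl[ml [nl [el [Kl Kl' l0 lr vl]]]] /IHr[mr [nr [er [Kr Kr' r0 rr vr]]]]].
  exists (fun p => if p is b :: p' then b :: (if b then mr p' else ml p') else [::]).
  exists (fun p => if p is b :: p' then b :: (if b then nr p' else nl p') else [::]).
  exists (fun p => if p is b :: p' then (if b then er p' else el p') else false).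
  split=> //.
  - by case=> // -[] p; rewrite ?Kl ?Kr.
  - by case=> // -[] p; rewrite ?Kl' ?Kr'.
  - by move=> [|[] p] b /=; rewrite ?addbF ?lr ?rr //; case: b; rewrite ?l0 ?r0.
  - by case=> // -[] p /=; rewrite ?vl ?vr.
exists (fun p => if p is b :: p' then ~~ b :: (if b then mr p' else ml p') else [::]).
exists (fun p => if p is b :: p' then ~~ b :: (if b then nl p' else nr p') else [::]).
exists (fun p => if p is b :: p' then (if b then er p' else el p') else true).
split=> //.
- by case=> // -[] p /=; rewrite ?Kl ?Kr.
- by case=> // -[] p /=; rewrite ?Kl' ?Kr'.
- by move=> [|[] p] b /=; rewrite ?addbT ?lr ?rr //; case: b; rewrite ?l0 ?r0.
- by case=> // -[] p /=; rewrite ?vl ?vr.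
Qed.

(** Preserving the relation of child to parent is enough: [f] keeps or exchanges the children of the
    root, and deleting the first letter of the paths gives such a map on each subtree. *)
Lemma tree_eqv_of_child_map t t' (f : seq bool -> seq bool) :
  (forall p, vertex t p -> vertex t' (f p)) ->
  {in vertex t &, injective f} ->
  (forall p', vertex t' p' -> exists2 p, vertex t p & f p = p') ->
  (vertex t [::] -> f [::] = [::]) ->
  (forall p b, vertex t (rcons p b) -> exists b', f (rcons p b) = rcons (f p) b') ->
  tree_eqv t t'.
Proof.
elim: t t' f => [|l IHl r IHr] t' f fv finj fsurj f0 fc.
  by case: t' fv fsurj => // l' r' _ /(_ [::] isT)[].
case: t' fv fsurj => [/(_ [::] isT) // | l' r' fv fsurj].
have {}f0 : f [::] = [::] by apply: f0.
pose sub (t : bintree) b := subtree t [:: b].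
have fb b : vertex (Node l r) [:: b] -> exists b', f [:: b] = [:: b'].
  by move=> vb; have [b' fE] := fc [::] b vb; exists b'; rewrite fE f0.
(* [e] tells whether [f] exchanges the children of the root; a single child determines it, and
   without children it is arbitrary. *)
have [e fe] : exists e, forall b, vertex (Node l r) [:: b] -> f [:: b] = [:: b (+) e].
  case vF: (vertex (Node l r) [:: false]); last first.
    case vT: (vertex (Node l r) [:: true]); last by exists false => -[]; rewrite ?vF ?vT.
    have [b' bE] := fb _ vT; exists (~~ b') => -[]; rewrite ?vF // bE.
    by case: b' {bE}.
  have [b0 b0E] := fb _ vF; exists b0 => -[] vb; last by rewrite b0E.
  have [b1 b1E] := fb _ vb; rewrite b1E.
  have : f [:: true] <> f [:: false] by move=> /(finj _ _ vb vF).
  by rewrite b1E b0E; case: b0 b1 {b0E b1E} => [] [].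
have vcons b p : vertex (Node l r) (b :: p) -> vertex (Node l r) [:: b].
  by rewrite /=; case: (if b then r else l) => //; case: p.
have hd b p : vertex (Node l r) (b :: p) -> f (b :: p) = (b (+) e) :: behead (f (b :: p)).
  elim/last_ind: p => [|p c IH] vp; first by rewrite fe.
  have vp' : vertex (Node l r) (b :: p) by move: vp; rewrite -rcons_cons => /vertex_rcons.
  have [c' cE] := fc (b :: p) c vp.
  by rewrite rcons_cons in cE; rewrite cE IH.
have sub_eqv b : tree_eqv (if b then r else l) (if b (+) e then r' else l').
  have IH : forall t' f', (forall p, vertex (if b then r else l) p -> vertex t' (f' p)) ->
      {in vertex (if b then r else l) &, injective f'} ->
      (forall p', vertex t' p' -> exists2 p, vertex (if b then r else l) p & f' p = p') ->
      (vertex (if b then r else l) [::] -> f' [::] = [::]) ->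
      (forall p c, vertex (if b then r else l) (rcons p c) ->
          exists b', f' (rcons p c) = rcons (f' p) b') ->
      tree_eqv (if b then r else l) t'.
    by case: (b); [exact: IHr | exact: IHl].
  apply: (IH _ (fun p => behead (f (b :: p)))).
  - by move=> p vp; have := fv (b :: p) vp; rewrite hd.
  - move=> p p' vp vp' E; have := finj (b :: p) (b :: p') vp vp'.
    by rewrite (hd _ _ vp) (hd _ _ vp') E => /(_ erefl)[].
  - move=> p' vp'; have [[|b1 p] vp pE] := fsurj ((b (+) e) :: p') vp'.
      by rewrite f0 in pE.
    move: pE; rewrite (hd _ _ vp) => -[/addIb b1E pE].
    by exists p; rewrite -b1E.
  - by move=> vp; rewrite fe.
  - move=> p c vp; have [b' E] := fc (b :: p) c vp.
    rewrite rcons_cons in E; exists b'; rewrite E.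
    have vp' : vertex (Node l r) (b :: p) by move: vp => /vertex_rcons.
    by rewrite (hd _ _ vp').
have := sub_eqv true; have := sub_eqv false.
by case: e {fe hd sub_eqv} => /= -> ->; rewrite ?orbT.
Qed.

Lemma unordered_isoP t t' : unordered_iso t t' <-> tree_eqv t t'.
Proof.
split=> [[f [[ff fi fs] f0 fadj]] | /tree_eqv_path_map[mu [nu [e [Km Kn m0 mr mv]]]]].
  have fv p : vertex t p -> vertex t' (f p) by move=> vp; apply: ff.
  have finj p q : vertex t p -> vertex t q -> f p = f q -> p = q.
    by move=> vp vq; apply: fi; rewrite inE.
  have fc p b : vertex t (rcons p b) -> exists b', f (rcons p b) = rcons (f p) b'.
    elim/last_ind: p b => [|p c IH] b vb.
      have [+ _] := fadj [::] [:: b] (vertex_rcons vb) vb.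
      case; first by exists b; left.
      by move=> b' []; rewrite f0 // => E; [exists b' | case: (f _) E].
    have vp := vertex_rcons vb; have [+ _] := fadj _ _ vp vb.
    case; first by exists b; left.
    move=> b' [] E; first by exists b'.
    (* Otherwise the image is the parent of [f (rcons p c)], which is [f p], against injectivity. *)
    have [c' E'] := IH c vp; rewrite E' in E.
    have [Ep _] := rcons_inj E.
    have /(congr1 size) := finj _ _ (vertex_rcons vp) vb Ep.
    by rewrite !size_rcons; lia.
  exact: (@tree_eqv_of_child_map t t' f).
exists mu; split=> //.
  split=> [p /= vp | p q _ _ /(can_inj Km) // | p' /= vp'].
    by rewrite mv.
  by exists (nu p'); rewrite ?Kn //= -mv Kn.
move=> p q _ _; split=> -[b [] E].
- by exists (b (+) e p); left; rewrite E mr.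
- by exists (b (+) e q); right; rewrite E mr.
- by exists (b (+) e p); left; apply: (can_inj Km); rewrite E mr addbK.
- by exists (b (+) e q); right; apply: (can_inj Km); rewrite E mr addbK.
Qed.

End TreeEquivalence.

(** * Homogeneous coordinates *)

Section Presentations.
Local Open Scope ring_scope.
Variable K : fieldType.
Implicit Types (t : bintree) (X Y : tspace K).

Definition nondegenerate t (z : seq bool -> bool -> K) : Prop :=
  forall q, vertex t q -> z q false != 0 \/ z q true != 0.

Definition cox_coord t : ({z | nondegenerate t z} -> K) -> Prop :=
  fun f => exists q b, vertex t q /\ f = (fun z => sval z q b).

(* The total coordinate space of the toric variety attached to t: the two
   coordinates [z q false] and [z q true] at a vertex q belong to the divisors
   of the rays of q; they have weight [lam q] under the torus (K^* )^n, and
   weight [(lam (rcons q b))^-1] is added when the child at b is a vertex. *)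
Definition cox t : space K := zariski (@cox_coord t).

Lemma cox_eq t (z z' : cox t) : sval z = sval z' -> z = z'.
Proof.
case: z z' => [z zt] [z' zt'] /= E; case: z' / E zt' => zt'.
by rewrite (Prop_irrelevance zt zt').
Qed.

Definition cox_equiv t (z z' : seq bool -> bool -> K) : Prop := exists lam : seq bool -> K,
  [/\ forall q, lam q != 0, forall q, ~~ vertex t q -> lam q = 1 &
      forall q b, vertex t q -> z' q b * lam (rcons q b) = lam q * z q b].

(** Openness and regularity are equivalences, so [r] alone determines the structure of [Y]. The
    torus is a set of self-maps, and the last field says which self-maps belong to it: those induced
    by rescaling the coordinates. *)
Record presents t Y (r : cox t -> Y) : Prop := Presents {
  presents_surj : forall y, exists z, r z = y;
  presents_fiber : forall z z', r z = r z' <-> cox_equiv t (sval z) (sval z');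
  presents_open : forall A : Y -> Prop, is_open A <-> is_open (fun z => A (r z));
  presents_regular : forall (U : Y -> Prop) f, is_open U ->
    (regular U f <-> regular (fun z => U (r z)) (fun z => f (r z)));
  presents_torus : forall s : Y -> Y, torus s <->
    exists2 c : seq bool -> bool -> K, forall q b, c q b != 0 &
      forall z z' : cox t,
        (forall q b, vertex t q -> sval z' q b = c q b * sval z q b) ->
        s (r z) = r z' }.

Lemma cox_equiv_refl t z : cox_equiv t z z.
Proof.
by exists (fun=> 1); split=> // [q|q b _]; [exact: oner_neq0 | rewrite mul1r mulr1].
Qed.

Lemma cox_equiv_sym t z z' : cox_equiv t z z' -> cox_equiv t z' z.
Proof.
case=> lam [l0 l1 lE]; exists (fun q => (lam q)^-1); split=> [q|q vq|q b vq].
- by rewrite invr_eq0.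
- by rewrite l1 // invr1.
- have := lE q b vq; move: (l0 q) (l0 (rcons q b)) => a0 b0 E.
  by apply: (mulfI a0); rewrite mulrA -E mulfK // mulVKf.
Qed.

Lemma cox_equiv_neq0 t z z' q b :
  vertex t q -> cox_equiv t z z' -> (z' q b != 0) = (z q b != 0).
Proof.
move=> vq [lam [l0 _ lE]]; have /(congr1 (fun x => x != 0)) := lE q b vq.
by rewrite !mulf_eq0 (negPf (l0 _)) (negPf (l0 q)) orbF.
Qed.

Lemma cox_point t z : nondegenerate t z -> exists w : cox t, sval w = z.
Proof. by move=> zt; exists (exist _ z zt). Qed.

Definition presentable t Y : Prop := exists r, @presents t Y r.

(** Both quotient maps have the same fibres, so that [r z] and [r' z] correspond to each other
    independently of [z]; the remaining fields match the structures. *)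
Lemma presentable_toric_iso t X Y :
  presentable t X -> presentable t Y -> toric_iso X Y.
Proof.
move=> [r pr] [r' pr'].
have [i iE] := choice (presents_surj pr); have [j jE] := choice (presents_surj pr').
pose f x : Y := r' (i x); pose g y : X := r (j y).
have fr z : f (r z) = r' z.
  by apply/(presents_fiber pr')/(presents_fiber pr); rewrite iE.
have gr z : g (r' z) = r z.
  by apply/(presents_fiber pr)/(presents_fiber pr'); rewrite jE.
exists f, g; split.
- by move=> x; have [z <-] := presents_surj pr x; rewrite fr gr.
- by move=> y; have [z <-] := presents_surj pr' y; rewrite gr fr.
- move=> V oV.
  have oV' : is_open (fun x => V (f x)).
    apply/(presents_open pr).
    have -> : (fun z => V (f (r z))) = (fun z => V (r' z)).
      by apply/funext => z; rewrite fr.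
    exact/(presents_open pr').
  split=> // h /(presents_regular pr' _ oV) rh; apply/(presents_regular pr) => //.
  have -> : (fun z => V (f (r z))) = (fun z => V (r' z)).
    by apply/funext => z; rewrite fr.
  by have -> : (fun z => h (f (r z))) = (fun z => h (r' z)) by apply/funext => z; rewrite fr.
- move=> V oV.
  have oV' : is_open (fun y => V (g y)).
    apply/(presents_open pr').
    have -> : (fun z => V (g (r' z))) = (fun z => V (r z)).
      by apply/funext => z; rewrite gr.
    exact/(presents_open pr).
  split=> // h /(presents_regular pr _ oV) rh; apply/(presents_regular pr') => //.
  have -> : (fun z => V (g (r' z))) = (fun z => V (r z)).
    by apply/funext => z; rewrite gr.
  by have -> : (fun z => h (g (r' z))) = (fun z => h (r z)) by apply/funext => z; rewrite gr.
- move=> s; split=> [/(presents_torus pr')[c c0 cE] | /(presents_torus pr)[c c0 cE]].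
    apply/(presents_torus pr); exists c => // z z' zz'.
    by rewrite fr (cE _ _ zz') gr.
  apply/(presents_torus pr'); exists c => // z z' zz'.
  have K1 y : f (g y) = y by have [w <-] := presents_surj pr' y; rewrite gr fr.
  by have := congr1 f (cE _ _ zz'); rewrite K1 !fr.
Qed.

(** Relabelling the slots along the tree isomorphism, with the two coordinates exchanged where [e]
    says so, identifies the Cox spaces and their equivalences. *)
Lemma presentable_eqv t t' Y : tree_eqv t t' -> presentable t' Y -> presentable t Y.
Proof.
move=> /tree_eqv_path_map[mu [nu [e [Km Kn m0 mr mv]]]] [r pr].
pose Phi z q b : K := z (nu q) (b (+) e (nu q)).
pose Psi z q b : K := z (mu q) (b (+) e q).
have PsiK z : Psi (Phi z) = z.
  by apply/funext => q; apply/funext => b; rewrite /Psi /Phi Km addbK.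
have PhiK z : Phi (Psi z) = z.
  by apply/funext => q; apply/funext => b; rewrite /Psi /Phi Kn addbK.
have Phi_nd z : nondegenerate t z -> nondegenerate t' (Phi z).
  move=> zt q; rewrite -{1}(Kn q) mv => /zt.
  by rewrite /Phi; case: (e _) => /= -[]; auto.
have Psi_nd z : nondegenerate t' z -> nondegenerate t (Psi z).
  move=> zt q; rewrite -mv => /zt.
  by rewrite /Psi; case: (e _) => /= -[]; auto.
pose phi (z : cox t) : cox t' := exist _ (Phi (sval z)) (Phi_nd _ (svalP z)).
pose psi (z : cox t') : cox t := exist _ (Psi (sval z)) (Psi_nd _ (svalP z)).
have phi_m : morphism_of_spaces phi.
  apply: poly_map_morphism => c [q [b [vq ->]]]; apply: Polyfun_coord.
  by exists (nu q), (b (+) e (nu q)); split=> //; rewrite -mv Kn.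
have psi_m : morphism_of_spaces psi.
  apply: poly_map_morphism => c [q [b [vq ->]]]; apply: Polyfun_coord.
  by exists (mu q), (b (+) e q); split=> //; rewrite mv.
have phiK z : psi (phi z) = z by apply: cox_eq; rewrite /= PsiK.
have psiK z : phi (psi z) = z by apply: cox_eq; rewrite /= PhiK.
have equivE z z' : cox_equiv t' (Phi z) (Phi z') <-> cox_equiv t z z'.
  split=> -[lam [l0 l1 lE]].
    exists (lam \o mu); split=> [q|q vq|q b vq] /=; first exact: l0.
      by rewrite l1 ?mv.
    have := lE (mu q) (b (+) e q); rewrite mv => /(_ vq).
    by rewrite /Phi Km addbK mr.
  exists (lam \o nu); split=> [q|q vq|q b vq] /=; first exact: l0.
    by rewrite l1 // -mv Kn.
  have := lE (nu q) (b (+) e (nu q)); rewrite -mv Kn => /(_ vq).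
  have -> // : nu (rcons q b) = rcons (nu q) (b (+) e (nu q)).
  by apply: (can_inj Km); rewrite Kn mr Kn addbK.
exists (r \o phi); split=> /=.
- by move=> y; have [z <-] := presents_surj pr y; exists (psi z); rewrite psiK.
- by move=> z z'; rewrite (presents_fiber pr) equivE.
- move=> A; rewrite (presents_open pr); split=> oA.
    exact: (phi_m _ oA).1.
  have := (psi_m _ oA).1.
  by have -> : (fun z => A (r (phi (psi z)))) = (fun z => A (r z)) by apply/funext => z; rewrite psiK.
- move=> U f oU; rewrite (presents_regular pr) //.
  have oU' : is_open (fun z => U (r z)) by apply/(presents_open pr).
  split=> rf; first exact: ((phi_m _ oU').2 (fun z => f (r z)) rf).
  have := (psi_m _ (phi_m _ oU').1).2 _ rf.
  have -> : (fun z => U (r (phi (psi z)))) = (fun z => U (r z)).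
    by apply/funext => z; rewrite psiK.
  by have -> : (fun z => f (r (phi (psi z)))) = (fun z => f (r z)) by apply/funext => z; rewrite psiK.
- move=> s; rewrite (presents_torus pr); split=> -[c c0 cE].
    exists (Psi c) => [q b|z z' zz']; first exact: c0.
    apply: cE => q b; rewrite -{1}(Kn q) mv => vq.
    by rewrite /= /Phi zz' // /Psi Kn addbK.
  exists (Phi c) => [q b|z z' zz']; first exact: c0.
  rewrite -(psiK z) -(psiK z'); apply: cE => q b vq /=.
  by rewrite /Psi zz' ?mv // /Phi Km addbK.
Qed.

End Presentations.

(** * Affine charts of the quotient *)

Section Charts.
Local Open Scope ring_scope.
Variables (K : fieldType) (t : bintree) (d : seq bool -> bool).
Implicit Types (x : seq bool -> K) (z : cox K t).

Definition affine_coord : ((seq bool -> K) -> K) -> Prop :=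
  fun f => exists2 q, vertex t q & f = (fun x => x q).

Definition chart_fun x q b : K := if b == d q then 1 else x q.

Lemma chart_fun_nondegenerate x : nondegenerate t (chart_fun x).
Proof.
by move=> q _; rewrite /chart_fun; case: (d q); [right | left]; exact: oner_neq0.
Qed.

Definition chart_map x : cox K t := exist _ _ (chart_fun_nondegenerate x).

Definition in_chart z : Prop := forall q, vertex t q -> sval z q (d q) != 0.

(** A walk from [q] has weight [lam q], so numerator and denominator have equal weight and the
    quotient is invariant. At a point [chart_map x] both walks are 1. *)
Definition chart_coord z q : K :=
  if vertex t q then
    sval z q (~~ d q) * walk t (sval z) d (rcons q (~~ d q)) / walk t (sval z) d q
  else 0.

Lemma in_chart_equiv z z' : cox_equiv t (sval z) (sval z') -> in_chart z -> in_chart z'.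
Proof. by move=> zz' dz q vq; rewrite (cox_equiv_neq0 _ vq zz') dz. Qed.

Lemma walk_chart_neq0 z q : in_chart z -> walk t (sval z) d q != 0.
Proof.
move=> dz; elim/(@path_ind t): q => q vq; first by rewrite walk_leaf // oner_neq0.
by move=> IH; rewrite walk_vertex // mulf_neq0 ?dz.
Qed.

Lemma walk_equiv (z z' : seq bool -> bool -> K) lam c q :
  (forall q, ~~ vertex t q -> lam q = 1) ->
  (forall q b, vertex t q -> z' q b * lam (rcons q b) = lam q * z q b) ->
  walk t z' c q = lam q * walk t z c q.
Proof.
move=> l1 lE; elim/(@path_ind t): q => q vq; first by rewrite !walk_leaf // l1 // mulr1.
by move=> IH; rewrite !(walk_vertex _ _ vq) IH mulrA lE // mulrA.
Qed.

Lemma polyfun_walk c q : polyfun (@cox_coord K t) (fun z => walk t (sval z) c q).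
Proof.
elim/(@path_ind t): q => q vq.
  have -> : (fun z : cox K t => walk t (sval z) c q) = fun=> 1.
    by apply/funext => z; rewrite walk_leaf.
  exact: Polyfun_const.
move=> IH; have -> : (fun z : cox K t => walk t (sval z) c q) =
  fun z => sval z q (c q) * walk t (sval z) c (rcons q (c q)).
  by apply/funext => z; rewrite walk_vertex.
by apply: Polyfun_mul => //; apply: Polyfun_coord; exists q, (c q).
Qed.

Lemma chart_coord_equiv z z' : cox_equiv t (sval z) (sval z') ->
  chart_coord z = chart_coord z'.
Proof.
move=> [lam [l0 l1 lE]]; apply/funext => q; rewrite /chart_coord; case: ifP => // vq.
rewrite !(walk_equiv _ _ l1 lE) [sval z' _ _ * _]mulrA lE //.
by rewrite -(mulrA (lam q)) -mulf_div divff ?mul1r.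
Qed.

Lemma walk_chart_map x q : walk t (chart_fun x) d q = 1.
Proof.
elim/(@path_ind t): q => q vq; first by rewrite walk_leaf.
by move=> IH; rewrite walk_vertex // IH /chart_fun eqxx mulr1.
Qed.

Lemma chart_mapK x q : vertex t q -> chart_coord (chart_map x) q = x q.
Proof.
move=> vq; rewrite /chart_coord vq /= !walk_chart_map divr1 mulr1 /chart_fun.
by case: (d q).
Qed.

Lemma in_chart_map x : in_chart (chart_map x).
Proof. by move=> q vq; rewrite /= /chart_fun eqxx oner_neq0. Qed.

Lemma chart_coordK z : in_chart z -> cox_equiv t (sval z) (chart_fun (chart_coord z)).
Proof.
(* This factor makes every walk along [d] equal to 1. *)
move=> dz; exists (fun q => (walk t (sval z) d q)^-1); split.
- by move=> q; rewrite invr_eq0 walk_chart_neq0.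
- by move=> q vq; rewrite walk_leaf // invr1.
- move=> q b vq; rewrite /chart_fun; case: eqP => [->|bd].
    by rewrite mul1r [walk t _ d q]walk_vertex // invfM [RHS]mulrC mulVKf // dz.
  have -> : b = ~~ d q by case: (b) (d q) bd => [] [].
  rewrite /chart_coord vq mulrAC mulfK ?walk_chart_neq0 //.
  by rewrite mulrC.
Qed.

Lemma open_in_chart : is_open in_chart.
Proof.
move=> z dz.
exists (fun w => \prod_(q <- vertices t) (if vertex t q then sval w q (d q) else 1)); split.
- apply: polyfun_prod => q; case vq: (vertex t q); last exact: Polyfun_const.
  by apply: Polyfun_coord; exists q, (d q).
- by rewrite prodf_seq_neq0; apply/allP => q /=; rewrite mem_vertices => vq; rewrite vq dz.
- move=> w; rewrite prodf_seq_neq0 => /allP h q vq.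
  by have := h q; rewrite mem_vertices vq => /(_ isT).
Qed.

Lemma regular_chart_coord q : regular in_chart (fun z => chart_coord z q).
Proof.
rewrite /chart_coord; case vq: (vertex t q); last exact: regular_cst.
apply: regularM.
  apply: regular_poly; apply: Polyfun_mul; last exact: polyfun_walk.
  by apply: Polyfun_coord; exists q, (~~ d q).
by apply: regularV; [move=> z; exact: walk_chart_neq0 | exact/regular_poly/polyfun_walk].
Qed.

Lemma affine_polyfun_ext f x x' :
  polyfun affine_coord f -> (forall q, vertex t q -> x q = x' q) -> f x = f x'.
Proof.
move=> pf xx'; elim: pf => [c | g [q vq ->] | g h _ IH _ IH' | g h _ IH _ IH'] //.
- exact: xx'.
- by rewrite IH IH'.
- by rewrite IH IH'.
Qed.

Lemma polyfun_chart_map g : polyfun (@cox_coord K t) g ->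
  polyfun affine_coord (fun x => g (chart_map x)).
Proof.
apply: polyfun_comp => c [q [b [vq ->]]] /=; rewrite /chart_fun.
by case: (b == d q); [exact: Polyfun_const | apply: Polyfun_coord; exists q].
Qed.

End Charts.

Lemma chart_exists (K : fieldType) t (z : cox K t) : exists d, in_chart d z.
Proof.
exists (fun q => sval z q false == 0%R) => q vq.
by case: (eqVneq (sval z q false)) => [z0|//]; case: (svalP z q vq) => //; rewrite z0 eqxx.
Qed.

(** * Regular functions on lines, and curves in the Cox space *)

Section Curves.
Local Open Scope ring_scope.

Lemma poly_nonroot (K : numDomainType) (p : {poly K}) :
  p != 0 -> exists2 a : K, a != 0 & p.[a] != 0.
Proof.
move=> p0; pose q := p * 'X.
have q0 : q != 0 by rewrite mulf_neq0 ?polyX_eq0.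
pose s : seq K := [seq i%:R | i <- iota 0 (size q)].
have us : uniq s by rewrite map_inj_uniq ?iota_uniq // => i j /eqP; rewrite eqr_nat => /eqP.
have : ~~ all (root q) s.
  by apply/negP => /(max_poly_roots q0)/(_ us); rewrite size_map size_iota ltnn.
case/seq.allPn => [a _]; rewrite /root hornerM hornerX mulf_eq0 negb_or => /andP[pa a0].
by exists a.
Qed.

Lemma poly_eq_nonroots (K : numDomainType) (p q h : {poly K}) :
  h != 0 -> (forall x, h.[x] != 0 -> p.[x] = q.[x]) -> p = q.
Proof.
move=> h0 E; apply/eqP; rewrite -subr_eq0; apply/negP => /negP pq0.
have [|a _] := @poly_nonroot K ((p - q) * h); first by rewrite mulf_neq0.
rewrite hornerM mulf_eq0 negb_or => /andP[+ /E pqa].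
by rewrite hornerD hornerN pqa subrr eqxx.
Qed.

Section LocalFractions.
Variable K : numClosedFieldType.

Definition local_fraction (phi : K -> K) : Prop := forall a, exists g h : {poly K},
  h.[a] != 0 /\ forall x, h.[x] != 0 -> phi x = g.[x] / h.[x].

(** In lowest terms the fraction has no pole, because near every point it agrees with a fraction
    whose denominator does not vanish there. Over an algebraically closed field its denominator is
    therefore constant. *)
Lemma local_fraction_poly phi : local_fraction phi -> exists p : {poly K}, phi = horner p.
Proof.
move=> loc; have [g [h [h0 phiE]]] := loc 0.
have hn0 : h != 0 by apply: contraNneq h0 => ->; rewrite horner0.
pose d := gcdp g h.
have dn0 : d != 0 by rewrite gcdp_eq0 (negPf hn0) andbF.
pose g' := g %/ d; pose h' := h %/ d.
have gE : g = g' * d by rewrite divpK ?dvdp_gcdl.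
have hE : h = h' * d by rewrite divpK ?dvdp_gcdr.
have h'n0 : h' != 0 by apply: contraNneq hn0 => h'0; rewrite hE h'0 mul0r.
have cop : coprimep g' h' by apply: coprimep_div_gcd; rewrite hn0 orbT.
have key a : h'.[a] != 0 /\ phi a = g'.[a] / h'.[a].
  have [g2 [h2 [h2a phi2E]]] := loc a.
  have h2n0 : h2 != 0 by apply: contraNneq h2a => ->; rewrite horner0.
  have E : g' * h2 = g2 * h'.
    apply: (@poly_eq_nonroots _ _ _ (h * h2)); first exact: mulf_neq0.
    move=> x; rewrite hornerM mulf_eq0 negb_or => /andP[hx h2x].
    have := phiE x hx; rewrite phi2E // gE hE !hornerM.
    move: hx; rewrite {1}hE hornerM mulf_eq0 negb_or => /andP[h'x dx].
    rewrite -mulf_div divff // mulr1 => /eqP.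
    by rewrite eqr_div // => /eqP ->.
  have Ea := congr1 (horner^~ a) E; rewrite /= !hornerM in Ea.
  have h'a : h'.[a] != 0.
    apply/negP => /eqP h'a; move: Ea; rewrite h'a mulr0 => /eqP.
    rewrite mulf_eq0 (negPf h2a) orbF => /eqP g'a.
    have /coprimepP/(_ ('X - a%:P)) := cop.
    rewrite !dvdp_XsubCl /root g'a h'a eqxx => /(_ isT isT)/eqp_size.
    by rewrite size_XsubC size_poly1.
  by split=> //; rewrite phi2E //; apply/eqP; rewrite eqr_div // Ea.
have sh' : size h' == 1%N.
  apply/negPn/negP => /closed_rootP[a]; rewrite /root.
  by rewrite (negPf (key a).1).
have [c c0 cE] := size_poly1P _ sh'.
exists (c^-1 *: g'); apply/funext => a.
by rewrite (key a).2 cE hornerC hornerZ mulrC.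
Qed.

(* The functions phi and psi are the restrictions to the two affine charts of
   a regular function on the projective line. *)
Lemma projective_line_const phi psi :
  local_fraction phi -> local_fraction psi ->
  (forall a, a != 0 -> phi a = psi a^-1) -> forall a b, phi a = phi b.
Proof.
move=> /local_fraction_poly[p ->] /local_fraction_poly[s ->] ps.
pose m := (size s).-1.
(* [s] is the function in the coordinate 1/x, and [s'] is x^m s(1/x), of degree at most m; so
   [p * 'X^m = s'] leaves only degree 0 for [p]. *)
pose s' := \poly_(i < m.+1) s`_(m - i).
have E : p * 'X^m = s'.
  apply: (@poly_eq_nonroots _ _ _ 'X); first by rewrite polyX_eq0.
  move=> x; rewrite hornerX => x0; rewrite hornerM ps // hornerXn.
  have sm : (size s <= m.+1)%N by rewrite /m; case: (size s).
  rewrite horner_poly (horner_coef_wide _ sm) mulr_suml.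
  rewrite (reindex_inj rev_ord_inj); apply: eq_bigr => i _ /=.
  rewrite subSS -mulrA; congr (_ * _).
  have im : (i <= m)%N by rewrite -ltnS ltn_ord.
  have -> : x ^+ m = x ^+ (m - i) * x ^+ i by rewrite -exprD subnK.
  by rewrite mulrA -exprMn mulVf // expr1n mul1r.
have sp : (size p <= 1)%N.
  have [->|p0] := eqVneq p 0; first by rewrite size_poly0.
  have : (size (p * 'X^m)%R <= m.+1)%N by rewrite E size_poly.
  by rewrite size_mulXn // -addn1 leq_add2l.
by move=> a b; rewrite (size1_polyC sp) !hornerC.
Qed.

End LocalFractions.

Section CoxCurves.
Variables (K : numFieldType) (t : bintree).
Implicit Types (z w : cox K t) (h : cox K t -> K) (gamma : seq bool -> bool -> {poly K}).

Definition on_curve gamma (a : K) z : Prop :=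
  forall q b, vertex t q -> sval z q b = (gamma q b).[a].

Lemma polyfun_curve h gamma : polyfun (@cox_coord K t) h ->
  exists p : {poly K}, forall z a, on_curve gamma a z -> h z = p.[a].
Proof.
elim=> [c | f [q [b [vq ->]]] | f g _ [p pE] _ [p' pE'] | f g _ [p pE] _ [p' pE']].
- by exists c%:P => z a _; rewrite hornerC.
- by exists (gamma q b) => z a ->.
- by exists (p + p') => z a zE; rewrite hornerD (pE _ _ zE) (pE' _ _ zE).
- by exists (p * p') => z a zE; rewrite hornerM (pE _ _ zE) (pE' _ _ zE).
Qed.

Definition scaled (c : seq bool -> bool -> K) z w : Prop :=
  forall q b, vertex t q -> sval w q b = c q b * sval z q b.

(** A curve with parameter a stays in the orbit of [z] for a != 0 and reaches [z'] at a = 0, where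
    the coordinates that vanish at [z'] only are switched off. An open set around [z'] contains
    almost all of the curve. *)
Lemma orbit_closure (U : cox K t -> Prop) z z' :
  (forall q b, vertex t q -> sval z q b = 0 -> sval z' q b = 0) ->
  is_open U -> U z' ->
  exists c w, [/\ forall q b, c q b != 0, scaled c z w & U w].
Proof.
move=> zz' oU Uz'; have [h [ph hz' hU]] := oU _ Uz'.
pose gamma q b : {poly K} :=
  if sval z' q b == 0 then (sval z q b) *: 'X else (sval z' q b)%:P.
have [p pE] := polyfun_curve gamma ph.
have p0 : p != 0.
  apply: contraNneq hz' => p0; rewrite (pE z' 0) ?p0 ?horner0 // => q b vq.
  by rewrite /gamma; case: eqP => [->|_]; rewrite ?hornerZ ?hornerX ?mulr0 ?hornerC.
have [a a0 pa] := poly_nonroot p0.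
pose c q b : K := if sval z q b == 0 then 1 else
  if sval z' q b == 0 then a else sval z' q b / sval z q b.
have c0 q b : c q b != 0.
  rewrite /c; case: (eqVneq (sval z q b)) => [_|zq]; first exact: oner_neq0.
  by case: (eqVneq (sval z' q b)) => // z'q; rewrite mulf_neq0 ?invr_eq0.
have [|w wE] := @cox_point K t (fun q b => c q b * sval z q b).
  move=> q vq; case: (svalP z q vq) => ?; [left|right]; exact: mulf_neq0.
exists c, w; split=> //; first by move=> q b _; rewrite wE.
apply: hU; rewrite (pE w a) // => q b vq; rewrite wE /c /gamma.
case: (eqVneq (sval z q b) 0) => [zq|zq].
  by rewrite zq mulr0 (zz' _ _ vq zq) eqxx scale0r horner0.
by case: eqP => _; rewrite ?hornerZ ?hornerX ?hornerC ?divfK // mulrC.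
Qed.

(** An orbit is irreducible: on the line that joins the scalings [c] and [c'], all but finitely many
    parameters give a point of both open sets and keep every factor non-zero. *)
Lemma scaled_open_meet (U V : cox K t -> Prop) z w w' c c' :
  (forall q b, c q b != 0) -> (forall q b, c' q b != 0) ->
  scaled c z w -> scaled c' z w' -> is_open U -> is_open V -> U w -> V w' ->
  exists c2 w2, [/\ forall q b, c2 q b != 0, scaled c2 z w2, U w2 & V w2].
Proof.
move=> c0 c0' zw zw' oU oV Uw Vw'.
have [h [ph hw hU]] := oU _ Uw; have [h' [ph' hw' hV]] := oV _ Vw'.
pose cc q b : {poly K} := (c q b)%:P + (c' q b - c q b) *: 'X.
pose gamma q b : {poly K} := (sval z q b) *: cc q b.
have [p pE] := polyfun_curve gamma ph; have [p' pE'] := polyfun_curve gamma ph'.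
have cc0 q b : cc q b != 0.
  apply: contraNneq (c0 q b) => /(congr1 (horner^~ 0)) /=.
  by rewrite /cc hornerD hornerZ hornerX hornerC mulr0 addr0 horner0 => ->.
have p0 : p != 0.
  apply: contraNneq hw => p0; rewrite (pE w 0) ?p0 ?horner0 // => q b vq.
  by rewrite /gamma /cc hornerZ hornerD hornerZ hornerX hornerC mulr0 addr0 zw // mulrC.
have p'0 : p' != 0.
  apply: contraNneq hw' => p'0; rewrite (pE' w' 1) ?p'0 ?horner0 // => q b vq.
  rewrite /gamma /cc hornerZ hornerD hornerZ hornerX hornerC mulr1 zw' //.
  by rewrite addrC subrK mulrC.
pose P := p * p' * \prod_(q <- vertices t) (cc q false * cc q true).
have P0 : P != 0.
  rewrite !mulf_neq0 // prodf_seq_neq0; apply/allP => q _.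
  by rewrite mulf_neq0.
have [a _] := poly_nonroot P0.
rewrite !hornerM horner_prod !mulf_eq0 !negb_or prodf_seq_neq0.
move=> /andP[/andP[pa p'a] /allP ca].
have {}ca q b : vertex t q -> (cc q b).[a] != 0.
  rewrite -mem_vertices => /ca; rewrite hornerM mulf_eq0 negb_or => /andP[? ?].
  by case: b.
pose c2 q b := if vertex t q then (cc q b).[a] else 1.
have c20 q b : c2 q b != 0.
  by rewrite /c2; case: ifP => [/ca //|_]; exact: oner_neq0.
have [|w2 wE] := @cox_point K t (fun q b => c2 q b * sval z q b).
  move=> q vq; case: (svalP z q vq) => ?; [left|right]; exact: mulf_neq0.
have on2 : on_curve gamma a w2.
  by move=> q b vq; rewrite wE /gamma /c2 vq hornerZ mulrC.
exists c2, w2; split=> //; first by move=> q b _; rewrite wE.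
- by apply: hU; rewrite (pE _ _ on2).
- by apply: hV; rewrite (pE' _ _ on2).
Qed.

End CoxCurves.

Lemma presents_scaling (K : numFieldType) t (Y : tspace K) (r : cox K t -> Y)
    (c : seq bool -> bool -> K) :
  presents r -> (forall q b, c q b != 0) ->
  exists2 f : Y -> Y, torus f & forall z w, scaled c z w -> f (r z) = r w.
Proof.
move=> pr c0; have [i iE] := choice (presents_surj pr).
have nd (v : cox K t) : nondegenerate t (fun q b => c q b * sval v q b).
  by move=> q vq; case: (svalP v q vq) => ?; [left|right]; exact: mulf_neq0.
have cE z w : scaled c z w -> r (exist _ _ (nd (i (r z)))) = r w.
  move=> zw; apply/(presents_fiber pr) => /=.
  have [lam [l0 l1 lE]] : cox_equiv t (sval (i (r z))) (sval z).
    by apply/(presents_fiber pr); rewrite iE.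
  by exists lam; split=> // q b vq; rewrite zw // -mulrA lE // mulrCA.
by exists (fun y => r (exist _ _ (nd (i y)))) => //; apply/(presents_torus pr); exists c.
Qed.

Lemma presentable_dense_orbit (K : numFieldType) t (Y : tspace K) :
  presentable t Y -> has_dense_orbit Y.
Proof.
move=> [r pr]; have [|z zE] := @cox_point K t (fun _ _ => 1).
  by move=> q _; left; exact: oner_neq0.
exists (r z) => y U oU Uy; have [w wy] := presents_surj pr y.
have [|||c [w' [c0 cw Uw']]] := @orbit_closure K t (fun z => U (r z)) z w.
- by move=> q b _; rewrite zE => /eqP; rewrite oner_eq0.
- exact/(presents_open pr).
- by rewrite wy.
have [f tf fE] := presents_scaling pr c0.
by exists (r w') => //; exists f; rewrite ?(fE _ _ cw).
Qed.

End Curves.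

(** * Boundary divisors determine the tree *)

Section BoundaryFunctions.
Local Open Scope ring_scope.
Variables (K : numClosedFieldType) (t : bintree) (Y : tspace K) (r : cox K t -> Y).
Hypothesis pr : presents r.
Local Notation slot := (seq bool * bool)%type.
Implicit Types (us zl : seq slot) (q p : seq bool) (b : bool) (z : cox K t).

Definition zeros_in us z : Prop :=
  forall x : slot, vertex t x.1 -> sval z x.1 x.2 = 0 -> x \in us.

Definition zero_locus us : Y -> Prop := fun y => exists2 z, r z = y & zeros_in us z.

Lemma zero_locusE us z : zero_locus us (r z) <-> zeros_in us z.
Proof.
split=> [[w /(presents_fiber pr) wz wus] x vx zx | zus]; last by exists z.
by apply: wus => //; apply/eqP; rewrite -(negbK (_ == _)) -(cox_equiv_neq0 _ vx wz) zx eqxx.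
Qed.

Lemma open_zero_locus us : is_open (zero_locus us).
Proof.
apply/(presents_open pr) => z /zero_locusE zus.
exists (fun z => \prod_(q <- vertices t)
  \prod_(b <- [:: false; true]) (if (q, b) \in us then 1 else
     if vertex t q then sval z q b else 1)); split.
- apply: polyfun_prod => q; apply: polyfun_prod => b.
  case: ((q, b) \in us); first exact: Polyfun_const.
  case vq: (vertex t q); last exact: Polyfun_const.
  by apply: Polyfun_coord; exists q, b.
- rewrite prodf_seq_neq0; apply/allP => q _ /=.
  rewrite prodf_seq_neq0; apply/allP => b _ /=.
  case: ifP => us'; first exact: oner_neq0.
  case: ifP => vq; last exact: oner_neq0.
  by apply: contraFN us' => /eqP; apply: (zus (q, b)).
- move=> w; rewrite prodf_seq_neq0 => /allP wus; apply/zero_locusE => -[q b] /= vq wq.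
  have := wus q; rewrite mem_vertices => /(_ vq) /=.
  rewrite prodf_seq_neq0 => /allP /(_ b); rewrite vq wq.
  by case: ifP => // _; case: b {wq} => /(_ isT); rewrite eqxx.
Qed.

Definition has_function us zl : Prop := exists f : Y -> K,
  regular (zero_locus us) f /\
  forall z, zeros_in us z ->
    (f (r z) = 0 <-> exists2 x : slot, x \in zl & sval z x.1 x.2 = 0).

Lemma walk_neq0 (z : seq bool -> bool -> K) d q :
  (forall x, vertex t x -> prefix q x -> z x (d x) != 0) -> walk t z d q != 0.
Proof.
elim/(@path_ind t): q => q vq; first by rewrite walk_leaf // oner_neq0.
move=> IH zd; rewrite walk_vertex // mulf_neq0 ?zd ?prefix_refl //.
apply: IH => x vx qx; apply: zd => //.
by apply: prefix_trans qx; apply: prefix_rcons.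
Qed.

(** Two walks from the same node have the same weight, so their quotient descends to a function on
    [Y] wherever the second one does not vanish. *)
Lemma has_walk_quotient us zl d d' q :
  (forall z, zeros_in us z -> walk t (sval z) d' q != 0) ->
  (forall z, zeros_in us z ->
     (walk t (sval z) d q = 0 <-> exists2 x : slot, x \in zl & sval z x.1 x.2 = 0)) ->
  has_function us zl.
Proof.
move=> d'0 dE; have [i iE] := choice (presents_surj pr).
pose f z := walk t (sval z) d q / walk t (sval z) d' q.
have fE z : f (i (r z)) = f z.
  have [lam [l0 l1 lE]] : cox_equiv t (sval z) (sval (i (r z))).
    by apply/(presents_fiber pr); rewrite iE.
  by rewrite /f !(walk_equiv _ _ l1 lE) -mulf_div divff // mul1r.
exists (fun y => f (i y)); split.
  apply/(presents_regular pr); first exact: open_zero_locus.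
  apply: (@regular_eq _ _ _ _ f) => [z _|]; first by rewrite fE.
  apply: regularM; first exact/regular_poly/polyfun_walk.
  apply: regularV; last exact/regular_poly/polyfun_walk.
  by move=> z /zero_locusE; apply: d'0.
move=> z zus; rewrite fE -dE // /f; split=> [/eqP|->]; last by rewrite mul0r.
by rewrite mulf_eq0 invr_eq0 (negPf (d'0 z zus)) orbF => /eqP.
Qed.

(* g1 and g2 are the restrictions to the two affine charts of a map from the
   projective line to Y along which f would have a single zero. *)
Lemma no_function us zl (g1 g2 : seq bool -> bool -> {poly K}) :
  (forall a, exists2 z, on_curve g1 a z & zeros_in us z) ->
  (forall a, exists2 z, on_curve g2 a z & zeros_in us z) ->
  (forall a z z', a != 0 -> on_curve g1 a z -> on_curve g2 a^-1 z' -> r z = r z') ->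
  (forall a z, on_curve g1 a z ->
     ((exists2 x : slot, x \in zl & sval z x.1 x.2 = 0) <-> a = 0)) ->
  ~ has_function us zl.
Proof.
move=> h1 h2 h12 hz [f [rf fz]].
have sel (g : seq bool -> bool -> {poly K}) :
    (forall a, exists2 z, on_curve g a z & zeros_in us z) ->
    exists c : K -> cox K t, (forall a, on_curve g a (c a)) /\ (forall a, zeros_in us (c a)).
  move=> h; have [|c cE] := @choice _ _ (fun a z => on_curve g a z /\ zeros_in us z).
    by move=> a; have [z ? ?] := h a; exists z.
  by exists c; split=> a; case: (cE a).
have [c1 [c1on c1us]] := sel _ h1; have [c2 [c2on c2us]] := sel _ h2.
have loc g (c : K -> cox K t) : (forall a, on_curve g a (c a)) ->
    (forall a, zeros_in us (c a)) -> local_fraction (fun a => f (r (c a))).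
  move=> con cus a.
  have /(presents_regular pr _ (open_zero_locus us)) rf' := rf.
  have [n [d [pn pd dca fE]]] := rf' (c a) (ex_intro2 _ _ (c a) erefl (cus a)).
  have [pn' pnE] := polyfun_curve g pn; have [pd' pdE] := polyfun_curve g pd.
  exists pn', pd'; split; first by rewrite -(pdE _ _ (con a)).
  move=> x; rewrite -(pdE _ _ (con x)) -(pnE _ _ (con x)) => dx.
  by apply: fE => //; exists (c x).
have cst := projective_line_const (loc _ _ c1on c1us) (loc _ _ c2on c2us).
have {}cst := cst (fun a a0 => congr1 f (h12 _ _ _ a0 (c1on a) (c2on a^-1))).
have f0 : f (r (c1 0)) = 0 by apply/fz => //; apply/(hz 0).
have /fz f1 : f (r (c1 1)) = 0 by rewrite (cst 1 0).
by have /(hz 1 _ (c1on 1))/eqP := f1 (c1us 1); rewrite oner_eq0.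
Qed.

Definition is_parent q b (s : slot) : Prop :=
  let us := [:: (q, b); (q, ~~ b); s] in
  has_function us [:: (q, b); s] /\ ~ has_function us [:: (q, b)].

Lemma not_prefix_rcons (p : seq bool) c x : (size x <= size p)%N -> ~~ prefix (rcons p c) x.
Proof.
move=> xp; apply/negP => /prefixP[y /(congr1 size)]; rewrite size_cat size_rcons => E.
by move: xp; rewrite E addSn ltnNge leq_addr.
Qed.

Lemma not_prefix_sibling (p : seq bool) c x : ~~ prefix (rcons p (~~ c)) (rcons p c ++ x).
Proof. by rewrite -!cats1 -catA prefix_catr // eqxx /=; case: c. Qed.

Section Parent.
Variables (q : seq bool) (b : bool) (p : seq bool) (c : bool).
Hypotheses (vq : vertex t q) (vp : vertex t p) (pq : p != q).
Local Notation us := [:: (q, b); (q, ~~ b); (p, c)].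

(** With (u, v) = ('X, 1) and (1, 'X) these are the two charts of a projective line along which the
    ratio of the coordinates at [q] varies. Rescaling at [q] affects the slots above it, and [w]
    absorbs the change at [(p, c)]. *)
Let pencil (A : nzRingType) (u v w : A) (x : seq bool) (e : bool) : A :=
  if x == q then (if e == b then u else v) else if (x, e) == (p, c) then w else 1.

Lemma horner_pencil (u v w : {poly K}) x e a :
  (pencil u v w x e).[a] = pencil u.[a] v.[a] w.[a] x e.
Proof. by rewrite /pencil; do !case: ifP => // _; rewrite hornerC. Qed.

Lemma pencil_point (u v w : {poly K}) a : u.[a] != 0 \/ v.[a] != 0 ->
  exists2 z, on_curve (pencil u v w) a z & zeros_in us z.
Proof.
move=> uv; have [|z zE] := @cox_point K t (pencil u.[a] v.[a] w.[a]).
  move=> x vx; rewrite /pencil; case: ifP => _.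
    by case: uv; case: (b); auto.
  rewrite !xpair_eqE; case: (x == p) => /=; last by left; exact: oner_neq0.
  by case: (c); [left | right]; exact: oner_neq0.
exists z; first by move=> x e _; rewrite zE horner_pencil.
move=> [x e] /= vx; rewrite zE /pencil !inE; case: eqP => [->|_].
  by rewrite !xpair_eqE eqxx /=; case: (e) (b) => [] [].
by case: eqP => [_|_ /eqP]; rewrite ?orbT // oner_eq0.
Qed.

Lemma no_pencil_function zl (w1 w2 : {poly K}) (lam : K -> seq bool -> K) :
  (forall x, x \in zl -> vertex t x.1) ->
  (forall a, a != 0 ->
     [/\ forall x, lam a x != 0, forall x, ~~ vertex t x -> lam a x = 1 &
         forall x e, vertex t x ->
           pencil 1 a^-1 w2.[a^-1] x e * lam a (rcons x e) =
           lam a x * pencil a 1 w1.[a] x e]) ->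
  (forall a, (exists2 x : slot, x \in zl & pencil a 1 w1.[a] x.1 x.2 = 0) <-> a = 0) ->
  ~ has_function us zl.
Proof.
move=> vzl lamE zlE.
apply: (@no_function _ _ (pencil 'X 1 w1) (pencil 1 'X w2)).
- by move=> a; apply: pencil_point; right; rewrite hornerC oner_neq0.
- by move=> a; apply: pencil_point; left; rewrite hornerC oner_neq0.
- move=> a z z' a0 za z'a; apply/(presents_fiber pr).
  have [l0 l1 lE] := lamE a a0; exists (lam a); split=> // x e vx.
  by rewrite za // z'a // !horner_pencil !hornerX !hornerC lE.
- move=> a z za; rewrite -zlE; split=> -[x xzl xE]; exists x => //.
    by move: xE; rewrite za ?horner_pencil ?hornerX ?hornerC //; apply: vzl.
  by rewrite za ?horner_pencil ?hornerX ?hornerC //; apply: vzl.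
Qed.

Lemma tail_neq0 y d z : zeros_in us z -> ~~ prefix y q ->
  (prefix y p -> d p = ~~ c) -> walk t (sval z) d y != 0.
Proof.
move=> zus yq dE; apply: walk_neq0 => x vx yx; apply: contraNneq yq => /(zus (x, d x) vx).
rewrite !inE !xpair_eqE /=; have [<- //|xq /=] := eqVneq x q.
case: eqP => //= xp; rewrite xp in yx *; rewrite dE //; by case: (c).
Qed.

(** The walk from [p] through [q] and [(q, b)] collects the factors of both divisors, while a walk
    from [p] on the other side does not vanish. For [(q, b)] alone, the divisor of [(p, c)] contains
    a projective line along which only the ratio at [q] varies. *)
Lemma is_parent_rcons : q = rcons p c -> is_parent q b (p, c).
Proof.
move=> qE; split.
  pose d x := if x == q then b else if x == p then c else false.
  pose d' x := if x == p then ~~ c else false.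
  have dq : d q = b by rewrite /d eqxx.
  have dp : d p = c by rewrite /d (negPf pq) eqxx.
  apply: (@has_walk_quotient _ _ d d' p) => z zus.
    rewrite walk_vertex // /d' eqxx mulf_neq0 //.
      apply/negP => /eqP /(zus (p, ~~ c) vp).
      by rewrite !inE !xpair_eqE (negPf pq) /=; case: (c); rewrite andbF.
    apply: tail_neq0 => //; last by rewrite eqxx.
    by rewrite qE -[rcons p c]cats0 not_prefix_sibling.
  have tl : walk t (sval z) d (rcons q b) != 0.
    apply: tail_neq0 => //; first exact: not_prefix_rcons.
    by apply: contraTeq => _; apply: not_prefix_rcons; rewrite qE size_rcons.
  have -> : walk t (sval z) d p = sval z p c * (sval z q b * walk t (sval z) d (rcons q b)).
    by rewrite walk_vertex // dp -qE walk_vertex // dq.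
  split.
    move=> /eqP; rewrite !mulf_eq0 (negPf tl) orbF => /orP[] /eqP E.
      by exists (p, c); rewrite // !inE eqxx orbT.
    by exists (q, b); rewrite // !inE eqxx.
  by case=> x; rewrite !inE => /orP[] /eqP -> /= ->; rewrite ?mul0r ?mulr0.
(* As the coordinate at [(p, c)] is 0, the factor at [q] has no effect on the slot that leads to
   [q]. *)
apply: (@no_pencil_function [:: (q, b)] 0 0 (fun a x => if x == q then a^-1 else 1)).
- by move=> x; rewrite inE => /eqP ->.
- move=> a a0; split.
  + by move=> x; case: ifP => _; rewrite ?oner_neq0 ?invr_eq0.
  + by move=> x; case: eqP => // -> /negP.
  + move=> x e vx; rewrite !horner0 /pencil; case: (eqVneq x q) => [->|xq].
      have -> : (rcons q e == q) = false.
        by apply/eqP => /(congr1 size); rewrite size_rcons; lia.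
      by case: ifP; rewrite ?mulVf // !mulr1.
    rewrite [in RHS]mulrC; case: (eqVneq (x, e) (p, c)) => [_|xe]; first by rewrite !mul0r.
    rewrite qE; case: eqP => // /rcons_inj E.
    by move: xe; rewrite E eqxx.
- move=> a; split=> [[x] | ->].
    by rewrite inE => /eqP -> /=; rewrite /pencil !eqxx.
  by exists (q, b); rewrite ?inE // /pencil /= !eqxx.
Qed.

(** No slot leads to the root, so its two coordinates form a projective line with all other
    coordinates 1, and the zero at [(q, b)] is the only one. *)
Lemma not_parent_root : q = [::] -> ~ is_parent q b (p, c).
Proof.
move=> q0 [+ _]; apply: (@no_pencil_function _ 1 1 (fun a x => if x == q then a^-1 else 1)).
- by move=> x; rewrite !inE => /orP[] /eqP ->.
- move=> a a0; split.
  + by move=> x; case: ifP => _; rewrite ?oner_neq0 ?invr_eq0.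
  + by move=> x; case: eqP => // -> /negP.
  + move=> x e vx; rewrite !hornerC /pencil.
    have -> : (rcons x e == q) = false by rewrite q0; case: x {vx}.
    case: (eqVneq x q) => _; first by case: ifP; rewrite ?mulVf // !mulr1.
    by case: ifP; rewrite ?mulr1.
- move=> a; split=> [[x] | ->].
    rewrite !inE => /orP[] /eqP -> /=; rewrite /pencil ?eqxx //.
    by rewrite (negPf pq) hornerC => /eqP; rewrite oner_eq0.
  by exists (q, b); rewrite ?inE ?eqxx // /pencil /= !eqxx.
Qed.

(** The factor at [q] is undone at the slot [(p, ~~ c)] by the same factor at the root, which then
    appears at [(p, c)]. This is why [w] is ['X] in one chart: both divisors are met at the same
    single parameter. *)
Lemma not_parent_root_sibling : p = [::] -> q = rcons p (~~ c) -> ~ is_parent q b (p, c).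
Proof.
move=> p0 qE [+ _].
apply: (@no_pencil_function _ 'X 1 (fun a x => if (x == q) || (x == p) then a^-1 else 1)).
- by move=> x; rewrite !inE => /orP[] /eqP ->.
- move=> a a0; split.
  + by move=> x; case: ifP => _; rewrite ?oner_neq0 ?invr_eq0.
  + by move=> x; case: eqP => [-> /negP //|_]; case: eqP => // -> /negP.
  + move=> x e vx; rewrite hornerX hornerC /pencil.
    have -> : (rcons x e == p) = false by rewrite p0; case: x {vx}.
    rewrite orbF; case: (eqVneq x q) => [->|xq] /=.
      have -> : (rcons q e == q) = false.
        by apply/eqP => /(congr1 size); rewrite size_rcons; lia.
      by case: ifP; rewrite ?mulVf // !mulr1.
    rewrite xpair_eqE; case: (eqVneq x p) => [->|xp] /=.
      rewrite qE; case: (eqVneq e c) => [->|ec].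
        have -> : (rcons p c == rcons p (~~ c)) = false.
          by apply/eqP => /rcons_inj []; case: (c).
        by rewrite mulVf ?mulr1.
      have -> : rcons p e == rcons p (~~ c) by case: (e) (c) ec => [] [].
      by rewrite mul1r mulr1.
    rewrite qE; case: eqP => [/rcons_inj[xp'] | _]; last by rewrite !mulr1.
    by rewrite xp' eqxx in xp.
- move=> a; rewrite hornerX; split=> [[x] | ->].
    by rewrite !inE => /orP[] /eqP -> /=; rewrite /pencil ?eqxx // (negPf pq).
  by exists (q, b); rewrite ?inE ?eqxx // /pencil /= !eqxx.
Qed.

(** The node [g] above [p] provides walks that avoid the other slots of [us], so the divisor of
    [(q, b)] alone is the zero set of a function and the second half of the criterion fails. *)
Lemma not_parent_sibling g e : p = rcons g e -> q = rcons p (~~ c) -> ~ is_parent q b (p, c).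
Proof.
move=> pE qE [_]; apply.
pose d x := if x == q then b else if x == p then ~~ c else if x == g then e else false.
pose d' x := if x == g then ~~ e else false.
have gp : g != p by apply/eqP => /(congr1 size); rewrite pE size_rcons; lia.
have gq : g != q by apply/eqP => /(congr1 size); rewrite qE pE !size_rcons; lia.
have vg : vertex t g by move: vp; rewrite pE => /vertex_rcons.
have dq : d q = b by rewrite /d eqxx.
have dp : d p = ~~ c by rewrite /d (negPf pq) eqxx.
have dg : d g = e by rewrite /d (negPf gq) (negPf gp) eqxx.
have ngus f : (g, f) \notin us by rewrite !inE !xpair_eqE (negPf gp) (negPf gq).
apply: (@has_walk_quotient _ _ d d' g) => z zus.
  rewrite walk_vertex // /d' eqxx mulf_neq0 //.
    by apply: contraNneq (ngus (~~ e)); apply: (zus (g, ~~ e)).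
  apply: tail_neq0 => //.
    by rewrite qE -(cats1 p) pE not_prefix_sibling.
  by rewrite pE -[rcons g e]cats0 (negPf (not_prefix_sibling _ _ _)).
have tl : walk t (sval z) d (rcons q b) != 0.
  by apply: tail_neq0 => //; exact: not_prefix_rcons.
have zg : sval z g e != 0 by apply: contraNneq (ngus e); apply: (zus (g, e)).
have zp : sval z p (~~ c) != 0.
  apply/negP => /eqP /(zus (p, ~~ c) vp).
  by rewrite !inE !xpair_eqE (negPf pq) /=; case: (c); rewrite andbF.
have -> : walk t (sval z) d g =
    sval z g e * (sval z p (~~ c) * (sval z q b * walk t (sval z) d (rcons q b))).
  by rewrite walk_vertex // dg -pE walk_vertex // dp -qE walk_vertex // dq.
split.
  move=> /eqP; rewrite !mulf_eq0 (negPf tl) (negPf zg) (negPf zp) orbF => /eqP E.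
  by exists (q, b); rewrite // !inE eqxx.
by case=> x; rewrite !inE => /eqP -> /= ->; rewrite mul0r !mulr0.
Qed.

(** Walks from the parent [g] of [q] can turn away from [(p, c)]. Dividing the one through [(q, b)]
    by one through the other child of [g] gives a function that vanishes on the divisor of [(q, b)]
    only. *)
Lemma not_parent_far g e : q = rcons g e -> p != g -> ~ is_parent q b (p, c).
Proof.
move=> qE pg [_]; apply.
pose d x := if x == q then b else if x == g then e else if x == p then ~~ c else false.
pose d' x := if x == g then ~~ e else if x == p then ~~ c else false.
have gq : g != q by apply/eqP => /(congr1 size); rewrite qE !size_rcons; lia.
have vg : vertex t g by move: vq; rewrite qE => /vertex_rcons.
have dq : d q = b by rewrite /d eqxx.
have dp : d p = ~~ c by rewrite /d (negPf pq) (negPf pg) eqxx.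
have dg : d g = e by rewrite /d (negPf gq) eqxx.
have ngus f : (g, f) \notin us.
  by rewrite !inE !xpair_eqE (negPf gq) [g == p]eq_sym (negPf pg).
apply: (@has_walk_quotient _ _ d d' g) => z zus.
  rewrite walk_vertex // /d' eqxx mulf_neq0 //.
    by apply: contraNneq (ngus (~~ e)); apply: (zus (g, ~~ e)).
  apply: tail_neq0 => //; last by rewrite (negPf pg) eqxx.
  by rewrite qE -[rcons g e]cats0 not_prefix_sibling.
have tl : walk t (sval z) d (rcons q b) != 0.
  by apply: tail_neq0 => //; exact: not_prefix_rcons.
have zg : sval z g e != 0 by apply: contraNneq (ngus e); apply: (zus (g, e)).
have -> : walk t (sval z) d g =
    sval z g e * (sval z q b * walk t (sval z) d (rcons q b)).
  by rewrite walk_vertex // dg -qE walk_vertex // dq.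
split.
  move=> /eqP; rewrite !mulf_eq0 (negPf tl) (negPf zg) orbF => /eqP E.
  by exists (q, b); rewrite // !inE eqxx.
by case=> x; rewrite !inE => /eqP -> /= ->; rewrite mul0r !mulr0.
Qed.

Lemma is_parentP : is_parent q b (p, c) <-> q = rcons p c.
Proof.
split; last exact: is_parent_rcons.
have nil_or_rcons (x : seq bool) : x = [::] \/ exists y e, x = rcons y e.
  by case/lastP: x => [|y e]; [left | right; exists y, e].
have [Eq|[g [e Eq]]] := nil_or_rcons q; first by move/(not_parent_root Eq).
have [pg|pg] := eqVneq p g; last by move/(not_parent_far Eq pg).
have [ec|ec] := eqVneq e c; first by rewrite Eq pg ec.
have qE : q = rcons p (~~ c) by rewrite Eq pg; congr rcons; case: (e) (c) ec => [] [].
have [Ep|[h [f Ep]]] := nil_or_rcons p; first by move/(not_parent_root_sibling Ep qE).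
by move/(not_parent_sibling Ep qE).
Qed.

End Parent.

End BoundaryFunctions.

(** * Isomorphisms permute the boundary divisors *)

Section Isomorphisms.
Local Open Scope ring_scope.
Variable K : numClosedFieldType.
Implicit Types (t : bintree) (Y : tspace K).
Local Notation slot := (seq bool * bool)%type.

(** [y] lies in the closure of the torus orbit of [x]. Only open sets and the torus enter, so
    isomorphisms preserve the relation. *)
Definition specializes Y (x y : Y) : Prop :=
  forall U : Y -> Prop, is_open U -> U y -> exists2 s : Y -> Y, torus s & U (s x).

Definition zero_at t (z : cox K t) (x : slot) : Prop := sval z x.1 x.2 = 0.

Lemma specializesP t Y (r : cox K t -> Y) z z' : presents r ->
  specializes (r z) (r z') <->
  forall x : slot, vertex t x.1 -> zero_at z x -> zero_at z' x.
Proof.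
move=> pr; split=> [sp [q b] /= vq zx | zz' U oU Uz'].
  apply/eqP/negPn/negP => /= z'x.
  pose U : Y -> Prop := fun y => exists2 w : cox K t, r w = y & sval w q b != 0.
  have UE w : U (r w) <-> sval w q b != 0.
    split=> [[w' /(presents_fiber pr) ww' w'x]|wx]; last by exists w.
    by rewrite (cox_equiv_neq0 _ vq ww').
  have oU : is_open U.
    apply/(presents_open pr).
    have -> : (fun w => U (r w)) = (fun w => sval w q b != 0).
      by apply/funext => w; apply/propext.
    by apply: zariski_open_neq0; apply: Polyfun_coord; exists q, b.
  have [s /(presents_torus pr)[c c0 cE]] := sp U oU ((UE _).2 z'x).
  have [|w wE] := @cox_point K t (fun q b => c q b * sval z q b).
    by move=> y vy; case: (svalP z y vy) => ?; [left|right]; exact: mulf_neq0.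
  rewrite (cE z w); last by move=> y e _; rewrite wE.
  by move=> /UE; rewrite wE -[sval z q b]/(sval z (q, b).1 (q, b).2) zx mulr0 eqxx.
have [|||c [w [c0 cw Uw]]] := @orbit_closure K t (fun z => U (r z)) z z'.
- by move=> q b vq; apply: (zz' (q, b)).
- exact/(presents_open pr).
- by [].
by have [f tf fE] := presents_scaling pr c0; exists f; rewrite ?(fE _ _ cw).
Qed.

Definition iso_pair Y Y' (F : Y -> Y') (G : Y' -> Y) : Prop :=
  [/\ cancel F G, cancel G F, morphism_of_spaces F, morphism_of_spaces G &
      forall s : Y' -> Y', torus s <-> torus (fun x => G (s (F x)))].

Lemma iso_pair_sym Y Y' (F : Y -> Y') (G : Y' -> Y) : iso_pair F G -> iso_pair G F.
Proof.
case=> FG GF mF mG tor; split=> // s; rewrite tor.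
by have -> : (fun x => G (F (s (G (F x))))) = s by apply/funext => x; rewrite !FG.
Qed.

Lemma specializes_iso Y Y' (F : Y -> Y') (G : Y' -> Y) x y :
  iso_pair F G -> specializes x y -> specializes (F x) (F y).
Proof.
move=> iFG sp U oU Uy; have [FG GF mF mG _] := iFG; have [_ _ _ _ tor] := iso_pair_sym iFG.
have [s ts Us] := sp _ (mF _ oU).1 Uy.
by exists (fun y => F (s (G y))); [apply/tor | rewrite FG].
Qed.

Section SlotMap.
Variables (t t' : bintree) (Y Y' : tspace K) (r : cox K t -> Y) (r' : cox K t' -> Y').
Hypotheses (pr : presents r) (pr' : presents r').

Lemma boundary_point t0 (x : slot) : exists z : cox K t0,
  forall y : slot, zero_at z y <-> y = x.
Proof.
have [|z zE] := @cox_point K t0 (fun q b => if (q, b) == x then 0 else 1).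
  move=> q vq; case: (x) => y b; rewrite !xpair_eqE; case: (q == y) => /=.
    by case: b; [left | right]; exact: oner_neq0.
  by left; exact: oner_neq0.
exists z => -[q b]; rewrite /zero_at zE /=; split=> [|->]; last by rewrite eqxx.
by case: eqP => // _ /eqP; rewrite oner_eq0.
Qed.

(** Specialisation is inclusion of zero sets. A point with a single zero has only the points without
    zeros strictly above it, and its image has the same property. *)
Lemma slot_corr F G (x : slot) : @iso_pair Y Y' F G -> vertex t x.1 ->
  exists x' : slot, vertex t' x'.1 /\
    forall z w, F (r z) = r' w -> (zero_at z x <-> zero_at w x').
Proof.
move=> iFG vx; have iGF := iso_pair_sym iFG; have [FG GF _ _ _] := iFG.
have [z zE] := boundary_point t x.
have [w wE] := presents_surj pr' (F (r z)).
have trans z1 w1 z2 w2 : F (r z1) = r' w1 -> F (r z2) = r' w2 ->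
    specializes (r z1) (r z2) <-> specializes (r' w1) (r' w2).
  move=> E1 E2; split=> [/(specializes_iso iFG)|/(specializes_iso iGF)].
    by rewrite E1 E2.
  by rewrite -E1 -E2 !FG.
(* If [w] had no zero, it would specialise to every point, and so [z] to the point with all
   coordinates 1. *)
have [x' vx' wx'] : exists2 x' : slot, vertex t' x'.1 & zero_at w x'.
  apply: contrapT => none.
  have [|z1 z1E] := @cox_point K t (fun _ _ => 1).
    by move=> q _; left; exact: oner_neq0.
  have [w1 w1E] := presents_surj pr' (F (r z1)).
  have /(specializesP _ _ pr)/(_ x vx) : specializes (r z) (r z1).
    apply/(trans _ _ _ _ (esym wE) (esym w1E))/(specializesP _ _ pr') => x' vx' wx'.
    by case: none; exists x'.
  by rewrite /zero_at z1E => /(_ ((zE x).2 erefl))/eqP; rewrite oner_eq0.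
have [w1 w1E] := boundary_point t' x'.
have [z1 z1E] := presents_surj pr (G (r' w1)).
have z1E' : F (r z1) = r' w1 by rewrite z1E GF.
(* The single zero of [w1] is a zero of [w], so [z1] specialises to [z]; as [z1] has some zero, this
   zero is [x]. *)
have z1x : zero_at z1 x.
  have sp : specializes (r z1) (r z).
    apply/(trans _ _ _ _ z1E' (esym wE))/(specializesP _ _ pr') => y vy.
    by move/w1E => ->.
  have [y vy z1y] : exists2 y : slot, vertex t y.1 & zero_at z1 y.
    apply: contrapT => none.
    have [|w2 w2E] := @cox_point K t' (fun _ _ => 1).
      by move=> q _; left; exact: oner_neq0.
    have [z2 z2E] := presents_surj pr (G (r' w2)).
    have z2E' : F (r z2) = r' w2 by rewrite z2E GF.
    have /(specializesP _ _ pr')/(_ x' vx') : specializes (r' w1) (r' w2).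
      apply/(trans _ _ _ _ z1E' z2E')/(specializesP _ _ pr) => y vy z1y.
      by case: none; exists y.
    by rewrite /zero_at w2E => /(_ ((w1E x').2 erefl))/eqP; rewrite oner_eq0.
  have /(specializesP _ _ pr)/(_ y vy z1y)/zE yx := sp.
  by rewrite -yx.
exists x'; split=> // z2 w2 E2; split=> [z2x | w2x'].
  have /(specializesP _ _ pr') : specializes (r' w) (r' w2).
    apply/(trans _ _ _ _ (esym wE) E2)/(specializesP _ _ pr) => y vy /zE ->.
    exact: z2x.
  by apply.
have /(specializesP _ _ pr) : specializes (r z1) (r z2).
  apply/(trans _ _ _ _ z1E' E2)/(specializesP _ _ pr') => y vy /w1E ->.
  exact: w2x'.
by apply.
Qed.

End SlotMap.

Section SlotBijection.
Variables (t t' : bintree) (Y Y' : tspace K) (r : cox K t -> Y) (r' : cox K t' -> Y').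
Hypotheses (pr : presents r) (pr' : presents r').
Variables (F : Y -> Y') (G : Y' -> Y) (psi : slot -> slot).
Hypothesis iFG : iso_pair F G.
Hypothesis psi_vertex : forall x, vertex t x.1 -> vertex t' (psi x).1.
Hypothesis psi_zero : forall x, vertex t x.1 -> forall z w,
  F (r z) = r' w -> (zero_at z x <-> zero_at w (psi x)).
Hypothesis psi_surj : forall x', vertex t' x'.1 -> exists2 x, vertex t x.1 & psi x = x'.

Lemma has_function_iso us zl :
  (forall x, x \in us -> vertex t x.1) -> (forall x, x \in zl -> vertex t x.1) ->
  has_function r us zl -> has_function r' (map psi us) (map psi zl).
Proof.
move=> vus vzl [f [rf fE]]; have [FG GF mF mG _] := iFG.
have locE z w : F (r z) = r' w -> zeros_in us z <-> zeros_in (map psi us) w.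
  move=> E; split=> [zus x' vx' wx' | wus x vx zx].
    have [x vx xE] := psi_surj vx'; rewrite -xE in wx' *.
    by apply/map_f/zus => //; apply/(psi_zero vx E).
  have /mapP[y yus xy] := wus (psi x) (psi_vertex vx) ((psi_zero vx E).1 zx).
  have vy := vus y yus.
  have [zb zbE] := boundary_point t x.
  have [wb wbE] := presents_surj pr' (F (r zb)).
  have : zero_at zb y.
    apply/(psi_zero vy (esym wbE)); rewrite -xy.
    by apply/(psi_zero vx (esym wbE))/zbE.
  by move=> /zbE <-.
have UE : zero_locus r' (map psi us) = (fun y => zero_locus r us (G y)).
  apply/funext => y; apply/propext; have [w <-] := presents_surj pr' y.
  have [z zw] := presents_surj pr (G (r' w)).
  have E : F (r z) = r' w by rewrite zw GF.
  rewrite -zw (zero_locusE pr') (zero_locusE pr); apply: iff_sym; exact: locE.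
exists (fun y => f (G y)); split.
  by rewrite UE; apply: (mG _ _).2 => //; apply: open_zero_locus.
move=> w; have [z zw] := presents_surj pr (G (r' w)).
have E : F (r z) = r' w by rewrite zw GF.
move=> /(locE z w E) zus; rewrite -zw fE //; split.
  move=> [x xzl zx]; exists (psi x); first exact: map_f.
  by apply/(psi_zero (vzl x xzl) E).
move=> [x' /mapP[x xzl ->] wx]; exists x => //.
by apply/(psi_zero (vzl x xzl) E).
Qed.

Lemma psi_inj x y : vertex t x.1 -> vertex t y.1 -> psi x = psi y -> x = y.
Proof.
move=> vx vy xy; have [zb zbE] := boundary_point t x.
have [wb wbE] := presents_surj pr' (F (r zb)).
have : zero_at zb y.
  by apply/(psi_zero vy (esym wbE)); rewrite -xy; apply/(psi_zero vx (esym wbE))/zbE.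
by move=> /zbE.
Qed.

(** The two slots of one vertex cannot vanish together, whereas slots of different vertices can; so
    the images of siblings belong to one vertex. *)
Lemma psi_sibling q b : vertex t q -> psi (q, ~~ b) = ((psi (q, b)).1, ~~ (psi (q, b)).2).
Proof.
move=> vq; have [_ GF _ _ _] := iFG.
have vb (e : bool) : vertex t (q, e).1 by [].
have ne : psi (q, b) != psi (q, ~~ b).
  by apply/eqP => /(psi_inj (vb b) (vb (~~ b))) []; case: (b).
case Eb: (psi (q, b)) ne => [p c]; case Eb': (psi (q, ~~ b)) => [p' c'] ne /=.
have [pp'|pp'] := eqVneq p' p.
  by move: ne; rewrite pp' xpair_eqE eqxx /=; case: (c) (c') => [] [].
exfalso; have [|w wE] := @cox_point K t' (fun x e => (((x, e) != (p, c)) && ((x, e) != (p', c')))%:R).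
  move=> x vx; rewrite !xpair_eqE; have [->|xp] := eqVneq x p.
    rewrite [p == p']eq_sym (negPf pp') /=.
    by case: (c); [left | right]; exact: oner_neq0.
  by case: (x == p') (c') => [] [] /=; [left | right | left | left]; exact: oner_neq0.
have [z zE] := presents_surj pr (G (r' w)).
have E : F (r z) = r' w by rewrite zE GF.
have z1 : zero_at z (q, b).
  by apply/(psi_zero (vb b) E); rewrite Eb /zero_at wE eqxx.
have z2 : zero_at z (q, ~~ b).
  by apply/(psi_zero (vb (~~ b)) E); rewrite Eb' /zero_at wE eqxx andbF.
have := svalP z q vq; move: z1 z2; rewrite /zero_at /=.
by case: (b) => /= -> ->; rewrite eqxx => -[].
Qed.

End SlotBijection.

Lemma slot_map t t' Y Y' (r : cox K t -> Y) (r' : cox K t' -> Y') F G :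
  presents r -> presents r' -> @iso_pair Y Y' F G -> exists psi : slot -> slot,
    forall x, vertex t x.1 -> vertex t' (psi x).1 /\
      forall z w, F (r z) = r' w -> (zero_at z x <-> zero_at w (psi x)).
Proof.
move=> pr pr' iFG.
have [|psi psiE] := @choice _ _ (fun x x' => vertex t x.1 -> vertex t' x'.1 /\
      forall z w, F (r z) = r' w -> (zero_at z x <-> zero_at w x')); last by exists psi.
move=> x; case vx: (vertex t x.1); last by exists x.
by have [x' xx'] := slot_corr pr pr' iFG vx; exists x'.
Qed.

Definition slot_correspondence t t' Y Y' (r : cox K t -> Y) (r' : cox K t' -> Y')
    (F : Y -> Y') (psi : slot -> slot) : Prop :=
  forall x, vertex t x.1 -> vertex t' (psi x).1 /\
    forall z w, F (r z) = r' w -> (zero_at z x <-> zero_at w (psi x)).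

Lemma slot_correspondence_cancel t t' Y Y' (r : cox K t -> Y) (r' : cox K t' -> Y')
    F G psi psi' : presents r' -> @iso_pair Y Y' F G ->
  slot_correspondence r r' F psi -> slot_correspondence r' r G psi' ->
  forall x, vertex t x.1 -> psi' (psi x) = x.
Proof.
move=> pr' [FG GF _ _ _] cpsi cpsi' x vx; have [z zE] := boundary_point t x.
have [w wE] := presents_surj pr' (F (r z)).
suff : zero_at z (psi' (psi x)) by move/zE.
have [vpx px] := cpsi x vx; apply/((cpsi' _ vpx).2 w z); first by rewrite wE FG.
by apply/(px z w); rewrite ?wE //; apply/zE.
Qed.

Lemma slot_map_parent t t' Y Y' (r : cox K t -> Y) (r' : cox K t' -> Y') F G psi psi' :
  presents r -> presents r' -> @iso_pair Y Y' F G ->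
  slot_correspondence r r' F psi -> slot_correspondence r' r G psi' ->
  forall p c b, vertex t (rcons p c) ->
    (psi (rcons p c, b)).1 = rcons (psi (p, c)).1 (psi (p, c)).2.
Proof.
move=> pr pr' iFG cpsi cpsi' p c b vq; have iGF := iso_pair_sym iFG.
have K1 := slot_correspondence_cancel pr' iFG cpsi cpsi'.
have K2 := slot_correspondence_cancel pr iGF cpsi' cpsi.
have pv x vx := (cpsi x vx).1; have pz x vx := (cpsi x vx).2.
have pv' x vx := (cpsi' x vx).1; have pz' x vx := (cpsi' x vx).2.
have ps x' (vx' : vertex t' x'.1) : exists2 x, vertex t x.1 & psi x = x'.
  by exists (psi' x'); [exact: pv' | exact: K2].
have ps' x (vx : vertex t x.1) : exists2 x', vertex t' x'.1 & psi' x' = x.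
  by exists (psi x); [exact: pv | exact: K1].
have sib q e vq' := psi_sibling pr pr' iFG pz e (vq' : vertex t q).
have inj := psi_inj pr' pz.
set q := rcons p c in vq *.
have vp : vertex t p by apply: vertex_rcons vq.
have pq : p != q by apply/eqP => /(congr1 size); rewrite size_rcons; lia.
have [h1 h2] : is_parent r q b (p, c) by apply/is_parentP.
have vus x : x \in [:: (q, b); (q, ~~ b); (p, c)] -> vertex t x.1.
  by rewrite !inE => /or3P[] /eqP ->.
have vzl x : x \in [:: (q, b); (p, c)] -> vertex t x.1.
  by rewrite !inE => /orP[] /eqP ->.
have vz1 x : x \in [:: (q, b)] -> vertex t x.1 by rewrite !inE => /eqP ->.
have pq' : (psi (p, c)).1 != (psi (q, b)).1.
  apply/eqP => E; have : psi (p, c) = psi (q, b) \/ psi (p, c) = psi (q, ~~ b).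
    rewrite (sib q b vq); case: (psi (p, c)) (psi (q, b)) E => [x e] [x' e'] /= ->.
    by case: e e' => [] []; auto.
  by case=> /inj E'; move: pq; rewrite -[p]/((p, c).1) E' ?eqxx.
have par : is_parent r' (psi (q, b)).1 (psi (q, b)).2 ((psi (p, c)).1, (psi (p, c)).2).
  rewrite /is_parent -sib // -!surjective_pairing; split.
    exact: (has_function_iso pr pr' iFG pv pz ps vus vzl h1).
  move=> hf; apply: h2.
  have := has_function_iso pr' pr iGF pv' pz' ps' _ _ hf.
  rewrite /= !K1 //; apply=> x; rewrite !inE.
    by case/or3P => /eqP ->; apply: pv.
  by move/eqP => ->; apply: pv.
by case: (@is_parentP K t' Y' r' pr' _ (psi (q, b)).2 _ (psi (p, c)).2
  (pv (q, b) vq) (pv (p, c) vp) pq') => /(_ par).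
Qed.

Lemma presentable_iso_eqv t t' Y Y' :
  presentable t Y -> presentable t' Y' -> toric_iso Y Y' -> tree_eqv t t'.
Proof.
move=> [r pr] [r' pr'] [F [G iFG]]; have iGF := iso_pair_sym iFG.
have [psi cpsi] := slot_map pr pr' iFG; have [psi' cpsi'] := slot_map pr' pr iGF.
have K1 := slot_correspondence_cancel pr' iFG cpsi cpsi'.
have K2 := slot_correspondence_cancel pr iGF cpsi' cpsi.
have par := slot_map_parent pr pr' iFG cpsi cpsi'.
have par' := slot_map_parent pr' pr iGF cpsi' cpsi.
have pv x vx := (cpsi x vx).1; have pz x vx := (cpsi x vx).2.
have pv' x vx := (cpsi' x vx).1; have pz' x vx := (cpsi' x vx).2.
have sib q vq := psi_sibling pr pr' iFG pz false (vq : vertex t q).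
have bE q b : vertex t q -> (psi (q, b)).1 = (psi (q, false)).1.
  by move=> vq; case: b; rewrite // (sib q vq).
apply: (@tree_eqv_of_child_map t t' (fun q => (psi (q, false)).1)).
- by move=> q vq; apply: pv.
- move=> q q' vq vq' E; have inj := psi_inj pr' pz.
  have : psi (q', false) = psi (q, false) \/ psi (q', false) = psi (q, true).
    rewrite (sib q vq); case: (psi (q', false)) (psi (q, false)) E => [x e] [x' e'] /= ->.
    by case: e e' => [] []; auto.
  by case=> /inj E'; have := E' vq' vq => -[->].
- move=> q' vq'; exists (psi' (q', false)).1; first exact: (pv' (q', false) vq').
  by rewrite -(bE _ (psi' (q', false)).2) -?surjective_pairing ?K2 //; apply: (pv' (q', false)).
(* If the image of the root had a parent, the inverse correspondence would make the root a child. *)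
- move=> v0; case/lastP E: (psi ([::], false)).1 => [|p c] //.
  have vE := pv ([::], false) v0; rewrite E in vE.
  have := par' p c (psi ([::], false)).2 vE.
  rewrite -E -surjective_pairing K1 //= => /(congr1 size).
  by rewrite size_rcons.
- move=> p b vq; exists (psi (p, b)).2.
  by rewrite (par p b false vq) (bE p b (vertex_rcons vq)).
Qed.

End Isomorphisms.

(** * Krull dimension *)

Section AlgebraicDependence.
Local Open Scope ring_scope.
Variables (K : fieldType) (P : Type).
Implicit Types f g : P -> K.

Section BoundedDegree.
Variables (n : nat) (x : 'I_n -> P -> K).

Definition monomial (e : 'I_n -> nat) (p : P) : K := \prod_i x i p ^+ e i.

(** The bound concerns each exponent separately, so that there are (D + 1)^n monomials to count. *)
Inductive degree_le (D : nat) : (P -> K) -> Prop :=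
| Degree_zero : degree_le D (fun=> 0)
| Degree_add f c e : degree_le D f -> (forall i, e i <= D)%N ->
    degree_le D (fun p => f p + c * monomial e p).

Lemma degree_leS D D' f : (D <= D')%N -> degree_le D f -> degree_le D' f.
Proof.
move=> DD'; elim=> [|g c e _ IH eD]; first exact: Degree_zero.
by apply: Degree_add => // i; apply: leq_trans DD'.
Qed.

Lemma degree_leD D f g : degree_le D f -> degree_le D g -> degree_le D (fun p => f p + g p).
Proof.
move=> df; elim=> [|h c e _ IH eD].
  by have -> : (fun p => f p + 0) = f by apply/funext => p; rewrite addr0.
have -> : (fun p => f p + (h p + c * monomial e p)) =
          (fun p => (f p + h p) + c * monomial e p) by apply/funext => p; rewrite addrA.
exact: Degree_add.
Qed.

Lemma degree_le_monomial D c e : (forall i, e i <= D)%N -> degree_le D (fun p => c * monomial e p).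
Proof.
move=> eD; have -> : (fun p => c * monomial e p) = (fun p => 0 + c * monomial e p).
  by apply/funext => p; rewrite add0r.
exact/Degree_add/eD/Degree_zero.
Qed.

Lemma degree_leM D D' f g :
  degree_le D f -> degree_le D' g -> degree_le (D + D') (fun p => f p * g p).
Proof.
move=> df dg; elim: df => [|h c e _ IH eD].
  have -> : (fun p => 0 * g p) = fun=> 0 by apply/funext => p; rewrite mul0r.
  exact: Degree_zero.
have -> : (fun p => (h p + c * monomial e p) * g p) =
  (fun p => h p * g p + c * monomial e p * g p) by apply/funext => p; rewrite mulrDl.
apply: degree_leD => //; elim: dg => [|h' c' e' _ IH' eD'].
  have -> : (fun p => c * monomial e p * 0) = fun=> 0 by apply/funext => p; rewrite mulr0.
  exact: Degree_zero.
have -> : (fun p => c * monomial e p * (h' p + c' * monomial e' p)) =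
  (fun p => c * monomial e p * h' p + (c * c') * monomial (fun i => e i + e' i)%N p).
  apply/funext => p; rewrite mulrDr mulrACA; congr (_ + _ * _).
  by rewrite -big_split; apply: eq_bigr => i _; rewrite exprD.
by apply: Degree_add => // i; apply: leq_add.
Qed.

Lemma degree_le_cst D c : degree_le D (fun=> c).
Proof.
have -> : (fun=> c) = (fun p => c * monomial (fun=> 0%N) p).
  by apply/funext => p; rewrite /monomial big1 ?mulr1 // => i _; rewrite expr0.
exact: degree_le_monomial.
Qed.

Lemma degree_leX D f m : degree_le D f -> degree_le (m * D) (fun p => f p ^+ m).
Proof.
move=> df; elim: m => [|m IH].
  by have -> : (fun p => f p ^+ 0) = fun=> 1 by []; exact: degree_le_cst.
have -> : (fun p => f p ^+ m.+1) = (fun p => f p * f p ^+ m).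
  by apply/funext => p; rewrite exprS.
by rewrite mulSn; apply: degree_leM.
Qed.

Lemma polyfun_degree (S : (P -> K) -> Prop) f :
  (forall g, S g -> exists i, g = x i) -> polyfun S f -> exists D, degree_le D f.
Proof.
move=> Sx; elim=> [c | g /Sx[i ->] | g h _ [D dg] _ [D' dh] | g h _ [D dg] _ [D' dh]].
- by exists 0%N; exact: degree_le_cst.
- exists 1%N; have -> : x i = (fun p => 1 * monomial (fun j => nat_of_bool (j == i)) p).
    apply/funext => p; rewrite mul1r /monomial (bigD1 i) //= eqxx expr1 big1 ?mulr1 //.
    by move=> j /negPf ->; rewrite expr0.
  by apply: degree_le_monomial => j; case: (j == i).
- exists (maxn D D'); apply: degree_leD.
    by apply: degree_leS dg; exact: leq_maxl.
  by apply: degree_leS dh; exact: leq_maxr.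
- by exists (D + D')%N; exact: degree_leM.
Qed.

Lemma degree_le_sum D f : degree_le D f ->
  exists c : {ffun 'I_n -> 'I_D.+1} -> K, forall p,
    f p = \sum_e c e * monomial (fun i => e i) p.
Proof.
elim=> [|g c e _ [c' cE] eD].
  by exists (fun=> 0) => p; rewrite big1 // => e _; rewrite mul0r.
pose e' : {ffun 'I_n -> 'I_D.+1} := [ffun i => inord (e i)].
exists (fun e0 => c' e0 + (if e0 == e' then c else 0)) => p.
rewrite cE; under [RHS]eq_bigr => i _ do rewrite mulrDl.
rewrite big_split /=; congr (_ + _).
rewrite (bigD1 e') //= eqxx big1 ?addr0 => [|e0 /negPf ->]; last by rewrite mul0r.
by congr (_ * _); apply: eq_bigr => i _; rewrite ffunE inordK // ltnS.
Qed.

Lemma linear_dependence D (I : eqType) (s : seq I) (F : I -> P -> K) :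
  uniq s -> (forall i, i \in s -> degree_le D (F i)) -> (D.+1 ^ n < size s)%N ->
  exists2 c : I -> K, (exists2 i, i \in s & c i != 0) &
    forall p, \sum_(i <- s) c i * F i p = 0.
Proof.
case: s => [//|i0 s0]; set s := i0 :: s0 => us dF sn.
have [C CE] : exists C : I -> {ffun 'I_n -> 'I_D.+1} -> K, forall i, i \in s ->
    forall p, F i p = \sum_e C i e * monomial (fun j => e j) p.
  have [|C CE] := @choice _ _ (fun i c => i \in s ->
    forall p, F i p = \sum_(e : {ffun 'I_n -> 'I_D.+1}) c e * monomial (fun j => e j) p).
    move=> i; case ii: (i \in s); last by exists (fun=> 0).
    by have [c cE] := degree_le_sum (dF i ii); exists c.
  by exists C.
pose N := #|{ffun 'I_n -> 'I_D.+1}|.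
pose A : 'M[K]_(size s, N) := \matrix_(i, j) C (nth i0 s i) (enum_val j).
(* The matrix of coefficients has more rows than columns; a vector of its left kernel is the
   relation. *)
have : kermx A != 0.
  rewrite kermx_eq0 /row_free neq_ltn (leq_ltn_trans (rank_leq_col A)) //.
  by rewrite /N card_ffun !card_ord.
move=> /rowV0Pn[v /sub_kermxP vA v0].
have [k vk] : exists k, v 0 k != 0.
  apply: contrapT => h; move: v0; apply/negP/negPn/eqP/rowP => k; rewrite mxE.
  by apply/eqP/negPn/negP => vk; apply: h; exists k.
have idx i : i \in s -> (index i s < size s)%N by rewrite index_mem.
exists (fun i => if insub (index i s) is Some k then v 0 k else 0).
  exists (nth i0 s k); first by rewrite mem_nth.
  by rewrite index_uniq // valK.
move=> p; rewrite (big_nth i0) big_mkord.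
under eq_bigr => i _.
  rewrite index_uniq // valK CE ?mem_nth // mulr_sumr.
  under eq_bigr => e _ do rewrite mulrA.
  over.
rewrite exchange_big big1 //= => e _; rewrite -mulr_suml.
have /rowP/(_ (enum_rank e)) := vA; rewrite !mxE => E.
rewrite [X in X * _](_ : _ = 0) ?mul0r // -[RHS]E; apply: eq_bigr => i _.
by rewrite mxE enum_rankK.
Qed.

End BoundedDegree.

Section IteratedPolynomials.
Variable f : nat -> P -> K.

(* Polynomials in k variables, as polynomials in the last variable, listed by
   increasing degree, over polynomials in the others; the variable of index i
   is evaluated at f i. *)
Fixpoint npoly (k : nat) : Type := if k is k'.+1 then seq (npoly k') else K.

Fixpoint neval k : npoly k -> P -> K :=
  match k with
  | 0 => fun c _ => c
  | k'.+1 => fun s p => foldr (fun c acc => neval c p + f k' p * acc) 0 s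
  end.

Fixpoint nnonzero k : npoly k -> bool :=
  match k with
  | 0 => fun c => c != 0
  | k'.+1 => fun s => has (@nnonzero k') s
  end.

Lemma neval_zero k (c : npoly k) p : ~~ nnonzero c -> neval c p = 0.
Proof.
elim: k c => [|k IH] /= c; first by rewrite negbK => /eqP.
by elim: c => //= c s IHs; rewrite negb_or => /andP[/IH -> /IHs ->]; rewrite mulr0 addr0.
Qed.

Fixpoint exponents (N k : nat) : seq (seq nat) :=
  if k is k'.+1 then [seq i :: e | i <- iota 0 N, e <- exponents N k'] else [:: [::]].

Lemma size_exponents N k : size (exponents N k) = (N ^ k)%N.
Proof. by elim: k => //= k IH; rewrite size_allpairs size_iota IH expnS. Qed.

Lemma uniq_exponents N k : uniq (exponents N k).
Proof.
elim: k => //= k IH; apply: allpairs_uniq => //; first exact: iota_uniq.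
by move=> [i e] [j e'] _ _ [-> ->].
Qed.

Fixpoint npoly_of (N k : nat) : (seq nat -> K) -> npoly k :=
  match k with
  | 0 => fun c => c [::]
  | k'.+1 => fun c => [seq npoly_of N k' (fun e => c (i :: e)) | i <- iota 0 N]
  end.

Fixpoint nmonomial (k : nat) (e : seq nat) (p : P) : K :=
  match k, e with
  | k'.+1, i :: e' => f k' p ^+ i * nmonomial k' e' p
  | _, _ => 1
  end.

Lemma nnonzero_npoly_of N k c e : e \in exponents N k -> c e != 0 -> nnonzero (npoly_of N k c).
Proof.
elim: k c e => [|k IH] c e /=; first by rewrite inE => /eqP ->.
move=> /allpairsP[[i e'] /= [iN e'k ->]] ce; rewrite has_map; apply/hasP.
by exists i => //=; apply: (IH _ e').
Qed.

Lemma horner_foldr (T : Type) (F : T -> K) (y : K) (G : nat -> T) m N :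
  foldr (fun c acc => F c + y * acc) 0 [seq G i | i <- iota m N] * y ^+ m =
  \sum_(i <- iota m N) y ^+ i * F (G i).
Proof.
elim: N m => [|N IH] m /=; first by rewrite big_nil mul0r.
rewrite big_cons -IH mulrDl [F _ * _]mulrC; congr (_ + _).
by rewrite exprS mulrAC mulrA [_ * y]mulrC mulrAC.
Qed.

Lemma neval_npoly_of N k c p :
  neval (npoly_of N k c) p = \sum_(e <- exponents N k) c e * nmonomial k e p.
Proof.
elim: k c => [|k IH] c /=; first by rewrite big_seq1 mulr1.
rewrite -[LHS]mulr1 -(expr0 (f k p)) horner_foldr big_allpairs_dep.
apply: eq_bigr => i _; rewrite IH mulr_sumr; apply: eq_bigr => e _.
by rewrite /= mulrCA.
Qed.

Lemma polyfun_neval (S : (P -> K) -> Prop) k (c : npoly k) :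
  (forall i, (i < k)%N -> polyfun S (f i)) -> polyfun S (neval c).
Proof.
elim: k c => [|k IH] /= c Sf; first exact: Polyfun_const.
elim: c => [|c s IHs] /=; first exact: Polyfun_const.
apply: Polyfun_add; first by apply: IH => i ik; apply: Sf; rewrite ltnW.
by apply: Polyfun_mul => //; apply: Sf.
Qed.

(* A strictly increasing chain of primes I k, ..., I 0 makes the f i, chosen
   in the successive differences, algebraically independent. *)
Lemma chain_independent (S : (P -> K) -> Prop) (I : nat -> (P -> K) -> Prop) k :
  (forall i, (i < k)%N -> polyfun S (f i)) ->
  (forall i g h, (i <= k)%N -> polyfun S g -> polyfun S h -> I i (fun p => g p * h p) ->
     I i g \/ I i h) ->
  (forall i g, (i < k)%N -> I i.+1 g -> I i g) ->
  (forall i g h, I i (fun p => g p + h p) -> I i h -> I i g) ->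
  (forall i g h, I i g -> I i (fun p => g p * h p)) ->
  (forall c, c != 0 -> ~ I 0%N (fun=> c)) ->
  (forall i, (i < k)%N -> I i (f i) /\ ~ I i.+1 (f i)) ->
  forall c : npoly k, nnonzero c -> ~ I k (neval c).
Proof.
move=> Sf prime dec sub ideal I0 If.
suff main : forall j, (j <= k)%N -> forall c : npoly j, nnonzero c -> ~ I j (neval c).
  exact: main (leqnn k).
elim=> [|j IH] jk; first by move=> c; apply: I0.
have IHj := IH (ltnW jk); have [Ij nIj] := If j jk.
(* If the constant coefficient is non-zero, it is what remains modulo the prime of index [j], which
   contains [f j]. Otherwise the value is a multiple of [f j], and primality at [j.+1] removes this
   factor. *)
elim=> [|c s IHs] //=; case nc: (nnonzero c) => /=.
  move=> _ /(dec _ _ jk) /sub Ic; apply: (IHj c nc); apply: Ic.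
  exact: ideal.
have E : neval (k := j.+1) (c :: s) = fun p => f j p * neval (k := j.+1) s p.
  by apply/funext => p /=; rewrite neval_zero ?nc // add0r.
move=> ns; rewrite -[X in I _ X]/(neval (k := j.+1) (c :: s)) E => /prime.
case=> //; first exact: Sf.
  by apply: polyfun_neval => i ij; apply: Sf; apply: leq_trans ij jk.
exact: IHs.
Qed.

Lemma degree_le_nmonomial n (x : 'I_n -> P -> K) D N k e :
  (forall i, (i < k)%N -> degree_le x D (f i)) -> e \in exponents N k ->
  degree_le x (k * (N * D)) (nmonomial k e).
Proof.
elim: k e => [|k IH] e df /=; first by move=> _; exact: degree_le_cst.
move=> /allpairsP[[i e'] /= [iN e'k ->]]; rewrite mulSn; apply: degree_leM.
  apply: (@degree_leS _ _ (i * D)).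
    by rewrite leq_mul2r ltnW ?orbT //; move: iN; rewrite mem_iota.
  by apply: degree_leX; apply: df.
by apply: IH => // j jk; apply: df; rewrite ltnW.
Qed.

Lemma algebraic_dependence n (x : 'I_n -> P -> K) D :
  (forall i, (i < n.+1)%N -> degree_le x D (f i)) ->
  exists2 c : npoly n.+1, nnonzero c & forall p, neval c p = 0.
Proof.
(* The N^(n+1) monomials in the [f i] with exponents below N are combinations of ((n+1)ND + 1)^n <=
   (NE)^n monomials in the coordinates, and N > E^n makes the first number the larger one. *)
move=> df; pose E := (n.+1 * D).+1; pose N := (E ^ n).+1.
have [||c [e es ce] cE] := @linear_dependence n x (n.+1 * (N * D)) _
    (exponents N n.+1) (nmonomial n.+1) (uniq_exponents _ _).
- by move=> e; apply: degree_le_nmonomial.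
- rewrite size_exponents; apply: (@leq_ltn_trans ((N * E) ^ n)).
    have [->|n0] := posnP n; first by rewrite !expn0.
    by rewrite leq_exp2r // mulnS mulnCA -addn1 addnC leq_add2r.
  by rewrite expnMn expnSr ltn_pmul2l // expn_gt0.
exists (npoly_of N n.+1 c); first exact: nnonzero_npoly_of ce.
by move=> p; rewrite neval_npoly_of cE.
Qed.

End IteratedPolynomials.
End AlgebraicDependence.

(** * Length of chains of irreducible closed sets *)

Section Dimension.
Local Open Scope ring_scope.
Variables (K : numFieldType) (t : bintree) (Y : tspace K) (r : cox K t -> Y).
Hypothesis pr : presents r.
Local Notation n := (nb_vertices t).

Section UpperBound.
Variables (k : nat) (Z : nat -> Y -> Prop) (z0 : cox K t) (d : seq bool -> bool).
Hypotheses (chainZ : irreducible_chain k Z) (Zz0 : Z 0%N (r z0)) (dz0 : in_chart d z0).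

Let I i (f : (seq bool -> K) -> K) : Prop := forall x, Z i (r (chart_map t d x)) -> f x = 0.

(* The complement of the closed set {f = 0} of the chart, closed up in Y. *)
Let nonzero (f : (seq bool -> K) -> K) : Y -> Prop := fun y => exists z, [/\ r z = y, in_chart d z & f (chart_coord d z) != 0].

Lemma nonzeroE (f : (seq bool -> K) -> K) z : nonzero f (r z) <-> in_chart d z /\ f (chart_coord d z) != 0.
Proof.
split=> [[w [/(presents_fiber pr) wz dw fw]]|[dz fz]]; last by exists z.
by split; [exact: in_chart_equiv wz dw | rewrite -(chart_coord_equiv d wz)].
Qed.

Lemma closed_vanishing (f : (seq bool -> K) -> K) : polyfun (affine_coord t) f -> is_closed (fun y => ~ nonzero f y).
Proof.
move=> pf; apply/(presents_open pr).
have -> : (fun z => ~ ~ nonzero f (r z)) =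
    (fun z => in_chart d z /\ f (chart_coord d z) != 0).
  by apply/funext => z; apply/propext; rewrite -nonzeroE; split=> [/contrapT|? ?].
apply: regular_open_neq0; first exact: open_in_chart.
apply: (@regular_polyfun_comp _ _ _ _ (affine_coord t)) => // c [q vq ->].
exact: regular_chart_coord.
Qed.

Lemma chain_subset i : (i <= k)%N -> forall y, Z 0%N y -> Z i y.
Proof.
elim: i => // i IH ik y /(IH (ltnW ik)); exact: (chainZ.2 i ik).1.
Qed.

(** The two closed sets are complements of loci inside the chart. They contain everything outside
    it, so that irreducibility can be applied in [Y] itself. *)
Lemma chain_prime i (f g : (seq bool -> K) -> K) : (i <= k)%N -> polyfun (affine_coord t) f -> polyfun (affine_coord t) g ->
  I i (fun x => f x * g x) -> I i f \/ I i g.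
Proof.
move=> ik pf pg Ifg; have [_ _ irr] := chainZ.1 i ik.
have van h x : polyfun (affine_coord t) h -> ~ nonzero h (r (chart_map t d x)) -> h x = 0.
  move=> ph; rewrite nonzeroE => nz; apply/eqP/negPn/negP => hx; apply: nz; split.
    exact: in_chart_map.
  by rewrite (affine_polyfun_ext ph (chart_mapK d x)).
case: (irr _ _ (closed_vanishing pf) (closed_vanishing pg)).
- move=> y Zy; apply: contrapT => /not_orP[/contrapT fy /contrapT].
  move: fy => [z [zy dz fz]]; rewrite -zy nonzeroE => -[_ gz].
  have : Z i (r (chart_map t d (chart_coord d z))).
    suff -> : r (chart_map t d (chart_coord d z)) = r z by rewrite zy.
    apply/(presents_fiber pr)/cox_equiv_sym; exact: chart_coordK.
  by move=> /Ifg/eqP; rewrite mulf_eq0 (negPf fz) (negPf gz).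
- by move=> Zf; left=> x /Zf /van; apply.
- by move=> Zg; right=> x /Zg /van; apply.
Qed.

(** The larger set is irreducible and meets the chart in [r z0], so it is not covered by the smaller
    set and the complement of the chart. A basic open set around a point left over gives the
    function. *)
Lemma chain_separate i : (i < k)%N ->
  exists f, [/\ polyfun (affine_coord t) f, I i f & ~ I i.+1 f].
Proof.
move=> ik; have [cZ _ _] := chainZ.1 i (ltnW ik); have [_ _ irr] := chainZ.1 i.+1 ik.
have [sub [y [Zy nZy]]] := chainZ.2 i ik.
have [w [Zw nZw dw]] : exists w, [/\ Z i.+1 (r w), ~ Z i (r w) & in_chart d w].
  apply: contrapT => h; have c1 := closed_vanishing (Polyfun_const (affine_coord t) 1).
  case: (irr _ _ cZ c1).
  - move=> y' Zy'; apply: contrapT => /not_orP[nZ /contrapT [w [wy dw _]]].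
    by apply: h; exists w; rewrite wy.
  - by move=> /(_ y Zy).
  - move=> /(_ (r z0)); apply; first exact: chain_subset.
    by apply/nonzeroE; rewrite oner_neq0.
have /(presents_open pr) oU : is_open (fun y => ~ Z i y) by [].
have E : r (chart_map t d (chart_coord d w)) = r w.
  by apply/(presents_fiber pr)/cox_equiv_sym; exact: chart_coordK.
have [|g [pg gw gZ]] := oU (chart_map t d (chart_coord d w)); first by rewrite E.
exists (fun x => g (chart_map t d x)); split; first exact: polyfun_chart_map.
  by move=> x Zx; apply/eqP/negPn/negP => /gZ.
by move=> /(_ (chart_coord d w)); rewrite E => /(_ Zw)/eqP; rewrite (negPf gw).
Qed.

Lemma chain_length : (k <= n)%N.
Proof.
rewrite leqNgt; apply/negP => nk.
have [F FE] : exists F, forall i, (i < k)%N ->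
    [/\ polyfun (affine_coord t) (F i), I i (F i) & ~ I i.+1 (F i)].
  have [|F FE] := @choice _ _ (fun i f => (i < k)%N ->
    [/\ polyfun (affine_coord t) f, I i f & ~ I i.+1 f]); last by exists F.
  move=> i; case ik: (i < k)%N; last by exists (fun=> 0).
  by have [f fE] := chain_separate ik; exists f.
pose x (i : 'I_n) (p : seq bool -> K) := p (nth [::] (vertices t) i).
have Sx g : affine_coord t g -> exists i, g = x i.
  move=> [q vq ->]; have iq : (index q (vertices t) < n)%N.
    by rewrite -size_vertices index_mem mem_vertices.
  by exists (Ordinal iq); apply/funext => p; rewrite /x /= nth_index // mem_vertices.
have [D DE] : exists D, forall i, (i < n.+1)%N -> degree_le x D (F i).
  elim: n.+1 nk => [|m IH] mk; first by exists 0%N.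
  have [D DE] := IH (ltnW mk); have [pF _ _] := FE m mk.
  have [D' dF] := polyfun_degree Sx pF; exists (maxn D D') => i.
  rewrite ltnS leq_eqVlt => /predU1P[->|/DE dFi].
    by apply: degree_leS dF; exact: leq_maxr.
  by apply: degree_leS dFi; exact: leq_maxl.
have [c nc cE] := algebraic_dependence DE.
have ik i : (i < n.+1)%N -> (i < k)%N by move=> /leq_trans; apply.
apply: (@chain_independent K _ F (affine_coord t) I n.+1 _ _ _ _ _ _ _ c nc).
- by move=> i /ik /FE[].
- by move=> i g h ilt; apply: chain_prime; apply: leq_trans ilt nk.
- by move=> i g /ik ilt Ig y Zy; apply: Ig; apply: (chainZ.2 i ilt).1.
- by move=> i g h Igh Ih y Zy; have := Igh y Zy; rewrite (Ih y Zy) addr0.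
- by move=> i g h Ig y Zy; rewrite (Ig y Zy) mul0r.
- move=> a a0 /(_ (chart_coord d z0)) h; move/eqP: a0; apply; apply: h.
  suff -> : r (chart_map t d (chart_coord d z0)) = r z0 by [].
  apply/(presents_fiber pr)/cox_equiv_sym; exact: chart_coordK.
- by move=> i /ik /FE[].
- by move=> y _.
Qed.

End UpperBound.

Definition coordinate_chain (i : nat) : Y -> Prop := fun y => exists2 z, r z = y &
  forall j, (i <= j < n)%N -> sval z (nth [::] (vertices t) j) false = 0.

Lemma vertex_nth j : (j < n)%N -> vertex t (nth [::] (vertices t) j).
Proof. by move=> jn; rewrite -mem_vertices mem_nth // size_vertices. Qed.

Lemma coordinate_chainE i z : coordinate_chain i (r z) <->
  forall j, (i <= j < n)%N -> sval z (nth [::] (vertices t) j) false = 0.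
Proof.
split=> [[w /(presents_fiber pr) wz wE] j ij|zE]; last by exists z.
have jn : (j < n)%N by case/andP: ij.
by apply/eqP; rewrite -(negbK (_ == _)) (cox_equiv_neq0 _ (vertex_nth jn) wz) wE // eqxx.
Qed.

Lemma generic_point i : exists z : cox K t, forall q b, vertex t q ->
  sval z q b = if b || (index q (vertices t) < i)%N then 1 else 0.
Proof.
have [|z zE] := @cox_point K t (fun q b => if b || (index q (vertices t) < i)%N then 1 else 0).
  by move=> q vq; right; exact: oner_neq0.
by exists z => q b vq; rewrite zE.
Qed.

(** The set is the closure of the torus orbit of its generic point: open sets that meet it meet the
    orbit, and within the orbit they meet each other. *)
Lemma coordinate_chain_irreducible i : irreducible_closed (coordinate_chain i).
Proof.
have [z zE] := generic_point i.
have Zz : coordinate_chain i (r z).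
  apply/coordinate_chainE => j /andP[ij jn].
  by rewrite zE ?vertex_nth //= index_uniq ?size_vertices ?uniq_vertices // ltnNge ij.
have Zscaled c w : scaled c z w -> coordinate_chain i (r w).
  move=> cw; apply/coordinate_chainE => j ij; have jn : (j < n)%N by case/andP: ij.
  by rewrite cw ?vertex_nth // (coordinate_chainE i z).1 // mulr0.
have zmin w : coordinate_chain i (r w) ->
    forall q b, vertex t q -> sval z q b = 0 -> sval w q b = 0.
  move=> /coordinate_chainE wE q b vq; rewrite zE //.
  case: ifP => [_ /eqP|]; first by rewrite oner_eq0.
  case: b => //=; rewrite ltnNge => /negbFE iq _.
  have := wE (index q (vertices t)); rewrite nth_index ?mem_vertices //; apply.
  by rewrite iq -size_vertices index_mem mem_vertices.
split; [|by exists (r z)|].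
- apply/(presents_open pr); apply: zariski_open_local => w nZw.
  have [j ij wj] : exists2 j, (i <= j < n)%N & sval w (nth [::] (vertices t) j) false != 0.
    apply: contrapT => h; apply: nZw; apply/coordinate_chainE => j ij.
    by apply/eqP/negPn/negP => wj; apply: h; exists j.
  have jn : (j < n)%N by case/andP: ij.
  exists (fun w => sval w (nth [::] (vertices t) j) false != 0); split=> //.
    by apply: zariski_open_neq0; apply: Polyfun_coord; eexists; eexists; split;
       first exact: vertex_nth jn.
  by move=> w' w'j /coordinate_chainE/(_ j ij) E; rewrite E eqxx in w'j.
- move=> A B cA cB AB; apply: contrapT => /not_orP[/existsNP[y1 h1] /existsNP[y2 h2]].
  move: h1 h2 => /not_implyP[Z1 nA] /not_implyP[Z2 nB].
  have [w1 w1E] := presents_surj pr y1; have [w2 w2E] := presents_surj pr y2.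
  rewrite -w1E in Z1 nA; rewrite -w2E in Z2 nB.
  have /(presents_open pr) oA : is_open (fun y => ~ A y) by [].
  have /(presents_open pr) oB : is_open (fun y => ~ B y) by [].
  have [c1 [v1 [c10 cv1 Av1]]] := orbit_closure (zmin _ Z1) oA nA.
  have [c2 [v2 [c20 cv2 Bv2]]] := orbit_closure (zmin _ Z2) oB nB.
  have [c [v [c0 cv Av Bv]]] := scaled_open_meet c10 c20 cv1 cv2 oA oB Av1 Bv2.
  by case: (AB _ (Zscaled _ _ cv)).
Qed.

Lemma presents_krull_dim : krull_dim Y n.
Proof.
split; last first.
  move=> k Z chainZ; have [_ [y Zy] _] := chainZ.1 0%N (leq0n k).
  have [z zy] := presents_surj pr y; rewrite -zy in Zy.
  have [d dz] := chart_exists z; exact: chain_length chainZ Zy dz.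
exists coordinate_chain; split=> [i _|i i_n]; first exact: coordinate_chain_irreducible.
split=> [y|].
  have [z <-] := presents_surj pr y; rewrite !coordinate_chainE => h j /andP[ij jn].
  by apply: h; rewrite ltnW.
have [z zE] := generic_point i.+1; exists (r z); split; rewrite coordinate_chainE.
  move=> j /andP[ij jn].
  by rewrite zE ?vertex_nth //= index_uniq ?size_vertices ?uniq_vertices // ltnNge ij.
move=> /(_ i); rewrite leqnn i_n zE ?vertex_nth //.
by rewrite /= index_uniq ?size_vertices ?uniq_vertices // ltnSn => /(_ isT)/eqP; rewrite oner_eq0.
Qed.

End Dimension.

Lemma presentable_krull_dim (K : numFieldType) t (Y : tspace K) :
  presentable t Y -> krull_dim Y (nb_vertices t).
Proof. by move=> [r]; exact: presents_krull_dim. Qed.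

(** * Wedderburn-Etherington numbers *)

Section Counting.
Implicit Types (t a b : bintree) (s : seq bintree).

HB.instance Definition _ := gen_eqMixin bintree.

Lemma tree_eqv_refl : reflexive tree_eqv.
Proof. by elim=> //= l -> r ->. Qed.

Lemma tree_eqv_sym : symmetric tree_eqv.
Proof.
elim=> [|l IHl r IHr] [|l' r'] //=.
by rewrite IHl IHr (IHl r') (IHr l') [X in _ || X]andbC.
Qed.

Lemma tree_eqv_trans : transitive tree_eqv.
Proof.
move=> b a; elim: a b => [|l IHl r IHr] [|l' r'] // [|l'' r''] //=.
case/orP => /andP[h1 h2] /orP[] /andP[h3 h4]; apply/orP.
- by left; rewrite (IHl _ _ h1 h3) (IHr _ _ h2 h4).
- by right; rewrite (IHl _ _ h1 h3) (IHr _ _ h2 h4).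
- by right; rewrite (IHl _ _ h1 h4) (IHr _ _ h2 h3).
- by left; rewrite (IHl _ _ h1 h4) (IHr _ _ h2 h3).
Qed.

Lemma tree_eqv_leaves t t' : tree_eqv t t' -> nb_leaves t = nb_leaves t'.
Proof.
rewrite /nb_leaves; elim: t t' => [|l IHl r IHr] [|l' r'] //=.
by case/orP => /andP[/IHl + /IHr]; lia.
Qed.

Lemma nb_leaves_node a b : nb_leaves (Node a b) = nb_leaves a + nb_leaves b.
Proof. by rewrite /nb_leaves /= addnS addSn. Qed.

(** Counting by leaves makes the sizes of the two subtrees add up to that of the tree, as in the
    recursion for the Wedderburn--Etherington numbers; n vertices mean n + 1 leaves. *)
Definition transversal (k : nat) s : Prop :=
  [/\ uniq s, forall t, t \in s -> nb_leaves t = k,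
      forall a b, a \in s -> b \in s -> tree_eqv a b -> a = b &
      forall t, nb_leaves t = k -> exists2 a, a \in s & tree_eqv a t].

Definition ordered_pairs s : seq bintree :=
  [seq Node (nth Empty s i) (nth Empty s j) | i <- iota 0 (size s), j <- iota i (size s - i)].

Lemma size_ordered_pairs s : size (ordered_pairs s) = (size s * (size s).+1) %/ 2.
Proof.
rewrite size_allpairs_dep; under eq_map => i do rewrite size_iota.
suff -> : sumn [seq size s - i | i <- iota 0 (size s)] = \sum_(i < size s) i.+1.
  elim: (size s) => [|m IH]; first by rewrite big_ord0.
  by rewrite big_ord_recr /= IH; lia.
have -> : iota 0 (size s) = index_iota 0 (size s) by rewrite /index_iota subn0.
rewrite sumnE big_map big_mkord.
by rewrite (reindex_inj rev_ord_inj); apply: eq_bigr => i _ /=; have := ltn_ord i; lia.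
Qed.

Lemma ordered_pairsP s x : uniq s ->
  reflect (exists a b, [/\ a \in s, b \in s, index a s <= index b s & x = Node a b])
          (x \in ordered_pairs s).
Proof.
move=> us; apply: (iffP idP) => [/allpairsPdep|].
  move=> [i [j [+ + ->]]]; rewrite !mem_iota /= add0n => is_ /andP[ij js].
  have js' : j < size s by lia.
  exists (nth Empty s i), (nth Empty s j); split; rewrite ?mem_nth //.
  by rewrite !index_uniq.
move=> [a [b [as_ bs ab ->]]]; apply/allpairsPdep.
exists (index a s), (index b s).
rewrite !nth_index // !mem_iota; split=> //; first by rewrite index_mem.
by rewrite ab subnKC ?index_mem // ltnW // index_mem.
Qed.

Lemma uniq_ordered_pairs s : uniq s -> uniq (ordered_pairs s).
Proof.
move=> us; apply: (@allpairs_uniq_dep _ (fun=> nat)); first exact: iota_uniq.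
  by move=> i _; apply: iota_uniq.
move=> p q /allpairsPdep[i [j [+ + ->]]] /allpairsPdep[i' [j' [+ + ->]]] /=.
rewrite !mem_iota /= !add0n => is_ /andP[ij js] is' /andP[ij' js'] [/eqP + /eqP].
rewrite (subnKC (ltnW is_)) in js; rewrite (subnKC (ltnW is')) in js'.
by rewrite !nth_uniq // => /eqP -> /eqP ->.
Qed.

Definition tree_block (R : nat -> seq bintree) k i : seq bintree :=
  [seq Node a b | a <- R i, b <- R (k - i)].

(** Every unordered pair of subtrees is represented once: the one with fewer leaves comes first,
    [i < uphalf k] meaning i < k - i, and between two subtrees with k/2 leaves the position in the
    list decides. *)
Definition next_transversal (R : nat -> seq bintree) k : seq bintree :=
  (if odd k then [::] else ordered_pairs (R k./2)) ++
  [seq x | i <- index_iota 1 (uphalf k), x <- tree_block R k i].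

Section Step.
Variables (R : nat -> seq bintree) (k : nat).
Hypotheses (k1 : 1 < k) (RP : forall i, 0 < i < k -> transversal i (R i)).

Let half_bounds : ~~ odd k -> 0 < k./2 < k.
Proof. by move: k1; lia. Qed.

Lemma next_transversalP x : reflect
  (exists a b, [/\ x = Node a b, nb_leaves a + nb_leaves b = k, a \in R (nb_leaves a),
     b \in R (nb_leaves b) & (nb_leaves a < nb_leaves b) ||
       ((nb_leaves a == nb_leaves b) && (index a (R (nb_leaves a)) <= index b (R (nb_leaves b))))])
  (x \in next_transversal R k).
Proof.
apply: (iffP idP).
  rewrite mem_cat => /orP[].
    case: ifP => // /negbT ek; have [uR lR _ _] := RP (half_bounds ek).
    case/ordered_pairsP => // a [b [aR bR ab ->]]; exists a, b.
    by rewrite (lR _ aR) (lR _ bR) aR bR ab eqxx orbT; split=> //; lia.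
  move=> /allpairsPdep[i [y [+ /allpairsP[[a b] /= [aR bR ->]] ->]]].
  rewrite mem_index_iota => ik; have ik1 : 0 < i < k by lia.
  have ik2 : 0 < k - i < k by lia.
  have [_ lR _ _] := RP ik1; have [_ lR' _ _] := RP ik2.
  by exists a, b; rewrite (lR _ aR) (lR' _ bR); split=> //; lia.
move=> [a [b [-> abk aR bR ab]]]; rewrite mem_cat; case/orP: ab => [ab|/andP[/eqP ab iab]].
  apply/orP; right; apply/allpairsPdep; exists (nb_leaves a), (Node a b); split=> //.
    by rewrite mem_index_iota; move: abk ab; rewrite /nb_leaves; lia.
  by apply/allpairsP; exists (a, b); split=> //=; rewrite (_ : k - _ = nb_leaves b) //; lia.
apply/orP; left; have ek : ~~ odd k by lia.
rewrite (negPf ek); have [uR _ _ _] := RP (half_bounds ek).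
have ak : nb_leaves a = k./2 by lia.
apply/ordered_pairsP => //; exists a, b.
by move: aR bR iab; rewrite -ab ak; split.
Qed.

Lemma uniq_next_transversal : uniq (next_transversal R k).
Proof.
rewrite cat_uniq; apply/and3P; split.
- case: ifP => // /negbT ek; have [uR _ _ _] := RP (half_bounds ek).
  exact: uniq_ordered_pairs.
- apply/hasPn => x /allpairsPdep[i [y [+ /allpairsP[[a b] /= [aR bR ->]] ->]]].
  rewrite mem_index_iota => ik; case: ifP => // /negbT ek.
  have [uR lR _ _] := RP (half_bounds ek); apply/negP => /ordered_pairsP[] // a' [b' [a'R _ _ [E _]]].
  have ik1 : 0 < i < k by lia.
  have [_ lR' _ _] := RP ik1; have := lR' _ aR; rewrite E (lR _ a'R).
  by move: ik ek; lia.
- apply: (@allpairs_uniq_dep _ (fun=> bintree)); first exact: iota_uniq.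
    move=> i; rewrite mem_index_iota => ik.
    have ik1 : 0 < i < k by lia.
    have ik2 : 0 < k - i < k by lia.
    have [uR _ _ _] := RP ik1; have [uR' _ _ _] := RP ik2.
    by apply: allpairs_uniq => // -[a b] [a' b'] _ _ [-> ->].
  move=> p q /allpairsPdep[i [x [+ /allpairsP[[a b] /= [aR bR ->]] ->]]].
  move=> + /allpairsPdep[i' [x' [+ /allpairsP[[a' b'] /= [aR' bR' ->]] ->]]].
  rewrite !mem_index_iota => ik ik' /= [E1 E2].
  have ik1 : 0 < i < k by lia.
  have ik2 : 0 < i' < k by lia.
  have [_ lR _ _] := RP ik1; have [_ lR' _ _] := RP ik2.
  have ii' : i = i' by rewrite -(lR _ aR) -(lR' _ aR') E1.
  by rewrite E1 E2 ii'.
Qed.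

Lemma size_next_transversal : size (next_transversal R k) = we_step (fun i => size (R i)) k.
Proof.
rewrite size_cat /we_step; congr (_ + _).
  by case: ifP => // _; rewrite size_ordered_pairs.
rewrite size_allpairs_dep sumnE big_map; apply: eq_bigr => i _.
by rewrite size_allpairs.
Qed.

Lemma transversal_next : transversal k (next_transversal R k).
Proof.
split; first exact: uniq_next_transversal.
- by move=> t /next_transversalP[a [b [-> <- _ _ _]]]; rewrite nb_leaves_node.
- move=> x y /next_transversalP[a [b [-> abk aR bR ab]]].
  move=> /next_transversalP[a' [b' [-> abk' aR' bR' ab']]].
  have la c : 0 < nb_leaves c by [].
  have bnd c c' : nb_leaves c + nb_leaves c' = k -> 0 < nb_leaves c < k.
    by move: (la c) (la c'); lia.
  have inj c c' : 0 < nb_leaves c < k -> c \in R (nb_leaves c) -> c' \in R (nb_leaves c') ->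
      tree_eqv c c' -> c = c'.
    move=> ck cR + cc'; rewrite -(tree_eqv_leaves cc') => cR'.
    by have [_ _ h _] := RP ck; apply: h.
  have bb : 0 < nb_leaves b < k by apply: (bnd b a); rewrite addnC.
  rewrite /= => /orP[] /andP[e1 e2].
    by rewrite (inj _ _ (bnd _ _ abk) aR aR' e1) (inj _ _ bb bR bR' e2).
  (* Here the subtrees are exchanged; both orderings then force equal sizes and equal positions, so
     the two subtrees coincide. *)
  have E1 := inj _ _ (bnd _ _ abk) aR bR' e1.
  have E2 := inj _ _ bb bR aR' e2.
  have lab : nb_leaves a = nb_leaves b.
    by move: ab ab'; rewrite -E1 -E2; case: ltngtP.
  suff ab0 : a = b by rewrite -E1 -E2 ab0.
  move: aR ab ab'; rewrite -E2 -E1 lab ltnn eqxx /= => aR h1 h2.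
  have E : index a (R (nb_leaves b)) = index b (R (nb_leaves b)).
    by apply/eqP; rewrite eqn_leq h1 h2.
  by rewrite -(nth_index Empty aR) E nth_index.
- case=> [|a b]; first by rewrite /nb_leaves /= => E; move: k1; rewrite -E.
  rewrite nb_leaves_node => abk.
  have la c : 0 < nb_leaves c by [].
  have ak : 0 < nb_leaves a < k by move: (la a) (la b); lia.
  have bk : 0 < nb_leaves b < k by move: (la a) (la b); lia.
  have [_ lR _ /(_ a erefl)[a0 a0R aa0]] := RP ak.
  have [_ lR' _ /(_ b erefl)[b0 b0R bb0]] := RP bk.
  have la0 := lR _ a0R; have lb0 := lR' _ b0R.
  have [h|h] := boolP ((nb_leaves a0 < nb_leaves b0) ||
     ((nb_leaves a0 == nb_leaves b0) && (index a0 (R (nb_leaves a0)) <= index b0 (R (nb_leaves b0))))).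
    exists (Node a0 b0); last by rewrite /= aa0 bb0.
    by apply/next_transversalP; exists a0, b0; rewrite la0 lb0 in h *.
  exists (Node b0 a0); last by rewrite /= aa0 bb0 orbT.
  apply/next_transversalP; exists b0, a0; rewrite la0 lb0 in h *; split=> //; first by rewrite addnC.
  move: h; lia.
Qed.

End Step.

Lemma transversal_exists k : 0 < k ->
  exists2 s, transversal k s & size s = wedderburn_etherington k.
Proof.
elim/ltn_ind: k => -[//|[_ _|k IH _]].
  exists [:: Empty]; split=> //.
  - by move=> t; rewrite inE => /eqP ->.
  - by move=> a b; rewrite inE => /eqP ->; rewrite inE => /eqP ->.
  - case=> [_|l r]; first by exists Empty; rewrite ?inE.
    by rewrite /nb_leaves /= => -[].
have [R RE] : exists R : nat -> seq bintree, forall i, 0 < i < k.+2 ->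
    transversal i (R i) /\ size (R i) = wedderburn_etherington i.
  have [|R RE] := @choice _ _ (fun i s => 0 < i < k.+2 ->
    transversal i s /\ size s = wedderburn_etherington i); last by exists R.
  move=> i; case: (boolP (0 < i < k.+2)) => [/andP[i0 ik]|_]; last by exists [::].
  by have [s sP sE] := IH i ik i0; exists s.
have RP i ik := (RE i ik).1.
exists (next_transversal R k.+2); first exact: transversal_next.
rewrite size_next_transversal // wedderburn_etheringtonE // /we_step.
congr (_ + _).
  case: ifP => // ek; rewrite (RE _ _).2 //=; lia.
rewrite big_nat_cond [RHS]big_nat_cond; apply: eq_bigr => i; rewrite andbT => ik.
by rewrite !(RE _ _).2 //; lia.
Qed.

Lemma unordered_class_eq t t' : unordered_class t = unordered_class t' <-> tree_eqv t t'.
Proof.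
split=> [E|tt'].
  have : unordered_class t' t' by apply/unordered_isoP; exact: tree_eqv_refl.
  by rewrite -E => /unordered_isoP.
apply/seteqP; split=> a /unordered_isoP ta; apply/unordered_isoP.
  by apply: tree_eqv_trans ta; rewrite tree_eqv_sym.
exact: tree_eqv_trans tt' ta.
Qed.

Lemma card_unordered_bintrees n :
  (unordered_bintrees n #= `I_(wedderburn_etherington n.+1))%card.
Proof.
have [s [us ls is_ fs] <-] := @transversal_exists n.+1 isT.
rewrite card_eq_sym; apply/card_set_bijP.
exists (fun i => unordered_class (nth Empty s i)); split.
- move=> i /= is1; exists (nth Empty s i) => //.
  by have := ls _ (mem_nth Empty is1) => -[].
- move=> i j; rewrite !inE /= => i_s js /unordered_class_eq E.
  by apply/eqP; rewrite -(nth_uniq Empty i_s js us); apply/eqP; apply: is_ => //; exact: mem_nth.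
- move=> U [t tn ->]; have [|a as_ ta] := fs t; first by rewrite /nb_leaves tn.
  exists (index a s); first by rewrite /= index_mem.
  by rewrite nth_index //; apply/unordered_class_eq.
Qed.

End Counting.

(** * The fan of a tree *)

Section FinalPresentation.
Variables (K : fieldType) (t : bintree) (I : Type) (X : I -> space K) (P : Type).
Variables (pi : forall i, X i -> P) (r : cox K t -> P).
Arguments pi : clear implicits.
Hypothesis section : forall i, exists2 sigma : X i -> cox K t,
  morphism_of_spaces sigma & forall x, r (sigma x) = pi i x.
Hypothesis lift : forall z : cox K t, exists (U : cox K t -> Prop) i (g : cox K t -> X i),
  [/\ is_open U, U z,
      forall V : X i -> Prop, is_open V -> is_open (fun w => U w /\ V (g w)),
      forall (V : X i -> Prop) h, is_open V -> regular V h ->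
        regular (fun w => U w /\ V (g w)) (fun w => h (g w)) &
      forall w, U w -> pi i (g w) = r w].

(** Sections of the charts transport openness from the Cox space to the charts, and local
    factorisations of [r] through a chart transport it back. *)
Lemma final_open (A : final_space pi -> Prop) : is_open A <-> is_open (fun z => A (r z)).
Proof.
split=> oA; last first.
  move=> i; have [sigma sm sE] := section i.
  have -> : (fun p => A (pi i p)) = (fun p => A (r (sigma p))).
    by apply/funext => p; rewrite sE.
  exact: (sm _ oA).1.
apply: zariski_open_local => z Az; have [U [i [g [oU Uz gV _ gE]]]] := lift z.
exists (fun w => U w /\ A (pi i (g w))); split.
- exact: gV (oA i).
- by rewrite gE.
- by move=> w [Uw]; rewrite gE.
Qed.

Lemma final_regular (U : final_space pi -> Prop) f : is_open U ->
  regular U f <-> regular (fun z => U (r z)) (fun z => f (r z)).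
Proof.
move=> oU; split=> rf; last first.
  move=> i; have [sigma sm sE] := section i.
  have E (T : Type) (h : P -> T) : (fun p => h (pi i p)) = (fun p => h (r (sigma p))).
    by apply/funext => p; rewrite sE.
  rewrite !E; apply: (sm _ _).2 (fun z => f (r z)) rf.
  by move/final_open: oU.
apply: regular_local => z Uz; have [W [i [g [oW Wz gV gr gE]]]] := lift z.
exists W; split=> //.
apply: (@regular_eq _ _ _ _ (fun w => f (pi i (g w)))) => [w [_ Ww]|]; first by rewrite gE.
apply: regularS (gr _ _ (oU i) (rf i)) => w [Uw Ww]; split=> //.
by rewrite gE.
Qed.

End FinalPresentation.

(** * Characters of the torus in Cox coordinates *)

Section TreeProducts.
Local Open Scope ring_scope.
Variables (K : comNzRingType) (t : bintree).
Implicit Types (g h : seq bool -> K) (q p : seq bool).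

Fixpoint tree_prod_from g T q : K :=
  if T is Node l r then
    g q * (tree_prod_from g l (rcons q false) * tree_prod_from g r (rcons q true))
  else 1.

Definition tree_prod g q := tree_prod_from g (subtree t q) q.

Lemma tree_prod_vertex g q : vertex t q ->
  tree_prod g q = g q * (tree_prod g (rcons q false) * tree_prod g (rcons q true)).
Proof. by rewrite /tree_prod vertexE !subtree_rcons; case: subtree. Qed.

Lemma tree_prod_leaf g q : ~~ vertex t q -> tree_prod g q = 1.
Proof. by rewrite /tree_prod vertexE; case: subtree. Qed.

Lemma eq_tree_prod g h q :
  (forall p, vertex t p -> prefix q p -> g p = h p) -> tree_prod g q = tree_prod h q.
Proof.
elim/(@path_ind t): q => q vq; first by rewrite !tree_prod_leaf.
move=> IH gh; rewrite !(tree_prod_vertex _ vq) gh ?prefix_refl //.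
by rewrite !IH // => p vp qp; apply: gh => //; apply: prefix_trans qp; apply: prefix_rcons.
Qed.

Lemma tree_prodM g h q : tree_prod (fun p => g p * h p) q = tree_prod g q * tree_prod h q.
Proof.
elim/(@path_ind t): q => q vq; first by rewrite !tree_prod_leaf // mulr1.
move=> IH; rewrite !(tree_prod_vertex _ vq) !IH.
ring.
Qed.

Lemma tree_prod1 g q : (forall p, vertex t p -> prefix q p -> g p = 1) -> tree_prod g q = 1.
Proof.
move=> g1; rewrite (@eq_tree_prod _ (fun=> 1)) //.
elim/(@path_ind t): q {g1} => q vq; first by rewrite tree_prod_leaf.
by move=> IH; rewrite tree_prod_vertex // !IH !mulr1.
Qed.

End TreeProducts.

Section Exponents.
Local Open Scope ring_scope.
Variables (t : bintree) (n : nat).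
Hypothesis nt : nb_vertices t = n.
Implicit Types (m : 'rV[int]_n.+1) (q p : seq bool) (d : seq bool -> bool).

Definition unit_row (j : nat) : 'rV[int]_n.+1 := \row_k ((k : nat) == j)%:R.

(* The pairing of m with the ray of the slot that ends at q. *)
Definition weight m q : int := - \sum_(k < n.+1 | below t k q) m 0 k.

Definition ray q b : 'rV[int]_n.+1 := \row_(k < n.+1) - (below t k (rcons q b))%:R.

Lemma weightD m m' q : weight (m + m') q = weight m q + weight m' q.
Proof. by rewrite /weight -opprD -big_split; congr (- _); apply: eq_bigr => k _; rewrite mxE. Qed.

Lemma weightN m q : weight (- m) q = - weight m q.
Proof. by rewrite /weight (eq_bigr (fun k => - m 0 k)) ?sumrN // => k _; rewrite mxE. Qed.

Lemma weight_ray m q b : weight m (rcons q b) = \sum_k m 0 k * ray q b 0 k.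
Proof.
rewrite /weight -sumrN big_mkcond; apply: eq_bigr => k _; rewrite mxE.
by case: below; rewrite ?mulrN1 // oppr0 mulr0.
Qed.

Lemma weight_vertex m q : vertex t q ->
  weight m q = weight m (rcons q false) + weight m (rcons q true).
Proof.
move=> vq; rewrite /weight -opprD; congr (- _); rewrite (bigID (fun k : 'I_n.+1 => toward t k q)) /= addrC.
by congr (_ + _); apply: eq_bigl => k; rewrite below_child // eq_sym; case: toward; rewrite ?andbT ?andbF.
Qed.

Lemma weight_root m : dualM m -> weight m [::] = 0.
Proof.
move=> mM; rewrite /weight (eq_bigl xpredT) ?mM ?oppr0 // => k.
by rewrite below_root /nb_leaves nt ltn_ord.
Qed.

Lemma weight_unit j q : (j < n.+1)%N -> weight (unit_row j) q = - (below t j q)%:R.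
Proof.
move=> jn; rewrite /weight; congr (- _); rewrite big_mkcond (bigD1 (Ordinal jn)) //= mxE eqxx.
rewrite big1 ?addr0 => [|k kj]; first by case: below.
by move: kj; rewrite mxE -val_eqE /= => /negPf ->; case: below.
Qed.

Fixpoint walk_leaf_from d T q : nat :=
  if T is Node l r then walk_leaf_from d (if d q then r else l) (rcons q (d q)) else lo t q.

(* The number of the leaf reached from q by choosing the child d p at each
   vertex p. *)
Definition target d q := walk_leaf_from d (subtree t q) q.

Lemma target_vertex d q : vertex t q -> target d q = target d (rcons q (d q)).
Proof. by rewrite /target vertexE subtree_rcons; case: subtree. Qed.

Lemma target_leaf d q : ~~ vertex t q -> target d q = lo t q.
Proof. by rewrite /target vertexE; case: subtree. Qed.

Lemma below_target d q : below t (target d q) q.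
Proof.
elim/(@path_ind t): q => q vq.
  by rewrite target_leaf // /below hi_leaf // leqnn ltnSn.
by move=> IH; have := IH (d q); rewrite -target_vertex // below_child // => /andP[].
Qed.

Lemma toward_target d q : vertex t q -> toward t (target d q) q = d q.
Proof.
move=> vq; have := below_target d (rcons q (d q)).
by rewrite -target_vertex // below_child // => /andP[_ /eqP ->].
Qed.

Lemma below_prefix j q p : vertex t p -> prefix q p -> below t j p -> below t j q.
Proof.
move=> vp /prefixP[x px]; rewrite {p}px in vp *; elim/last_ind: x vp => [_|x b IH]; first by rewrite cats0.
rewrite -rcons_cat => vqxb; have vqx := vertex_rcons vqxb.
by rewrite below_child // => /andP[+ _]; apply: IH.
Qed.

Lemma target_bound d q : vertex t q -> (target d q < n.+1)%N.
Proof.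
move=> vq; have /andP[_ h] := below_target d q; apply: leq_trans h _.
by rewrite (leq_trans (hi_le vq)) // /nb_leaves nt.
Qed.

End Exponents.

Section LeafUnits.
Local Open Scope ring_scope.
Variables (t : bintree) (n : nat).
Hypothesis nt : nb_vertices t = n.
Implicit Types (m : 'rV[int]_n.+1) (q p : seq bool) (d : seq bool -> bool).

Lemma eq_target d d' q :
  (forall p, vertex t p -> prefix q p -> d p = d' p) -> target t d q = target t d' q.
Proof.
elim/(@path_ind t): q => q vq; first by rewrite !target_leaf.
move=> IH dd'; rewrite (target_vertex d vq) (target_vertex d' vq) dd' ?prefix_refl //.
apply: IH => p vp qp.
by apply: dd' => //; apply: prefix_trans qp; apply: prefix_rcons.
Qed.

Lemma target_on_path d q p : vertex t p -> prefix q p -> below t (target t d q) p ->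
  target t d q = target t d p.
Proof.
move=> vp /prefixP[x px]; rewrite {p}px in vp *.
elim/last_ind: x vp => [|x b IH]; first by rewrite cats0.
rewrite -rcons_cat => vqxb; have vqx := vertex_rcons vqxb.
rewrite below_child // => /andP[bx /eqP ->].
by rewrite IH // toward_target // -target_vertex.
Qed.

Lemma below_nested j q p : vertex t q -> vertex t p -> below t j q -> below t j p ->
  (size q <= size p)%N -> prefix q p.
Proof.
elim/last_ind: p q => [|p b IH] q vq vp bq bp.
  by rewrite leqn0 => /nilP ->.
have vp' := vertex_rcons vp; move: bp; rewrite below_child // => /andP[bp /eqP ->].
rewrite size_rcons leq_eqVlt => /predU1P[sq|]; last first.
  by rewrite ltnS => /(IH q vq vp' bq bp) /prefix_trans; apply; exact: prefix_rcons.
case/lastP: q vq bq sq => [//|q c] vq bq; rewrite size_rcons => -[sq].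
have vq' := vertex_rcons vq; move: bq; rewrite below_child // => /andP[bq /eqP ->].
have /prefixP[x px] : prefix q p by apply: IH => //; rewrite sq.
have x0 : x = [::].
  by apply/nilP; move: sq; rewrite px size_cat /nilp => /esym/eqP; rewrite -{2}[size q]addn0 eqn_add2l.
by rewrite px x0 cats0 prefix_refl.
Qed.

Local Notation unit_diff i j := (unit_row n i - unit_row n j).

Lemma weight_unit_diff i j q : (i < n.+1)%N -> (j < n.+1)%N ->
  weight t (unit_diff i j) q = (below t j q)%:R - (below t i q)%:R.
Proof. by move=> ni nj; rewrite weightD weightN !weight_unit // opprK addrC. Qed.

Lemma below_bound j q : vertex t q -> below t j q -> (j < n.+1)%N.
Proof.
by move=> vq /andP[_ h]; apply: leq_trans h _; rewrite (leq_trans (hi_le vq)) // /nb_leaves nt.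
Qed.

Lemma dualM_unit_diff i j : (i < n.+1)%N -> (j < n.+1)%N -> dualM (unit_diff i j).
Proof.
move=> ni nj; rewrite /dualM (eq_bigr (fun k => unit_row n i 0 k - unit_row n j 0 k)).
  rewrite sumrB (bigD1 (Ordinal ni)) //= (bigD1 (Ordinal nj) (F := fun k => unit_row n j 0 k)) //=.
  rewrite !mxE !eqxx !big1 ?subrr //; move=> k; rewrite mxE -val_eqE /= => /negPf -> //.
by move=> k _; rewrite !mxE.
Qed.

(** From [q] on, the path to the target always follows [d], so the target lies below
    [rcons p (~~ d p)] only if [p] is strictly above [q]. Then all leaves below [q] lie there, [j]
    included. *)
Lemma weight_target_ge0 d q p j : vertex t q -> vertex t p -> below t j q ->
  0 <= weight t (unit_diff (target t d q) j) (rcons p (~~ d p)).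
Proof.
move=> vq vp jq; rewrite weight_unit_diff ?target_bound ?(below_bound vq) //.
case bi: (below t (target t d q) _); last by rewrite subr0 ler0n.
suff -> : below t j (rcons p (~~ d p)) by rewrite subrr.
move: bi; rewrite below_child // => /andP[bip]; set i := target t d q in bip *.
have biq : below t i q by exact: below_target.
case: (leqP (size q) (size p)) => [qp|pq].
  have pre := below_nested vq vp biq bip qp.
  by rewrite /i (target_on_path vp pre bip) toward_target //; case: (d p).
have /prefixP[x qE] := below_nested vp vq bip biq (ltnW pq).
case: x qE => [|c x] qE; first by rewrite qE cats0 ltnn in pq.
have vpc e : below t e q -> below t e (rcons p c).
  by apply: below_prefix => //; rewrite qE -cat_rcons prefix_prefix.
have := vpc _ biq; rewrite below_child // => /andP[_ /eqP cE] /eqP tE.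
by rewrite tE -cE vpc.
Qed.

End LeafUnits.

Section Monomials.
Local Open Scope ring_scope.
Variables (K : fieldType) (t : bintree) (n : nat).
Hypothesis nt : nb_vertices t = n.
Implicit Types (m : 'rV[int]_n.+1) (q p : seq bool) (d : seq bool -> bool)
  (z c : seq bool -> bool -> K).

Definition slot_power z m q : K :=
  z q false ^ weight t m (rcons q false) * z q true ^ weight t m (rcons q true).

(** The character of [m]: every Cox coordinate is raised to the pairing of [m] with its ray. *)
Definition mono z m : K := tree_prod t (slot_power z m) [::].

(** Negative powers of 0 are 0, which destroys additivity in the exponent; this condition restores
    it, and it holds on the chart of a cone for [m] in the dual semigroup. *)
Definition admissible z m : Prop :=
  forall q b, vertex t q -> z q b = 0 -> 0 <= weight t m (rcons q b).

Lemma exprzD_admissible (x : K) (a b : int) :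
  (x = 0 -> 0 <= a) -> (x = 0 -> 0 <= b) -> x ^ (a + b) = x ^ a * x ^ b.
Proof.
have [x0 /(_ x0) a0 /(_ x0) b0|x0 _ _] := eqVneq x 0; last by rewrite expfzDr.
by rewrite exprzD_ss // a0 b0.
Qed.

Lemma monoD z m m' : admissible z m -> admissible z m' ->
  mono z (m + m') = mono z m * mono z m'.
Proof.
move=> am am'; rewrite /mono -tree_prodM; apply: eq_tree_prod => p vp _.
rewrite /slot_power !weightD !exprzD_admissible 1?mulrACA //.
- by move/am; apply.
- by move/am'; apply.
- by move/am; apply.
- by move/am'; apply.
Qed.

Lemma weight0 q : weight t (0 : 'rV[int]_n.+1) q = 0.
Proof. by rewrite /weight big1 ?oppr0 // => k _; rewrite mxE. Qed.

Lemma mono0 z : mono z 0 = 1.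
Proof. by apply: tree_prod1 => p _ _; rewrite /slot_power !weight0 !expr0z mulr1. Qed.

Lemma monoM c z m : mono (fun q b => c q b * z q b) m = mono c m * mono z m.
Proof.
rewrite /mono -tree_prodM; apply: eq_tree_prod => p _ _.
by rewrite /slot_power !expfzMl mulrACA.
Qed.

Lemma mono_equiv z z' m : dualM m -> cox_equiv t z z' -> mono z' m = mono z m.
Proof.
move=> mM [lam [l0 l1 lE]].
rewrite /mono (@eq_tree_prod _ _ _ (fun q => slot_power (fun q b => lam q / lam (rcons q b)) m q *
  slot_power z m q)); last first.
  move=> q vq _; rewrite /slot_power mulrACA -!expfzMl.
  by congr (_ ^ _ * _ ^ _); rewrite mulrAC -lE // mulfK.
rewrite tree_prodM -[RHS]mul1r; congr (_ * _).
(* The factors below [q] telescope to a power of [lam q] with the weight of [m] at [q] as exponent,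
   and the weight at the root is 0. *)
suff main q : tree_prod t (slot_power (fun q b => lam q / lam (rcons q b)) m) q =
    lam q ^ weight t m q by rewrite main weight_root.
elim/(@path_ind t): q => q vq; first by rewrite tree_prod_leaf // l1 // exp1rz.
move=> IH; rewrite tree_prod_vertex // !IH /slot_power mulrACA -!expfzMl !divfK //.
by rewrite -expfzDr // -weight_vertex.
Qed.

Lemma tree_prod_root i j z q : vertex t q -> below t i q -> below t j q ->
  tree_prod t (slot_power z (unit_row n i - unit_row n j)) [::] =
  tree_prod t (slot_power z (unit_row n i - unit_row n j)) q.
Proof.
elim/last_ind: q => // q b IH vq; have vq' := vertex_rcons vq.
rewrite !below_child // => /andP[bi /eqP ib] /andP[bj /eqP jb].
rewrite IH // tree_prod_vertex //.
set m := unit_row n i - unit_row n j.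
have w p : weight t m p = (below t j p)%:R - (below t i p)%:R.
  by rewrite weight_unit_diff // (below_bound nt vq').
have -> : slot_power z m q = 1.
  by rewrite /slot_power !w !below_child // bi bj -ib -jb !subrr !expr0z mulr1.
rewrite mul1r; have sib : tree_prod t (slot_power z m) (rcons q (~~ b)) = 1.
  apply: tree_prod1 => p vp qp.
  have out k e : below t k q -> b = toward t k q -> below t k (rcons p e) = false.
    move=> bk kb; rewrite below_child //; case bkp: (below t k p) => //=.
    by have := below_prefix vp qp bkp; rewrite below_child // bk -kb; case: (b).
  by rewrite /slot_power !w !out // !subrr !expr0z mulr1.
by case: b sib {IH vq ib jb} => /= ->; rewrite ?mul1r ?mulr1.
Qed.

Lemma walk_toward_target z d q : walk t z (toward t (target t d q)) q = walk t z d q.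
Proof.
elim/(@path_ind t): q => q vq; first by rewrite !walk_leaf.
move=> IH; rewrite !(walk_vertex _ _ vq) toward_target // -IH.
by rewrite -target_vertex.
Qed.

Lemma tree_prod_leaf_path z j q :
  tree_prod t (fun p => z p false ^+ below t j (rcons p false) *
                        z p true ^+ below t j (rcons p true)) q =
  if below t j q then walk t z (toward t j) q else 1.
Proof.
elim/(@path_ind t): q => q vq; first by rewrite tree_prod_leaf // walk_leaf // if_same.
move=> IH; rewrite tree_prod_vertex // !IH !below_child // (walk_vertex _ _ vq).
case: (below t j q) => /=; last by rewrite !expr0 !mulr1.
by case: (toward t j q) => /=; rewrite ?expr0 ?expr1 ?mul1r ?mulr1.
Qed.

(** Slots above [j] have exponent 1, slots above the target have exponent -1, and those that lead to
    [q] cancel. In this way the coordinates of an affine chart become characters. *)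
Lemma mono_unit_diff z d j q : vertex t q -> below t j q ->
  (forall p, vertex t p -> prefix q p -> z p (d p) != 0) ->
  mono z (unit_row n (target t d q) - unit_row n j) =
  walk t z (toward t j) q / walk t z d q.
Proof.
move=> vq jq zd; set i := target t d q.
have iq : below t i q by exact: below_target.
have [ni nj] := (below_bound nt vq iq, below_bound nt vq jq).
have w0 : walk t z d q != 0.
  elim/(@path_ind t): q vq {jq i iq ni nj} zd => q vq; first by rewrite (negPf vq).
  move=> IH _ zd; rewrite walk_vertex // mulf_neq0 ?zd ?prefix_refl //.
  case vqd: (vertex t (rcons q (d q))); last by rewrite walk_leaf ?vqd ?oner_neq0.
  apply: IH => // p vp qp; apply: zd => //.
  by apply: prefix_trans qp; apply: prefix_rcons.
apply: (mulIf w0); rewrite divfK // /mono (tree_prod_root z vq iq jq).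
rewrite -(walk_toward_target z d q) -/i.
have := tree_prod_leaf_path z i q; have := tree_prod_leaf_path z j q.
rewrite iq jq => <- <-; rewrite -tree_prodM; apply: eq_tree_prod => p vp qp.
have e1 e : z p e ^ weight t (unit_row n i - unit_row n j) (rcons p e) *
    z p e ^+ below t i (rcons p e) = z p e ^+ below t j (rcons p e).
  rewrite weight_unit_diff //; case bi: (below t i (rcons p e)); last first.
    by case: below; rewrite subr0 expr0 mulr1 ?expr1z ?expr0z.
  have ze : z p e != 0.
    move: bi; rewrite below_child // => /andP[bip /eqP ->].
    by rewrite /i (target_on_path vp qp bip) toward_target // zd.
  by case: below; rewrite ?subrr ?sub0r ?expr0z ?mul1r // expr1 expr0 -exprz_inv expr1z mulVf.
by rewrite /slot_power mulrACA !e1.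
Qed.

End Monomials.

Lemma cox_equiv_trans (K : fieldType) t (x y z : seq bool -> bool -> K) :
  cox_equiv t x y -> cox_equiv t y z -> cox_equiv t x z.
Proof.
move=> [l [l0 l1 lE]] [l' [l0' l1' lE']].
exists (fun q => (l q * l' q)%R); split=> [q|q vq|q b vq].
- by rewrite GRing.mulf_neq0.
- by rewrite l1 // l1' // GRing.mulr1.
- by rewrite [(l _ * _)%R]GRing.mulrC GRing.mulrA lE' // -GRing.mulrA lE // GRing.mulrA [(l' q * _)%R]GRing.mulrC.
Qed.

Section RayInjectivity.
Variable t : bintree.

Lemma below_sub_child q b p : vertex t q -> vertex t p ->
  (size q <= size p) -> (forall j, below t j (rcons p b) -> below t j q) -> prefix q p.
Proof.
move=> vq vp qp sub; set j := lo t (rcons p b).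
have jb : below t j (rcons p b) by rewrite /below leqnn lo_lt_hi.
by apply: (below_nested vq vp (sub _ jb)) => //; move: jb; rewrite below_child // => /andP[].
Qed.

(** If one vertex lay strictly above the other, its slot would contain the leaves of both slots of
    the lower vertex. *)
Lemma below_set_inj q b p c : vertex t q -> vertex t p ->
  (forall j, below t j (rcons q b) = below t j (rcons p c)) -> (q, b) = (p, c).
Proof.
wlog qp : q b p c / size q <= size p.
  move=> h vq vp E; case: (leqP (size q) (size p)) => [/h|/ltnW /h h']; first exact.
  by rewrite (h' c b).
move=> vq vp E.
have /prefixP[x px] : prefix q p.
  by apply: (below_sub_child (b := c)) => // j; rewrite -E below_child // => /andP[].
have lb y : below t (lo t y) y by rewrite /below leqnn lo_lt_hi.
case: x px => [|e x] px.
  rewrite cats0 in px; subst p; congr (_, _).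
  have := lb (rcons q b); rewrite E below_child // => /andP[_ /eqP ->].
  by have := lb (rcons q b); rewrite below_child // => /andP[_ /eqP].
have pre : prefix (rcons q e) p by rewrite px -cat_rcons prefix_prefix.
have eb : e = b.
  have h : below t (lo t (rcons p c)) (rcons q e).
    apply: (below_prefix vp pre); have := lb (rcons p c).
    by rewrite below_child // => /andP[].
  move: h; rewrite below_child // => /andP[_ /eqP ->].
  by have := lb (rcons p c); rewrite -E below_child // => /andP[_ /eqP ->].
have h : below t (lo t (rcons p (~~ c))) (rcons q b).
  rewrite -eb; apply: (below_prefix vp pre).
  by have := lb (rcons p (~~ c)); rewrite below_child // => /andP[].
move: h (lb (rcons p (~~ c))); rewrite E !below_child // => /andP[_ /eqP <-] /andP[_].
by case: (c).
Qed.

Lemma ray_inj n q b p c : nb_vertices t = n -> vertex t q -> vertex t p ->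
  ray t n q b = ray t n p c -> (q, b) = (p, c).
Proof.
move=> nt vq vp E; apply: below_set_inj => // j.
case: (ltnP j n.+1) => jn.
  have := congr1 (fun u : 'rV_n.+1 => u ord0 (Ordinal jn)) E.
  by rewrite !mxE /=; do 2!case: below.
have out y e : vertex t y -> below t j (rcons y e) = false.
  move=> vy; apply/negP; rewrite below_child // => /andP[/(below_bound nt vy)].
  by rewrite ltnNge jn.
by rewrite !out.
Qed.

End RayInjectivity.

(** * Cones of the fan and their dual semigroups *)

Section TreeCones.
Local Open Scope ring_scope.
Variables (R : realType) (t : bintree) (n : nat).
Hypothesis nt : nb_vertices t = n.
Local Notation C := (R[i]).
Implicit Types (m : 'rV[int]_n.+1) (q p : seq bool) (d : seq bool -> bool)
  (Q : seq 'rV[int]_n.+1) (z : cox C t) (s : NR_set R n).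

Definition cone_rays Q : Prop :=
  (forall v, v \in Q -> exists q b, vertex t q /\ v = ray t n q b) /\
  (forall q, vertex t q -> ~~ ((ray t n q false \in Q) && (ray t n q true \in Q))).

Definition tree_fan : NR_set R n -> Prop := fun s => exists2 Q, cone_rays Q & s = Cone Q.

Lemma ray_in_cone Q v : v \in Q -> Cone (R := R) Q (map_mx intr v).
Proof.
move=> vQ; exists (fun x => (x == v)%:R / (count_mem v Q)%:R), 0; split.
  by move=> x; rewrite divr_ge0 ?ler0n.
have k0 : (count_mem v Q)%:R != 0 :> R by rewrite pnatr_eq0 -lt0n -has_count has_pred1.
have -> : const_mx 0 = 0 :> 'rV[R]_n.+1 by apply/matrixP => i j; rewrite !mxE.
rewrite addr0.
rewrite (eq_bigr (fun x => if x == v then (count_mem v Q)%:R^-1 *: map_mx intr v else 0)).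
  rewrite -big_mkcond big_const_seq iter_addr addr0 -scaler_nat scalerA.
  by rewrite divff ?scale1r.
by move=> x _; case: eqP => [->|_]; rewrite ?mul1r // mul0r scale0r.
Qed.

Lemma pairing_ray m q b : pairing (R := R) m (map_mx intr (ray t n q b)) = (weight t m (rcons q b))%:~R.
Proof.
rewrite weight_ray /pairing rmorph_sum; apply: eq_bigr => k _.
by rewrite mxE rmorphM.
Qed.

Lemma pairing_cone Q m (c : 'rV[int]_n.+1 -> R) a : dualM m ->
  pairing m (\sum_(v <- Q) c v *: map_mx intr v + const_mx a) =
  \sum_(v <- Q) c v * pairing m (map_mx intr v).
Proof.
move=> mM; rewrite /pairing.
under eq_bigr => j _ do rewrite !mxE mulrDr summxE mulr_sumr.
rewrite big_split /= -mulr_suml -rmorph_sum /= mM mul0r addr0 exchange_big.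
apply: eq_bigr => q _; rewrite mulr_sumr; apply: eq_bigr => j _.
by rewrite !mxE mulrCA.
Qed.

Lemma dual_coneP Q m : cone_rays Q -> dual_semigroup (Cone (R := R) Q) m <->
  dualM m /\ forall q b, vertex t q -> ray t n q b \in Q -> 0 <= weight t m (rcons q b).
Proof.
move=> [Qr _]; split=> -[mM h]; split=> //.
  by move=> q b vq /ray_in_cone/h; rewrite pairing_ray ler0z.
move=> u [c [a [c0 ->]]]; rewrite pairing_cone // big_seq; apply: sumr_ge0 => v vQ.
rewrite mulr_ge0 //; have [q [b [vq vE]]] := Qr v vQ.
by rewrite vE pairing_ray ler0z h // -vE.
Qed.

(** It selects at each vertex a slot whose ray is not in [Q]; the coordinate there does not vanish
    on the chart of the cone and is normalised to 1. *)
Definition choice_of Q q : bool := ray t n q false \in Q.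

Lemma choice_ofN Q q : cone_rays Q -> vertex t q -> ray t n q (choice_of Q q) \notin Q.
Proof.
move=> [_ h] /h; rewrite /choice_of negb_and.
by case: (boolP (ray t n q false \in Q)) => //= h1.
Qed.

Lemma dual_unit_diff Q d q j : cone_rays Q ->
  (forall p, vertex t p -> ray t n p (d p) \notin Q) -> vertex t q -> below t j q ->
  dual_semigroup (Cone (R := R) Q) (unit_row n (target t d q) - unit_row n j).
Proof.
move=> cQ dQ vq jq; apply/dual_coneP => //; split.
  apply: dualM_unit_diff; first exact: (below_bound nt vq (below_target _ _ _)).
  exact: (below_bound nt vq jq).
move=> p b vp pQ; have -> : b = ~~ d p.
  by move: (dQ p vp) pQ; case: (b) (d p) => [] [] // /negPf ->.
exact: weight_target_ge0.
Qed.

Definition zeros_in_cone s z : Prop := forall q b, vertex t q -> sval z q b = 0 ->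
  s (map_mx intr (ray t n q b)).

Definition mono_point s z m : C := if `[<dual_semigroup s m>] then mono t (sval z) m else 0.

Lemma admissible_dual s z m :
  zeros_in_cone s z -> dual_semigroup s m -> admissible t (sval z) m.
Proof.
move=> zs [_ h] q b vq zq; have := h _ (zs q b vq zq).
by rewrite pairing_ray ler0z.
Qed.

Lemma dual_semigroupD s m m' :
  dual_semigroup s m -> dual_semigroup s m' -> dual_semigroup s (m + m').
Proof.
move=> [mM h] [mM' h']; split.
  rewrite /dualM (eq_bigr (fun j => m 0 j + m' 0 j)) ?big_split /= ?mM ?mM' ?addr0 //.
  by move=> j _; rewrite mxE.
move=> u su; rewrite /pairing (eq_bigr (fun j => (m 0 j)%:~R * u 0 j + (m' 0 j)%:~R * u 0 j)).
  by rewrite big_split /= addr_ge0 ?h ?h'.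
by move=> j _; rewrite mxE rmorphD mulrDl.
Qed.

Lemma dual_semigroup0 s : dual_semigroup s 0.
Proof.
split; first by rewrite /dualM big1 // => j _; rewrite mxE.
by move=> u _; rewrite /pairing big1 // => j _; rewrite mxE mul0r.
Qed.

Lemma affine_mono_point s z : zeros_in_cone s z -> affine_point s (mono_point s z).
Proof.
move=> zs; split.
- by rewrite /mono_point asboolT ?mono0 //; exact: dual_semigroup0.
- move=> m m' dm dm'; rewrite /mono_point !asboolT //; last exact: dual_semigroupD.
  by apply: monoD; [exact: (admissible_dual zs dm) | exact: (admissible_dual zs dm')].
- by move=> m dm; rewrite /mono_point asboolF.
Qed.

Lemma glued_mono_point s s' z : zeros_in_cone s z -> zeros_in_cone s' z ->
  glued (s, mono_point s z) (s', mono_point s' z).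
Proof.
move=> zs zs'; exists (mono_point (fun u => s u /\ s' u) z); split.
- by apply: affine_mono_point => q b vq zq; split; [exact: zs | exact: zs'].
- move=> m dm /=; rewrite /mono_point !asboolT //.
  by case: dm => mM h; split=> // u [/h].
- move=> m dm /=; rewrite /mono_point !asboolT //.
  by case: dm => mM h; split=> // u [_ /h].
Qed.

Lemma walk_toward_child (K : fieldType) (z : seq bool -> bool -> K) d q e : vertex t q ->
  walk t z (toward t (target t d (rcons q e))) q = z q e * walk t z d (rcons q e).
Proof.
move=> vq; rewrite walk_vertex //; have := below_target t d (rcons q e).
by rewrite below_child // => /andP[_ /eqP <-]; rewrite walk_toward_target.
Qed.

Lemma below_target_child d q e : vertex t q -> below t (target t d (rcons q e)) q.
Proof. by move=> vq; have := below_target t d (rcons q e); rewrite below_child // => /andP[]. Qed.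

Lemma mono_child (z : cox C t) d q e : in_chart d z -> vertex t q ->
  mono t (sval z) (unit_row n (target t d q) - unit_row n (target t d (rcons q e))) =
  sval z q e * walk t (sval z) d (rcons q e) / walk t (sval z) d q.
Proof.
move=> dz vq; rewrite (mono_unit_diff nt vq) ?walk_toward_child //.
  exact: below_target_child.
by move=> p vp _; exact: dz.
Qed.

Lemma zeros_in_chart Q z d : (forall q, vertex t q -> ray t n q (d q) \notin Q) ->
  (forall q b, vertex t q -> sval z q b = 0 -> ray t n q b \in Q) -> in_chart d z.
Proof. by move=> dQ zQ q vq; apply: contraNneq (dQ q vq); apply: zQ. Qed.

(** The character [a q] lies in the dual semigroup of the first cone and its opposite in that of the
    second, so [psi (a q)] is non-zero. This puts [z] into the chart of the second cone too, where
    the coordinates of both points can be compared. *)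
Lemma glued_cox_equiv Q Q' z z' : cone_rays Q -> cone_rays Q' ->
  (forall q b, vertex t q -> sval z q b = 0 -> ray t n q b \in Q) ->
  (forall q b, vertex t q -> sval z' q b = 0 -> ray t n q b \in Q') ->
  glued (Cone (R := R) Q, mono_point (Cone Q) z) (Cone Q', mono_point (Cone Q') z') ->
  cox_equiv t (sval z) (sval z').
Proof.
move=> cQ cQ' zQ zQ'; pose d := choice_of Q; pose d' := choice_of Q'.
have dQ q (vq : vertex t q) : ray t n q (d q) \notin Q by exact: choice_ofN.
have dQ' q (vq : vertex t q) : ray t n q (d' q) \notin Q' by exact: choice_ofN.
have dz := zeros_in_chart dQ zQ; have dz' := zeros_in_chart dQ' zQ'.
rewrite /glued /= => -[psi [[psi0 psiD _] psiE psiE']].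
have D m : dual_semigroup (Cone (R := R) Q) m ->
    dual_semigroup (fun u => Cone (R := R) Q u /\ Cone Q' u) m /\ psi m = mono t (sval z) m.
  move=> dm; split; last by rewrite psiE // /mono_point asboolT.
  by case: dm => mM h; split=> // u [cu _]; exact: h.
have D' m : dual_semigroup (Cone (R := R) Q') m ->
    dual_semigroup (fun u => Cone (R := R) Q u /\ Cone Q' u) m /\ psi m = mono t (sval z') m.
  move=> dm; split; last by rewrite psiE' // /mono_point asboolT.
  by case: dm => mM h; split=> // u [_ cu]; exact: h.
pose a y := unit_row n (target t d y) - unit_row n (target t d' y).
have aE q : dual_semigroup (fun u => Cone (R := R) Q u /\ Cone Q' u) (a q) /\
    psi (a q) = walk t (sval z) d' q / walk t (sval z) d q /\ psi (a q) != 0.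
  case: (boolP (vertex t q)) => [vq|nvq]; last first.
    rewrite /a !target_leaf // subrr psi0 !walk_leaf // divr1 oner_neq0; split=> //.
    exact: dual_semigroup0.
  have [da pa] := D (a q) (dual_unit_diff cQ dQ vq (below_target _ _ _)).
  have [da' _] := D' (- a q) (ltac:(rewrite opprB; exact: (dual_unit_diff cQ' dQ' vq (below_target _ _ _)))).
  split=> //; split.
    rewrite pa (mono_unit_diff nt vq) ?walk_toward_target //; first exact: below_target.
    by move=> p vp _; exact: dz.
  have := psiD _ _ da da'; rewrite subrr psi0 => /esym E.
  by apply/negP => /eqP a0; move: E; rewrite a0 mul0r => /eqP; rewrite eq_sym oner_eq0.
have dz2 : in_chart d' z.
  move=> q vq; have [_ [E]] := aE q; rewrite E mulf_eq0 negb_or walk_vertex // => /andP[+ _].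
  by rewrite mulf_eq0 negb_or => /andP[].
suff cc : chart_coord d' z = chart_coord d' z'.
  apply: cox_equiv_trans (chart_coordK dz2) _; rewrite cc; apply: cox_equiv_sym.
  exact: chart_coordK.
apply/funext => q; rewrite /chart_coord; case: ifP => // vq.
set e := ~~ d' q; set c := rcons q e.
have [dm' pm'] := D' _ (dual_unit_diff cQ' dQ' vq (below_target_child d' e vq)).
have [dm1 pm1] := D _ (dual_unit_diff cQ dQ vq (below_target_child d e vq)).
have [daq [paq aq0]] := aE q; have [dac [pac ac0]] := aE c.
(* Two ways from the target of [q] along [d] to the target of its child along [d']: one through a
   character of the chart of [Q'], the other through one of the chart of [Q]. *)
have E : unit_row n (target t d' q) - unit_row n (target t d' c) + a q =
         unit_row n (target t d q) - unit_row n (target t d c) + a c.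
  by rewrite /a; apply/rowP => k; rewrite !mxE; ring.
have := psiD _ _ dm' daq; rewrite E psiD // pm1 pm' !mono_child // paq pac => {}E.
have wq := walk_chart_neq0 q dz; have wc := walk_chart_neq0 c dz.
have wq' := walk_chart_neq0 q dz2.
apply: (mulIf aq0); rewrite paq -E -/c; field.
by rewrite wq wc wq'.
Qed.

End TreeCones.

(** * The toric variety as a quotient of the Cox space *)

Section ToricPresentation.
Local Open Scope ring_scope.
Variables (R : realType) (t : bintree) (n : nat).
Hypothesis nt : nb_vertices t = n.
Local Notation C := (R[i]).
Local Notation Sigma := (@tree_fan R t n).
Local Notation cone := (@Cone R n).
Implicit Types (m : 'rV[int]_n.+1) (q : seq bool) (d : seq bool -> bool)
  (Q : seq 'rV[int]_n.+1) (z : cox C t) (s : NR_set R n).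

Section AffinePoint.
Variables (Q : seq 'rV[int]_n.+1) (phi : 'rV[int]_n.+1 -> C).
Hypotheses (cQ : cone_rays t Q) (aphi : affine_point (cone Q) phi).
Let d := choice_of t Q.

(** For the vertices [q] this is the basis of M dual to the rays of the slots [(q, ~~ d q)]: the
    pairing is 1 at [q] and 0 at the other vertices. *)
Definition dual_basis (d0 : seq bool -> bool) q : 'rV[int]_n.+1 :=
  unit_row n (target t d0 q) - unit_row n (target t d0 (rcons q (~~ d0 q))).

Let x q := phi (dual_basis d q).

Lemma dual_semigroup_basis q : vertex t q -> dual_semigroup (cone Q) (dual_basis d q).
Proof.
move=> vq; apply: dual_unit_diff => //; first by move=> p vp; exact: choice_ofN.
exact: below_target_child.
Qed.

Lemma dual_semigroup_basisN q : vertex t q -> ray t n q (~~ d q) \notin Q ->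
  dual_semigroup (cone Q) (- dual_basis d q).
Proof.
move=> vq rq; pose d2 p := if p == q then ~~ d q else d p.
have -> : - dual_basis d q = unit_row n (target t d2 q) - unit_row n (target t d q).
  rewrite opprB; congr (unit_row n _ - _); rewrite [RHS]target_vertex // /d2 eqxx.
  apply: eq_target => p vp qp; case: eqP => // pq; move: qp; rewrite pq.
  by rewrite (negPf (not_prefix_rcons _ (leqnn _))).
apply: dual_unit_diff => //; last exact: below_target.
by move=> p vp; rewrite /d2; case: eqP => [->|_] //; exact: choice_ofN.
Qed.

Lemma affine_point_neq0 q : vertex t q -> ray t n q (~~ d q) \notin Q -> x q != 0.
Proof.
move=> vq rq; have [phi0 phiD _] := aphi.
have := phiD _ _ (dual_semigroup_basis vq) (dual_semigroup_basisN vq rq).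
rewrite subrr phi0 => E; apply/negP => /eqP x0.
by move: E; rewrite -/(x q) x0 mul0r => /eqP; rewrite oner_eq0.
Qed.

Lemma affine_point_expn v (k : nat) : dual_semigroup (cone Q) v ->
  dual_semigroup (cone Q) (k%:Z *: v) /\ phi (k%:Z *: v) = phi v ^+ k.
Proof.
move=> dv; have [phi0 phiD _] := aphi; elim: k => [|k [dk pk]].
  by rewrite scale0r phi0; split=> //; exact: dual_semigroup0.
rewrite intS scalerDl scale1r phiD // pk exprS; split=> //.
exact: dual_semigroupD.
Qed.

Lemma affine_point_exp q (k : int) : vertex t q ->
  (ray t n q (~~ d q) \in Q -> 0 <= k) ->
  dual_semigroup (cone Q) (k *: dual_basis d q) /\ phi (k *: dual_basis d q) = x q ^ k.
Proof.
move=> vq; have dq := dual_semigroup_basis vq; have [phi0 phiD _] := aphi.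
case: k => k kQ; first by have [? ->] := affine_point_expn k dq.
have rq : ray t n q (~~ d q) \notin Q by apply/negP => /kQ.
have dqN := dual_semigroup_basisN vq rq; have x0 := affine_point_neq0 vq rq.
rewrite NegzE scaleNr -scalerN; have [? ->] := affine_point_expn k.+1 dqN.
split=> //; rewrite -exprz_inv; congr (_ ^+ _).
have := phiD _ _ dq dqN; rewrite subrr phi0 -/(x q) => E.
by apply: (mulfI x0); rewrite -E divff.
Qed.

(** This is [m] cut off to the leaves below [p], with its sum brought back to 0 at the target leaf.
    It is 0 when [p] is a leaf and [m] when [p] is the root, so recursion over the tree writes [m]
    in the dual basis. *)
Let D m p : 'rV[int]_n.+1 :=
  (\row_(k < n.+1) if below t k p then m 0 k else 0) + weight t m p *: unit_row n (target t d p).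

Lemma affine_point_tree_prod m p : dual_semigroup (cone Q) m ->
  dual_semigroup (cone Q) (D m p) /\
  phi (D m p) = tree_prod t (fun q => x q ^ weight t m (rcons q (~~ d q))) p.
Proof.
move=> dm; have [phi0 phiD _] := aphi; elim/(@path_ind t): p => p vp.
  have -> : D m p = 0.
    apply/rowP => k; rewrite !mxE target_leaf // /weight /below hi_leaf // ltnS -eqn_leq.
    rewrite [lo t p == k]eq_sym; case: eqP => [kp|_]; last by rewrite mulr0 addr0.
    rewrite (big_pred1 k) ?mulr1 ?subrr // => j.
    by rewrite -kp ltnS -eqn_leq /= -val_eqE eq_sym.
  by rewrite tree_prod_leaf // phi0; split=> //; exact: dual_semigroup0.
move=> IH; have [d0 p0] := IH false; have [d1 p1] := IH true.
have -> : D m p = weight t m (rcons p (~~ d p)) *: dual_basis d p +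
    (D m (rcons p false) + D m (rcons p true)).
  have -> : D m p = (\row_(k < n.+1) if below t k (rcons p false) then m 0 k else 0) +
      (\row_(k < n.+1) if below t k (rcons p true) then m 0 k else 0) +
      weight t m p *: unit_row n (target t d p).
    congr (_ + _); apply/rowP => k; rewrite !mxE !below_child //.
    by case: below => /=; rewrite ?addr0 //; case: toward; rewrite /= ?addr0 ?add0r.
  rewrite /D /dual_basis (weight_vertex _ vp) target_vertex //.
  by apply/rowP => k; rewrite !mxE; case: (d p) => /=; ring.
have [|dk pk] := @affine_point_exp p (weight t m (rcons p (~~ d p))) vp.
  by have [_ h] := (dual_coneP R m cQ).1 dm; exact: h.
have d01 := dual_semigroupD d0 d1.
rewrite tree_prod_vertex // (phiD _ _ dk d01) (phiD _ _ d0 d1) p0 p1 pk.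
by split=> //; exact: dual_semigroupD.
Qed.

Lemma affine_point_chart :
  (forall q b, vertex t q -> sval (chart_map t d x) q b = 0 -> ray t n q b \in Q) /\
  phi = mono_point (cone Q) (chart_map t d x).
Proof.
split=> [q b vq|].
  rewrite /= /chart_fun; case: eqP => [_ /eqP|/eqP bd xq]; first by rewrite oner_eq0.
  have -> : b = ~~ d q by case: (b) (d q) bd => [] [].
  by apply/negPn/negP => rq; have := affine_point_neq0 vq rq; rewrite xq eqxx.
apply/funext => m; rewrite /mono_point; case: asboolP => dm; last by case: aphi => _ _ ->.
have [_] := affine_point_tree_prod [::] dm.
have -> : D m [::] = m.
  rewrite /D weight_root //; last by case: dm.
  by apply/rowP => k; rewrite !mxE mul0r addr0 below_root /nb_leaves nt ltn_ord.
move=> ->; apply: eq_tree_prod => q vq _; rewrite /slot_power /= /chart_fun.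
by case: (d q) => /=; rewrite exp1rz ?mulr1 ?mul1r.
Qed.

End AffinePoint.

Definition zeros_in_rays Q z : Prop :=
  forall q b, vertex t q -> sval z q b = 0 -> ray t n q b \in Q.

Lemma zeros_in_rays_cone Q z : zeros_in_rays Q z -> zeros_in_cone (cone Q) z.
Proof. by move=> zQ q b vq zq; apply/ray_in_cone/zQ. Qed.

Lemma zeros_in_rays_equiv Q z z' :
  cox_equiv t (sval z) (sval z') -> zeros_in_rays Q z -> zeros_in_rays Q z'.
Proof.
move=> zz' zQ q b vq z'q; apply: zQ => //; apply/eqP.
by rewrite -(negbK (_ == _)) -(cox_equiv_neq0 _ vq zz') z'q eqxx.
Qed.

Lemma mono_point_equiv s z z' : cox_equiv t (sval z) (sval z') ->
  mono_point s z = mono_point s z'.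
Proof.
move=> zz'; apply/funext => m; rewrite /mono_point; case: asboolP => [[mM _]|_]; last by [].
by rewrite (mono_equiv nt mM zz').
Qed.

Lemma glue_class_mono Q z p : cone_rays t Q -> zeros_in_rays Q z ->
  glue_class Sigma (cone Q, mono_point (cone Q) z) p <->
  exists Q' z', [/\ cone_rays t Q', zeros_in_rays Q' z', cox_equiv t (sval z) (sval z') &
                    p = (cone Q', mono_point (cone Q') z')].
Proof.
move=> cQ zQ; split.
  case: p => s phi [[/= [Q' cQ' ->] aphi] gl].
  have [z'Q' phiE] := affine_point_chart cQ' aphi.
  exists Q', (chart_map t (choice_of t Q') (fun q => phi (dual_basis (choice_of t Q') q))).
  split=> //; last by rewrite -phiE.
  by apply: (glued_cox_equiv nt cQ cQ') => //; rewrite -phiE.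
move=> [Q' [z' [cQ' z'Q' zz' ->]]]; split.
  split=> /=; first by exists Q'.
  exact/affine_mono_point/zeros_in_rays_cone.
rewrite -(mono_point_equiv _ zz'); apply: glued_mono_point; apply: zeros_in_rays_cone => //.
exact: zeros_in_rays_equiv (cox_equiv_sym zz') z'Q'.
Qed.

Definition rays_of d : seq 'rV[int]_n.+1 := [seq ray t n q (~~ d q) | q <- vertices t].

Lemma mem_rays_of d q b : vertex t q -> (ray t n q b \in rays_of d) = (b != d q).
Proof.
move=> vq; apply/mapP/idP => [[p] | bd].
  rewrite mem_vertices => vp /(ray_inj nt vq vp)[-> ->]; by case: (d p).
by exists q; rewrite ?mem_vertices //; congr ray; case: (b) (d q) bd => [] [].
Qed.

Lemma cone_rays_of d : cone_rays t (rays_of d).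
Proof.
split=> [v /mapP[q]|q vq]; last by rewrite !mem_rays_of //; case: (d q).
by rewrite mem_vertices => vq ->; exists q, (~~ d q).
Qed.

Lemma zeros_in_rays_of d z : in_chart d z -> zeros_in_rays (rays_of d) z.
Proof.
move=> dz q b vq zq; rewrite mem_rays_of //; apply/eqP => bd.
by have := dz q vq; rewrite -bd zq eqxx.
Qed.

Definition zero_choice z q : bool := sval z q false == 0.

Lemma in_chart_zero_choice z : in_chart (zero_choice z) z.
Proof.
move=> q vq; rewrite /zero_choice.
by case: (eqVneq (sval z q false)) => [z0|//]; case: (svalP z q vq) => //; rewrite z0 eqxx.
Qed.

Definition fan_cone d : {s | Sigma s} :=
  exist _ (cone (rays_of d)) (ex_intro2 _ _ (rays_of d) (cone_rays_of d) erefl).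

Definition toric_chart_point d z (dz : in_chart d z) : affine_toric (cone (rays_of d)) :=
  exist _ (mono_point (cone (rays_of d)) z)
    (affine_mono_point (zeros_in_rays_cone (zeros_in_rays_of dz))).

(** The zeros of [z] choose the chart; by [cox_to_toricP] every cone whose rays include the zeros
    gives the same point. *)
Definition cox_to_toric z : toric_variety Sigma :=
  chart (s := fan_cone (zero_choice z)) (toric_chart_point (in_chart_zero_choice z)).

Lemma toric_point_eq (x y : toric_point Sigma) : sval x = sval y -> x = y.
Proof.
case: x y => [x xP] [y yP] /= E; case: y / E yP => yP.
by rewrite (Prop_irrelevance xP yP).
Qed.

Lemma cox_to_toricP z p : sval (cox_to_toric z) p <->
  exists Q' z', [/\ cone_rays t Q', zeros_in_rays Q' z', cox_equiv t (sval z) (sval z') &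
                    p = (cone Q', mono_point (cone Q') z')].
Proof.
apply: glue_class_mono; first exact: cone_rays_of.
exact/zeros_in_rays_of/in_chart_zero_choice.
Qed.

Lemma cox_to_toric_chart (s : {s | Sigma s}) (phi : affine_toric (sval s)) z Q :
  cone_rays t Q -> zeros_in_rays Q z -> sval s = cone Q -> sval phi = mono_point (cone Q) z ->
  cox_to_toric z = chart phi.
Proof.
move=> cQ zQ sE phiE; apply: toric_point_eq; apply/funext => p; apply/propext.
have -> : sval (chart phi) = glue_class Sigma (cone Q, mono_point (cone Q) z).
  by rewrite /= phiE sE.
by rewrite cox_to_toricP glue_class_mono.
Qed.

Lemma cox_to_toric_fiber z z' : cox_to_toric z = cox_to_toric z' <-> cox_equiv t (sval z) (sval z').
Proof.
split=> [E | zz']; last first.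
  apply: toric_point_eq; apply/funext => p; apply/propext.
  apply: iff_trans (cox_to_toricP z p) _; apply: iff_trans _ (iff_sym (cox_to_toricP z' p)).
  split=> -[Q [w [cQ wQ zw ->]]]; exists Q, w; split=> //.
    exact: cox_equiv_trans (cox_equiv_sym zz') zw.
  exact: cox_equiv_trans zz' zw.
pose d := zero_choice z'; have dz' := in_chart_zero_choice z'.
have h : sval (cox_to_toric z') (cone (rays_of d), mono_point (cone (rays_of d)) z').
  apply: (cox_to_toricP z' _).2; exists (rays_of d), z'.
  by split; [exact: cone_rays_of | exact: zeros_in_rays_of | exact: cox_equiv_refl |].
rewrite -E in h; have [Q [w [cQ wQ zw [sE pE]]]] := (cox_to_toricP z _).1 h.
apply: cox_equiv_trans zw _; apply: cox_equiv_sym.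
apply: (glued_cox_equiv nt (cone_rays_of d) cQ (zeros_in_rays_of dz') wQ).
by rewrite -pE -sE; apply: glued_mono_point; exact/zeros_in_rays_cone/zeros_in_rays_of.
Qed.

Lemma cox_to_toric_surj y : exists z, cox_to_toric z = y.
Proof.
have [[s phi] [[/= [Q cQ sE] aphi] PE]] := svalP y; rewrite sE in aphi PE.
have [zQ phiE] := affine_point_chart cQ aphi; set z := chart_map _ _ _ in zQ phiE.
exists z; apply: toric_point_eq; apply/funext => p; apply/propext.
by rewrite PE cox_to_toricP phiE glue_class_mono.
Qed.

Lemma regular_tree_prod (U : cox C t -> Prop) (G : seq bool -> cox C t -> C) q :
  (forall q, vertex t q -> regular U (G q)) ->
  regular U (fun z => tree_prod t (fun q => G q z) q).
Proof.
move=> rG; elim/(@path_ind t): q => q vq.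
  by apply: regular_eq (regular_cst 1) => z _; rewrite tree_prod_leaf.
move=> IH; apply: regular_eq (regularM (rG q vq) (regularM (IH false) (IH true))) => z _.
by rewrite (tree_prod_vertex _ vq).
Qed.

Lemma regular_mono d m : (forall q, vertex t q -> 0 <= weight t m (rcons q (~~ d q))) ->
  regular (in_chart d) (fun z => mono t (sval z) m).
Proof.
move=> wm; apply: regular_tree_prod => q vq.
have rcoord b : regular (in_chart d) (fun z => sval z q b).
  by apply: regular_poly; apply: Polyfun_coord; exists q, b.
have rpow b (k : nat) : regular (in_chart d) (fun z => sval z q b ^+ k).
  elim: k => [|k IH]; first exact: regular_cst.
  by apply: regular_eq (regularM (rcoord b) IH) => z _; rewrite -exprS.
have rslot b : regular (in_chart d) (fun z => sval z q b ^ weight t m (rcons q b)).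
  case: (eqVneq b (d q)) => [bE|bd].
    case: (weight t m _) => k; first exact: rpow.
    by apply: regularV (rpow b k.+1) => z dz; rewrite expf_neq0 // bE dz.
  have := wm q vq; have -> : ~~ d q = b by case: (b) (d q) bd => [] [].
  by case: (weight t m _) => k // _; exact: rpow.
exact: regularM.
Qed.

Lemma toric_section (s : {s | Sigma s}) : exists2 sigma : affine_toric (sval s) -> cox C t,
  morphism_of_spaces sigma & forall phi, cox_to_toric (sigma phi) = chart phi.
Proof.
have [Q cQ sE] := svalP s.
exists (fun phi : affine_toric (sval s) =>
  chart_map t (choice_of t Q) (fun q => sval phi (dual_basis (choice_of t Q) q))).
  apply: poly_map_morphism => c [q [b [vq ->]]] /=; rewrite /chart_fun.
  case: (b == _); first exact: Polyfun_const.
  apply: Polyfun_coord; exists (dual_basis (choice_of t Q) q) => //.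
  by rewrite sE; apply: dual_semigroup_basis.
move=> phi; have aphi : affine_point (cone Q) (sval phi) by rewrite -sE; exact: (svalP phi).
have [zQ phiE] := affine_point_chart cQ aphi.
exact: (cox_to_toric_chart cQ zQ sE phiE).
Qed.

Lemma toric_lift z : exists (U : cox C t -> Prop) (s : {s | Sigma s})
    (g : cox C t -> affine_toric (sval s)),
  [/\ is_open U, U z,
      forall V : affine_toric (sval s) -> Prop, is_open V -> is_open (fun w => U w /\ V (g w)),
      forall (V : affine_toric (sval s) -> Prop) h, is_open V -> regular V h ->
        regular (fun w => U w /\ V (g w)) (fun w => h (g w)) &
      forall w, U w -> chart (g w) = cox_to_toric w].
Proof.
pose d := zero_choice z; have dz : in_chart d z := in_chart_zero_choice z.
(* A total function is required; off the chart its value is the point of [z] itself. *)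
pose g w : affine_toric (sval (fan_cone d)) :=
  if pselect (in_chart d w) is left dw then toric_chart_point dw else toric_chart_point dz.
have gE w : in_chart d w -> sval (g w) = mono_point (cone (rays_of d)) w.
  by move=> dw; rewrite /g; case: (pselect (in_chart d w)) => [?|/(_ dw)] //.
have greg c : (exists2 m, dual_semigroup (cone (rays_of d)) m & forall p : affine_toric _, c p = sval p m) ->
    regular (in_chart d) (fun w => c (g w)).
  move=> [m dm cE]; apply: (@regular_eq _ _ _ _ (fun w => mono t (sval w) m)).
    by move=> w dw; rewrite cE gE // /mono_point asboolT.
  apply: regular_mono => q vq; have [_ h] := (dual_coneP R m (cone_rays_of d)).1 dm.
  by apply: h => //; rewrite mem_rays_of //; case: (d q).
exists (in_chart d), (fan_cone d), g; split=> //.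
- exact: open_in_chart.
- by move=> V oV; apply: (local_preimage_open greg) => //; exact: open_in_chart.
- by move=> V h oV rh; apply: (local_pullback_regular greg) => //; exact: open_in_chart.
- move=> w dw; apply/esym; apply: (@cox_to_toric_chart _ _ w (rays_of d)) => //.
  + exact: cone_rays_of.
  + exact: zeros_in_rays_of.
  + exact: gE.
Qed.

Lemma cox_to_toric_scaled (c : seq bool -> bool -> C) (tau : 'rV[int]_n.+1 -> C) z z' :
  (forall q b, c q b != 0) -> (forall m, dualM m -> tau m = mono t c m) ->
  scaled c z z' ->
  forall p, sval (cox_to_toric z') p <->
    exists2 phi, sval (cox_to_toric z) (p.1, phi) & p.2 = (fun m => tau m * phi m).
Proof.
move=> c0 tauE zz' p.
have tauM Q (w w' : cox C t) : (forall q b, vertex t q -> sval w' q b = c q b * sval w q b) ->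
    mono_point (cone Q) w' = (fun m => tau m * mono_point (cone Q) w m).
  move=> ww'; apply/funext => m; rewrite /mono_point; case: asboolP => [[mM _]|_]; last by rewrite mulr0.
  rewrite tauE // -monoM; apply: eq_tree_prod => q vq _.
  by rewrite /slot_power !ww'.
have zero w w' Q : scaled c w w' -> zeros_in_rays Q w <-> zeros_in_rays Q w'.
  move=> ww'; split=> h q b vq w0; apply: h => //.
    by have := ww' q b vq; rewrite w0 => /esym/eqP; rewrite mulf_eq0 (negPf (c0 q b)) => /eqP.
  by rewrite ww' // w0 mulr0.
apply: iff_trans (cox_to_toricP z' p) _; split.
  move=> [Q [w' [cQ wQ zw' ->]]] /=.
  have [|w wE] := @cox_point C t (fun q b => (c q b)^-1 * sval w' q b).
    by move=> q vq; case: (svalP w' q vq) => ?; [left|right]; rewrite mulf_neq0 ?invr_eq0.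
  have ww' : scaled c w w' by move=> q b _; rewrite wE mulVKf.
  exists (mono_point (cone Q) w); last exact: tauM.
  apply/cox_to_toricP; exists Q, w; split=> //; first exact/(zero _ _ _ ww').
  have [lam [l0 l1 lE]] := zw'; exists lam; split=> // q b vq.
  by rewrite wE -mulrA lE // zz' // mulrCA mulKf.
move=> [phi /cox_to_toricP[Q [w [cQ wQ zw [pE phiE]]]] p2E].
have [|w' wE] := @cox_point C t (fun q b => c q b * sval w q b).
  by move=> q vq; case: (svalP w q vq) => ?; [left|right]; rewrite mulf_neq0.
have ww' : scaled c w w' by move=> q b _; rewrite wE.
exists Q, w'; split=> //.
- exact/(zero _ _ _ ww').
- have [lam [l0 l1 lE]] := zw; exists lam; split=> // q b vq.
  by rewrite wE -mulrA lE // zz' // mulrCA.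
- by case: p pE p2E => p1 p2 /= -> ->; rewrite phiE -(tauM _ _ _ ww').
Qed.

Lemma toric_presents : presents cox_to_toric.
Proof.
split.
- exact: cox_to_toric_surj.
- exact: cox_to_toric_fiber.
- exact: (final_open toric_section toric_lift).
- exact: (final_regular toric_section toric_lift).
move=> f; split=> [[tau [tau0 tauD] fE] | [c c0 cE]].
  (* A torus point is a point of the chart of the zero cone. Its Cox coordinates have no zeros and
     serve as the scaling. *)
  have cQ : cone_rays t ([::] : seq 'rV[int]_n.+1) by split.
  have dE m : dual_semigroup (cone [::]) m <-> dualM m.
    by rewrite (dual_coneP R m cQ); split=> [[]|].
  have aphi : affine_point (cone [::]) (fun m => if `[<dualM m>] then tau m else 0).
    split.
    - by rewrite asboolT ?tau0 //; apply/dE; exact: dual_semigroup0.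
    - move=> m m' /[dup] dm /dE mM /[dup] dm' /dE mM'; rewrite !asboolT ?tauD //.
      by apply/dE; exact: dual_semigroupD.
    - by move=> m dm; rewrite asboolF // -dE.
  have [zQ phiE] := affine_point_chart cQ aphi; set z := chart_map _ _ _ in zQ phiE.
  pose c q b : C := if vertex t q then sval z q b else 1.
  have c0 q b : c q b != 0.
    rewrite /c; case: ifP => vq; last exact: oner_neq0.
    by apply/negP => /eqP /(zQ q b vq).
  have tauE m : dualM m -> tau m = mono t c m.
    move=> mM; have := congr1 (fun h => h m) phiE.
    rewrite /mono_point !asboolT ?dE // => ->.
    by apply: eq_tree_prod => q vq _; rewrite /slot_power /c vq.
  exists c => // w w' ww'; apply: toric_point_eq; apply/funext => p; apply/propext.
  exact: iff_trans (fE _ p) (iff_sym (cox_to_toric_scaled c0 tauE ww' p)).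
exists (mono t c).
  split; first exact: mono0.
  by move=> m m' _ _; apply: monoD => q b _ /eqP; rewrite (negPf (c0 q b)).
move=> x p; have [w <-] := cox_to_toric_surj x.
have [|w' wE] := @cox_point C t (fun q b => c q b * sval w q b).
  by move=> q vq; case: (svalP w q vq) => ?; [left|right]; rewrite mulf_neq0.
have ww' : scaled c w w' by move=> q b _; rewrite wE.
rewrite (cE _ _ ww').
exact: (cox_to_toric_scaled c0 (fun _ _ => erefl) ww' p).
Qed.

Lemma toric_presentable : presentable t (toric_variety Sigma).
Proof. by exists cox_to_toric; exact: toric_presents. Qed.

End ToricPresentation.

(** * Polygon triangulations *)

Section TriangulationTree.
Variables (n : nat) (T : {set 'I_n.+2 * 'I_n.+2}).
Hypothesis trT : triangulation T.
Implicit Types (a b c : 'I_n.+2) (q : seq bool).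

Lemma apex_unique a b c :
  a < c -> c < b -> (a, c) \in T -> (c, b) \in T -> apex T a b = Some c.
Proof.
move=> ac cb acT cbT; have [_ _ ncr _] := trT; rewrite /apex; case: pickP => [c'|/(_ c)].
  move=> /and4P[ac' cb' acT' cbT']; congr Some; apply/val_inj => /=.
  case: (ltngtP c' c) => // cc'.
    by have := ncr _ _ acT cbT'; rewrite /crossing /= ac' cc' cb.
  by have := ncr _ _ acT' cbT; rewrite /crossing /= ac cc' cb'.
by rewrite ac cb acT cbT.
Qed.

Lemma apex_side a b : b = a.+1 :> nat -> apex T a b = None.
Proof. by move=> ab; rewrite /apex; case: pickP => // c /and4P[]; rewrite ab; lia. Qed.

Lemma side_mem a b : b = a.+1 :> nat -> (a, b) \in T.
Proof. by move=> ab; have [/fintype.subsetP h _ _ _] := trT; apply: h; rewrite inE /= ab eqxx. Qed.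

(* The chords of T, including the distinguished edge but no other side, that
   lie in the polygon with vertices a, ..., b. *)
Definition chords a b := [set e in T | [&& e.1.+1 < e.2, a <= e.1 & e.2 <= b]].

(** [c] is the largest end below [b] of an edge from [a]. An edge that passes over [c] starts at
    [a], since otherwise it crosses [(a, c)], and then maximality leaves only [b] as its end. *)
Lemma chords_split a b : a.+1 < b -> exists c,
  [/\ a < c, c < b, (a, c) \in T &
      chords a b \subset [set (a, b)] :&: T :|: (chords a c :|: chords c b)].
Proof.
move=> ab; have [_ lt ncr _] := trT.
have a1 : a.+1 < n.+2 by rewrite (ltn_trans ab).
pose P (c : 'I_n.+2) := [&& a < c, c < b & (a, c) \in T].
have Pa : P (Ordinal a1) by rewrite /P /= ltnSn ab side_mem.
case: (arg_maxnP (fun c : 'I_n.+2 => (c : nat)) Pa) => c /and3P[ac cb acT] cmax.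
exists c; split=> //; apply/fintype.subsetP => -[x y]; rewrite !inE /= => /andP[xyT /and3P[xy ax yb]].
rewrite xyT /= andbT xpair_eqE.
case: (leqP y c) => [yc|cy]; first by rewrite xy ax /= orbT.
case: (leqP c x) => [cx|xc]; first by rewrite xy yb /= !orbT.
have xa : x = a.
  apply/val_inj; apply/eqP; rewrite eqn_leq ax andbT leqNgt; apply/negP => a_x.
  by have := ncr _ _ acT xyT; rewrite /crossing /= a_x xc cy.
rewrite xa eqxx /=; case: (ltngtP y b) => [y_b|b_y|/val_inj ->].
- have Py : P y by rewrite /P y_b (ltn_trans ac cy) -xa xyT.
  by have := cmax y Py; rewrite /geq /= leqNgt cy.
- by move: yb; rewrite leqNgt b_y.
- by rewrite eqxx.
Qed.

Lemma card_setU3 (A B D : {set 'I_n.+2 * 'I_n.+2}) :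
  #|A :|: (B :|: D)| <= #|A| + (#|B| + #|D|).
Proof.
apply: leq_trans (leq_of_leqif (leq_card_setU _ _)) _.
by rewrite leq_add2l; exact: leq_of_leqif (leq_card_setU _ _).
Qed.

Lemma card_chords a b : a < b -> #|chords a b| <= (b - a).-1.
Proof.
have [m] := ubnP (b - a); elim: m a b => // m IH a b abm ab.
case: (ltngtP a.+1 b) => [ab1| |ab1]; last 2 first.
- by rewrite ltnS leqNgt ab.
- rewrite (_ : chords a b = finset.set0) ?cards0 //; apply/setP => -[x y]; rewrite !inE /=.
  by apply/negP => /andP[_ /and3P[]]; lia.
have [c [ac cb _ sub]] := chords_split ab1; apply: leq_trans (subset_leq_card sub) _.
apply: leq_trans (card_setU3 _ _ _) _; have h1 : #|[set (a, b)] :&: T| <= 1.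
  by rewrite -(cards1 (a, b)) subset_leq_card // finset.subsetIl.
have h2 : #|chords a c| <= (c - a).-1 by apply: IH => //; lia.
have h3 : #|chords c b| <= (b - c).-1 by apply: IH => //; lia.
apply: leq_trans (leq_add h1 (leq_add h2 h3)) _; lia.
Qed.

(** Equality in [card_chords]. The number of diagonals gives it for the whole polygon, and it passes
    to both parts of a split; thus the count of diagonals alone produces every triangle. *)
Definition full a b : bool := (a < b) && (#|chords a b| == (b - a).-1).

Lemma full_split a b : full a b -> a.+1 < b -> exists c,
  [/\ a < c, c < b, (a, c) \in T, full a c & full c b].
Proof.
move=> /andP[ab /eqP cab] ab1; have [c [ac cb acT sub]] := chords_split ab1.
have h := leq_trans (subset_leq_card sub) (card_setU3 _ _ _); rewrite cab in h.
have h1 : #|[set (a, b)] :&: T| <= 1.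
  by rewrite -(cards1 (a, b)) subset_leq_card // finset.subsetIl.
have h2 := card_chords ac; have h3 := card_chords cb.
exists c; rewrite /full ac cb; split=> //; move: h h1 h2 h3 ab1 ac cb;
  move: #|[set _] :&: _| #|chords a c| #|chords c b| => x y z; lia.
Qed.

Lemma full_mem a b : full a b -> (a, b) \in T.
Proof.
move=> /andP[ab /eqP cab]; case: (ltngtP a.+1 b) => [ab1| |ab1]; last 2 first.
- by rewrite ltnS leqNgt ab.
- exact: side_mem.
have [c [ac cb acT sub]] := chords_split ab1.
have h := leq_trans (subset_leq_card sub) (card_setU3 _ _ _); rewrite cab in h.
have h2 := card_chords ac; have h3 := card_chords cb.
have : 0 < #|[set (a, b)] :&: T|.
  move: h h2 h3 ab1 ac cb; move: #|[set _] :&: _| #|chords a c| #|chords c b| => x y z; lia.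
by rewrite card_gt0 => /set0Pn[x]; rewrite !inE => /andP[/eqP ->].
Qed.

Lemma full_top : 0 < n -> full ord0 ord_max.
Proof.
move=> n0; suff E : #|chords ord0 ord_max| = n by rewrite /full E /= eqxx.
have [/fintype.subsetP sT lt ncr cT] := trT.
have -> : chords ord0 ord_max = (ord0, ord_max) |: (T :\: polygon_sides n).
  apply/setP => -[x y]; rewrite !inE /= xpair_eqE -!val_eqE /=.
  have := ltn_ord y; have := ltn_ord x; case xyT: ((x, y) \in T) => /=.
    by have /= := lt _ xyT; rewrite -[0%R]/0%N; move: (nat_of_ord x) (nat_of_ord y) => i j; lia.
  rewrite andbF orbF => _ _; apply/esym/negP => /andP[/eqP x0 /eqP yn].
  by move/negP: xyT; apply; apply: sT; rewrite inE /= x0 yn !eqxx orbT.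
by rewrite cardsU1 !inE /= eqxx orbT cT add1n prednK.
Qed.

Local Notation node_edge k a b q c x s :=
  [/\ vertex (triangle_tree_rec T k a b) q,
      x.1 = a + lo (triangle_tree_rec T k a b) (rcons q c) :> nat,
      x.2 = a + hi (triangle_tree_rec T k a b) (rcons q c) :> nat &
      s = if c then SideR else SideL].

(** The leaves of the tree are the sides from a to b in order, so the edge of a node joins the two
    ends of its interval of leaves. The polygon has b - a - 1 triangles, whence the bound on [k]. *)
Lemma triangle_tree_rec_full k a b : full a b -> b - a <= k.+1 ->
  nb_leaves (triangle_tree_rec T k a b) = b - a /\
  forall x s, labelling T k a b x s <->
    exists q (c : bool), node_edge k a b q c x s.
Proof.
elim: k a b => [|k IH] a b fab abk.
  have /andP[ab _] := fab; split=> [|x s]; first by rewrite /nb_leaves /=; lia.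
  by split=> // -[q [c []]]; case: q.
case: (ltnP a.+1 b) => [ab1|ab1]; last first.
  have /andP[ab _] := fab; have bE : b = a.+1 :> nat by lia.
  rewrite /= apex_side //; split=> [|x s]; first by rewrite bE /nb_leaves /=; lia.
  by split=> // -[q [c []]]; case: q.
have [c [ac cb acT fac fcb]] := full_split fab ab1; have cbT := full_mem fcb.
rewrite /= (apex_unique ac cb acT cbT).
have [nl labl] := IH a c fac ltac:(lia); have [nr labr] := IH c b fcb ltac:(lia).
split=> [|x s]; first by rewrite nb_leaves_node nl nr; lia.
set l := triangle_tree_rec T k a c in nl labl *; set r := triangle_tree_rec T k c b in nr labr *.
have nlE : (nb_vertices l).+1 = c - a by [].
have nrE : (nb_vertices r).+1 = b - c by [].
split.
  case=> [[-> ->] | [-> ->] | /labl[q [e [vq h1 h2 h3]]] | /labr[q [e [vq h1 h2 h3]]]].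
  - exists [::], false; split=> //=; rewrite /hi /= ?lo_root /nb_leaves; lia.
  - exists [::], true; split=> //=; rewrite /hi /= ?lo_root /nb_leaves; lia.
  - by exists (false :: q), e.
  - by exists (true :: q), e; split=> //=; rewrite /hi /= -?/(hi r _) ?h1 ?h2 /hi /nb_leaves; lia.
case=> -[|[] q] [e [/= vq h1 h2 h3]].
- case: e h1 h2 h3; rewrite /hi /= ?lo_root /nb_leaves => h1 h2 h3.
    by apply: Or42; split=> //; case: x h1 h2 => x1 x2 /= h1 h2; congr (_, _); apply/val_inj => /=; lia.
  by apply: Or41; split=> //; case: x h1 h2 => x1 x2 /= h1 h2; congr (_, _); apply/val_inj => /=; lia.
- apply: Or44; apply/labr; exists q, e; split=> //.
    by rewrite h1 /nb_leaves; lia.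
  by rewrite h2 /hi /= /nb_leaves; lia.
- by apply: Or43; apply/labl; exists q, e.
Qed.

End TriangulationTree.

(** * The fan of a triangulation is the fan of its tree *)

Section CatalanFan.
Variables (n : nat) (T : {set 'I_n.+2 * 'I_n.+2}).
Hypotheses (n0 : 0 < n) (trT : triangulation T).
Local Notation t := (triangle_tree T).

Lemma nb_vertices_triangle_tree : nb_vertices t = n.
Proof.
have [|+ _] := @triangle_tree_rec_full n T trT n ord0 ord_max (full_top trT n0).
  by rewrite /= subn0.
by rewrite /nb_leaves /= subn0 => -[].
Qed.

Lemma F_slot x s : F T x s <-> exists q (c : bool), [/\ vertex t q,
  x.1 = lo t (rcons q c) :> nat, x.2 = hi t (rcons q c) :> nat &
  s = if c then SideR else SideL].
Proof.
have [|_] := @triangle_tree_rec_full n T trT n ord0 ord_max (full_top trT n0).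
  by rewrite /= subn0.
exact.
Qed.

(** A left edge with upper end [k] belongs to the left child, and a right edge with lower end [k] to
    the right child, of a vertex with inorder number [k]; this number determines the vertex. *)
Lemma parents_of_mid (k : 'I_n.+2) q : vertex t q -> mid t q = k ->
  left_parent T k = lo t q :> nat /\ right_parent T k = hi t q :> nat.
Proof.
move=> vq qk; have nt := nb_vertices_triangle_tree.
have lk := lo_lt_mid vq; have kh := mid_lt_hi vq.
have hn : hi t q < n.+2 by have := hi_le vq; rewrite /nb_leaves nt ltnS.
have ln : lo t q < n.+2 by rewrite (ltn_trans (ltn_trans lk kh)).
split.
- rewrite /left_parent; case: pickP => [j /andP[_ /asboolP/F_slot[q' [c [vq' /= h1 h2 h3]]]]|h].
    case: c h1 h2 h3 => //; rewrite lo_left // hi_left // -qk => -> /(mid_inj vq) -> //.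
  have := h (Ordinal ln); rewrite /= -qk lk /= => /asboolP[]; apply/F_slot.
  by exists q, false; rewrite lo_left // hi_left.
- rewrite /right_parent; case: pickP => [j /andP[_ /asboolP/F_slot[q' [c [vq' /= h1 h2 h3]]]]|h].
    case: c h1 h2 h3 => //; rewrite lo_right hi_right // -qk => /(mid_inj vq) -> //.
  have := h (Ordinal hn); rewrite /= -qk kh /= => /asboolP[]; apply/F_slot.
  by exists q, true; rewrite lo_right hi_right.
Qed.

Lemma rays_of_mid (k : 'I_n.+2) q : vertex t q -> mid t q = k ->
  w_vect T k = ray t n q false /\ v_vect T k = ray t n q true.
Proof.
move=> vq qk; have [Ll Rl] := parents_of_mid vq qk.
have lk := lo_lt_mid vq; have kh := mid_lt_hi vq.
split; apply/rowP => j; rewrite !mxE /below.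
  rewrite Ll -qk lo_left // hi_left //; case: (ltnP j (lo t q)) => h1; case: (ltnP j (mid t q)) => h2 //=.
  by move: (leq_ltn_trans h2 (ltn_trans h1 lk)); rewrite ltnn.
rewrite Rl -qk lo_right hi_right //; case: (ltnP j (mid t q)) => h1; case: (ltnP j (hi t q)) => h2 //=.
by move: (leq_ltn_trans h2 (ltn_trans h1 kh)); rewrite ltnn.
Qed.

Lemma catalan_fan_tree_fan (R : realType) : catalan_fan T (R := R) = @tree_fan R t n.
Proof.
have nt := nb_vertices_triangle_tree.
have mid_ord q : vertex t q -> exists2 k : 'I_n.+2, in_range k & mid t q = k.
  move=> vq; have := mid_bounds vq; rewrite nt => /andP[m0 mn].
  have mn2 : mid t q < n.+2 by rewrite ltnS (leq_trans mn).
  by exists (Ordinal mn2); rewrite // /in_range /= m0 ltnS.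
have ord_mid (k : 'I_n.+2) : in_range k -> exists2 q, vertex t q & mid t q = k.
  by move=> kr; apply: mid_surj; rewrite nt.
apply/funext => s; apply/propext; split.
  move=> [Q [Qv Qd ->]]; exists Q => //; split=> [v /Qv[k kr vk]|q vq].
    have [q vq qk] := ord_mid k kr; have [wE vE] := rays_of_mid vq qk.
    by case: vk => ->; [exists q, true | exists q, false].
  have [k kr qk] := mid_ord q vq; have [<- <-] := rays_of_mid vq qk.
  by rewrite andbC Qd.
move=> [Q [Qv Qd] ->]; exists Q; split=> // [v /Qv[q [b [vq ->]]]|k kr].
  have [k kr qk] := mid_ord q vq; have [wE vE] := rays_of_mid vq qk.
  by exists k => //; case: b; [left | right].
have [q vq qk] := ord_mid k kr; have [-> ->] := rays_of_mid vq qk.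
by rewrite andbC Qd.
Qed.

Lemma catalan_variety_presentable (R : realType) : presentable t (catalan_variety R T).
Proof.
rewrite /catalan_variety catalan_fan_tree_fan.
exact: toric_presentable nb_vertices_triangle_tree.
Qed.

End CatalanFan.

(** * The triangulation attached to a tree *)

Section TreeTriangulation.
Implicit Types (t : bintree) (q y : seq bool).

(** Vertices and leaves, the root being listed even if it is a leaf; they index the edges of the
    triangulation. *)
Definition nodes t : seq (seq bool) :=
  [::] :: [seq rcons q b | q <- vertices t, b <- [:: false; true]].

Lemma mem_nodes t y : reflect (y = [::] \/ exists q b, vertex t q /\ y = rcons q b) (y \in nodes t).
Proof.
rewrite inE; apply: (iffP orP) => [[/eqP ->|/allpairsP[[q b] /= [+ _ ->]]]|[->|[q [b [vq ->]]]]].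
- by left.
- by rewrite mem_vertices => vq; right; exists q, b.
- by left.
- by right; apply/allpairsP; exists (q, b); rewrite /= mem_vertices; case: (b).
Qed.

Lemma nodes_cons l r y : y \in nodes (Node l r) -> y = [::] \/
  exists (b : bool) y', y = b :: y' /\ y' \in nodes (if b then r else l).
Proof.
case/mem_nodes => [|[q [b [vq ->]]]]; [by left | right].
case: q vq => [|e q] vq /=; first by exists b, [::]; split=> //; apply/mem_nodes; left.
by exists e, (rcons q b); split=> //; apply/mem_nodes; right; exists q, b.
Qed.

Lemma hi_node t y : y \in nodes t -> hi t y <= nb_leaves t.
Proof.
case/mem_nodes => [->|[q [b [vq ->]]]]; first by rewrite hi_root.
apply: leq_trans (hi_le vq); case: b; first by rewrite hi_right.
by rewrite hi_left // ltnW // mid_lt_hi.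
Qed.

Lemma leaf_node t j : j < nb_leaves t -> exists2 y, y \in nodes t & lo t y = j /\ hi t y = j.+1.
Proof.
elim: t j => [|l IHl r IHr] j jt.
  by exists [::]; [apply/mem_nodes; left | rewrite /hi /=; case: j jt].
have lift b y : y \in nodes (if b then r else l) -> b :: y \in nodes (Node l r).
  case/mem_nodes => [->|[q [e [vq ->]]]]; apply/mem_nodes; right.
    by exists [::], b.
  by exists (b :: q), e.
case: (ltnP j (nb_leaves l)) => jl.
  have [y yl [h1 h2]] := IHl j jl; exists (false :: y); first exact: lift.
  by rewrite /hi /= -/(hi l y) h1 h2.
have [|y yr [h1 h2]] := IHr (j - nb_leaves l).
  by move: jt; rewrite nb_leaves_node; lia.
exists (true :: y); first exact: lift.
by move: h2; rewrite /hi /= h1; lia.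
Qed.

Lemma lo_cons l r (b : bool) y :
  lo (Node l r) (b :: y) = (if b then nb_leaves l else 0) + lo (if b then r else l) y.
Proof. by case: b. Qed.

Lemma hi_cons l r (b : bool) y :
  hi (Node l r) (b :: y) = (if b then nb_leaves l else 0) + hi (if b then r else l) y.
Proof. by rewrite /hi lo_cons addnA; case: b. Qed.

Lemma nodes_noncrossing t y y' : y \in nodes t -> y' \in nodes t ->
  ~~ [&& lo t y < lo t y', lo t y' < hi t y & hi t y < hi t y'].
Proof.
elim: t y y' => [|l IHl r IHr] y y' yt y't.
  move: yt y't => /mem_nodes[->|[q [b []]]]; last by case: q.
  by move=> /mem_nodes[->|[q [b []]]]; [rewrite ltnn | case: q].
have hy' := hi_node y't.
case/nodes_cons: yt => [->|[b [z [-> zt]]]].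
  by rewrite hi_root; apply/negP => /and3P[_ _]; rewrite ltnNge hy'.
case/nodes_cons: y't hy' => [->|[b' [z' [-> zt']]] _]; first by rewrite lo_root ltn0.
have hz := hi_node zt; have hz' := hi_node zt'.
case: b b' zt zt' hz hz' => [] [] zt zt' hz hz'; rewrite !lo_cons !hi_cons ?add0n.
- by rewrite !ltn_add2l; apply: IHr.
- by apply/negP => /and3P[h _ _]; have := lo_lt_hi l z'; lia.
- by apply/negP => /and3P[_ h _]; lia.
- exact: IHl.
Qed.

Variables (t : bintree) (n : nat).
Hypotheses (nt : nb_vertices t = n) (n0 : 0 < n).
Local Notation edge := ('I_n.+2 * 'I_n.+2)%type.

Definition tree_edges : {set edge} :=
  [set e : edge | has (fun y => (e.1 == lo t y :> nat) && (e.2 == hi t y :> nat)) (nodes t)].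

Lemma tree_edgesP (e : edge) : reflect
  (exists2 y, y \in nodes t & e.1 = lo t y :> nat /\ e.2 = hi t y :> nat) (e \in tree_edges).
Proof.
rewrite inE; apply: (iffP hasP) => -[y yt]; last by move=> [-> ->]; exists y; rewrite ?eqxx.
by move=> /andP[/eqP h1 /eqP h2]; exists y.
Qed.

Lemma node_edge_exists y : y \in nodes t ->
  exists e : edge, e.1 = lo t y :> nat /\ e.2 = hi t y :> nat.
Proof.
move=> yt; have h : hi t y < n.+2 by rewrite ltnS -nt; exact: hi_node.
have l : lo t y < n.+2 by apply: ltn_trans (lo_lt_hi t y) h.
by exists (Ordinal l, Ordinal h).
Qed.

Lemma width_lt q b : vertex t q -> hi t (rcons q b) - lo t (rcons q b) < n.+1.
Proof.
move=> vq; have := hi_le vq; rewrite /nb_leaves nt => hn.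
have := lo_lt_mid vq; have := mid_lt_hi vq.
by case: b; rewrite ?lo_right ?hi_right ?lo_left ?hi_left //; lia.
Qed.

Lemma tree_edges_triangulation : triangulation tree_edges.
Proof.
split.
- apply/fintype.subsetP => -[x y]; rewrite inE /= => /orP[/eqP xy|/andP[/eqP x0 /eqP yn]]; apply/tree_edgesP.
    have [|z zt [h1 h2]] := @leaf_node t x; first by rewrite /nb_leaves nt; have := ltn_ord y; lia.
    by exists z; rewrite // h1 h2 -xy.
  exists [::]; first by apply/mem_nodes; left.
  by rewrite lo_root hi_root /nb_leaves nt x0 yn.
- by move=> e /tree_edgesP[y _ [-> ->]]; exact: lo_lt_hi.
- move=> e e' /tree_edgesP[y yt [h1 h2]] /tree_edgesP[y' yt' [h1' h2']].
  by rewrite /crossing h1 h2 h1' h2'; exact: nodes_noncrossing.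
have [f fE] : exists f : seq bool -> edge, forall y, y \in nodes t ->
    (f y).1 = lo t y :> nat /\ (f y).2 = hi t y :> nat.
  have [|f fE] := @choice _ _ (fun y (e : edge) => y \in nodes t ->
    e.1 = lo t y :> nat /\ e.2 = hi t y :> nat); last by exists f.
  move=> y; case yt: (y \in nodes t); last by exists (ord0, ord0).
  by have [e eE] := node_edge_exists yt; exists e.
(* Diagonals come from the vertices other than the root: a leaf gives a side, and the root gives the
   distinguished edge. *)
pose inner := [seq q <- vertices t | q != [::]].
have inner_rcons q : q \in inner -> exists p b, q = rcons p b /\ vertex t (rcons p b).
  rewrite mem_filter mem_vertices; case/lastP: q => // p b /andP[_ v].
  by exists p, b.
have inner_node q : q \in inner -> q \in nodes t.
  by move=> /inner_rcons[p [b [-> /vertex_rcons vp]]]; apply/mem_nodes; right; exists p, b.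
have finj : {in inner &, injective f}.
  move=> q p qi pi E; have [h1 h2] := fE q (inner_node q qi); have [h1' h2'] := fE p (inner_node p pi).
  have [q' [b [qE /vertex_rcons vq']]] := inner_rcons q qi.
  have [p' [c [pE /vertex_rcons vp']]] := inner_rcons p pi.
  rewrite {}E in h1 h2; rewrite qE pE in h1 h2 h1' h2' *.
  suff [-> ->] : (q', b) = (p', c) by [].
  by apply: below_set_inj vq' vp' _ => j; rewrite /below -h1 -h2 h1' h2'.
have -> : tree_edges :\: polygon_sides n = [set e in map f inner].
  apply/setP => -[x y]; rewrite !inE; apply/andP/mapP => [[ns /hasP[z zt /andP[/eqP h1 /eqP h2]]]|[q qi E]].
    rewrite /= in h1 h2; have [g1 g2] := fE z zt; exists z.
      rewrite mem_filter mem_vertices; move: ns; rewrite h1 h2 -[0%R]/0%N.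
      case/mem_nodes: zt => [->|[q [b [vq zE]]]].
        by rewrite lo_root hi_root /nb_leaves nt !eqxx orbT.
      move=> ns; apply/andP; split; first by rewrite zE; case: (q).
      by apply: contraR ns => /hi_leaf ->; rewrite eqxx.
    by case: (f z) g1 g2 => f1 f2 /= g1 g2; congr (_, _); apply/val_inj => /=; rewrite ?g1 ?g2.
  have [h1 h2] := fE q (inner_node q qi); rewrite -E /= in h1 h2.
  have [p [b [qE vpb]]] := inner_rcons q qi.
  split; last by apply/hasP; exists q; rewrite ?inner_node // h1 h2 !eqxx.
  rewrite -[0%R]/0%N h1 h2 negb_or; apply/andP; split.
    by have := lo_lt_mid vpb; have := mid_lt_hi vpb; rewrite -qE; lia.
  by have := width_lt b (vertex_rcons vpb); rewrite -qE; lia.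
rewrite cardsE (card_uniqP _) ?size_map; last by rewrite map_inj_in_uniq ?filter_uniq ?uniq_vertices.
have c1 : count (predC (fun q => q != [::])) (vertices t) = 1.
  rewrite (@eq_count _ _ (pred1 [::])) => [|q /=]; last exact: negbK.
  rewrite count_uniq_mem ?uniq_vertices // mem_vertices.
  by case: (t) nt n0 => [<-|].
rewrite size_filter; have := count_predC (fun q => q != [::]) (vertices t).
by rewrite c1 size_vertices nt addn1 => <-.
Qed.

Lemma triangle_tree_rec_edges k q (a b : 'I_n.+2) : q \in nodes t ->
  a = lo t q :> nat -> b = hi t q :> nat -> nb_vertices (subtree t q) <= k ->
  triangle_tree_rec tree_edges k a b = subtree t q.
Proof.
elim: k q a b => [|k IH] q a b qt aE bE kq.
  by case: (subtree t q) kq.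
case: (boolP (vertex t q)) => vq; last first.
  rewrite /= apex_side ?bE ?aE ?hi_leaf //.
  by move: vq; rewrite vertexE; case: subtree.
have h : mid t q < n.+2.
  have := mid_bounds vq; rewrite nt; lia.
have node e : rcons q e \in nodes t by apply/mem_nodes; right; exists q, e.
have edge e (x y : 'I_n.+2) : x = lo t (rcons q e) :> nat -> y = hi t (rcons q e) :> nat ->
    (x, y) \in tree_edges.
  by move=> xE yE; apply/tree_edgesP; exists (rcons q e).
rewrite /= (@apex_unique _ _ tree_edges_triangulation a b (Ordinal h)) /=.
- have := vq; rewrite vertexE; case E: (subtree t q) kq => [//|l r] /= kq _.
  have sl e : subtree t (rcons q e) = if e then r else l by rewrite subtree_rcons E.
  congr Node.
    rewrite (IH (rcons q false)) ?sl ?lo_left ?hi_left //; lia.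
  by rewrite (IH (rcons q true)) ?sl ?lo_right ?hi_right //; lia.
- by rewrite aE lo_lt_mid.
- by rewrite bE mid_lt_hi.
- by apply: (edge false); rewrite ?lo_left ?hi_left.
- by apply: (edge true); rewrite ?lo_right ?hi_right.
Qed.

Lemma triangle_tree_edges : triangle_tree tree_edges = t.
Proof.
apply: (@triangle_tree_rec_edges n [::]) => //=; last by rewrite nt.
by rewrite hi_root /nb_leaves nt.
Qed.

End TreeTriangulation.

(** * Richardson varieties *)

Section VertexOrder.
Implicit Types (t : bintree) (q p : seq bool).

Lemma index_child t q b : vertex t (rcons q b) ->
  index q (vertices t) < index (rcons q b) (vertices t).
Proof.
have cons_inj (e : bool) : injective (cons e) by move=> x y [].
have disj (e : bool) x s : e :: x \in [seq ~~ e :: i | i <- s] = false.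
  by apply/negP => /mapP[y _ []]; case: e.
elim: t q => [|l IHl r IHr] //= q; case: q => [|e q] //=.
case: e => /= vq; rewrite !index_cat ?(disj true) ltnS.
  by rewrite !index_map // ltn_add2l; apply: IHr.
have vq' := vertex_rcons vq.
by rewrite !mem_map // !mem_vertices vq vq' !index_map //; apply: IHl.
Qed.

Lemma index_prefix t q p : vertex t p -> prefix q p ->
  index q (vertices t) <= index p (vertices t).
Proof.
move=> vp /prefixP[x px]; rewrite {p}px in vp *.
elim/last_ind: x vp => [|x b IH]; first by rewrite cats0.
rewrite -rcons_cat => v; apply: leq_trans (ltnW (index_child v)).
exact: IH (vertex_rcons v).
Qed.

Lemma mid_between t q p : vertex t q -> vertex t p -> lo t q < mid t p < hi t q -> prefix q p.
Proof.
move=> vq vp /andP[h1 h2]; have lp := lo_lt_mid vp; have hp := mid_lt_hi vp.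
have bq : below t (mid t p) q by rewrite /below (ltnW h1).
have bp : below t (mid t p) p by rewrite /below (ltnW lp).
case: (leqP (size q) (size p)) => [sz|sz]; first exact: (@below_nested t _ q p vq vp bq bp sz).
have /prefixP[x qE] := @below_nested t _ p q vp vq bp bq (ltnW sz).
case: x qE => [|e x] qE; first by rewrite qE cats0 ltnn in sz.
have sub j : below t j q -> below t j (rcons p e).
  by apply: below_prefix => //; rewrite qE -cat_rcons prefix_prefix.
have := sub _ bq; have := sub (mid t p).-1.
rewrite /below; case: e {sub qE}; rewrite ?lo_right ?hi_right ?lo_left ?hi_left //; lia.
Qed.

(** The left end of an interval is the inorder number of the last ancestor at which the path turns
    right; for the right end it is the last one at which the path turns left. *)
Lemma lo_breakpoint t q : vertex t q -> lo t q = 0 \/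
  exists2 p, vertex t p /\ prefix p q & (mid t p = lo t q) /\ p != q.
Proof.
elim/last_ind: q => [|q b IH] vqb; first by left; rewrite lo_root.
have vq := vertex_rcons vqb.
have ne p : prefix p q -> p != rcons q b.
  by apply: contraTneq => ->; exact: not_prefix_rcons.
case: b vqb ne => vqb ne.
  right; exists q; first by split=> //; exact: prefix_rcons.
  by rewrite lo_right; split=> //; apply: ne; exact: prefix_refl.
rewrite lo_left //; case: (IH vq) => [|[p [vp pq] [E _]]]; [by left | right].
by exists p; [split=> //; apply: prefix_trans pq (prefix_rcons _ _) | split=> //; apply: ne].
Qed.

Lemma hi_breakpoint t q : vertex t q -> hi t q = nb_leaves t \/
  exists2 p, vertex t p /\ prefix p q & (mid t p = hi t q) /\ p != q.
Proof.
elim/last_ind: q => [|q b IH] vqb; first by left; rewrite hi_root.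
have vq := vertex_rcons vqb.
have ne p : prefix p q -> p != rcons q b.
  by apply: contraTneq => ->; exact: not_prefix_rcons.
case: b vqb ne => vqb ne; last first.
  right; exists q; first by split=> //; exact: prefix_rcons.
  by rewrite hi_left //; split=> //; apply: ne; exact: prefix_refl.
rewrite hi_right //; case: (IH vq) => [|[p [vp pq] [E _]]]; [by left | right].
by exists p; [split=> //; apply: prefix_trans pq (prefix_rcons _ _) | split=> //; apply: ne].
Qed.

End VertexOrder.

(** * The permutations v and w and their rank counts *)

Section RichardsonPermutations.
Variable t : bintree.
Local Notation n := (nb_vertices t).
Implicit Types (q p : seq bool) (l k : nat).

Definition nth_vertex l : seq bool := nth [::] (vertices t) l.

Lemma vertex_nth_vertex l : l < n -> vertex t (nth_vertex l).
Proof. by move=> ln; rewrite -mem_vertices mem_nth // size_vertices. Qed.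

Lemma index_nth_vertex l : l < n -> index (nth_vertex l) (vertices t) = l.
Proof. by move=> ln; rewrite index_uniq ?size_vertices ?uniq_vertices. Qed.

Lemma nth_vertex_index q : vertex t q -> nth_vertex (index q (vertices t)) = q.
Proof. by move=> vq; rewrite /nth_vertex nth_index // mem_vertices. Qed.

Lemma index_vertex_lt q : vertex t q -> index q (vertices t) < n.
Proof. by move=> vq; rewrite -size_vertices index_mem mem_vertices. Qed.

(* The one-line notations of the permutations v and w of the Richardson variety
   attached to t, and the interpolating ones that pass from v to w by the swaps
   of the values k and k + 1. *)
Definition vnum l := if l is l'.+1 then mid t (nth_vertex l') else 0.
Definition unum k l :=
  if l == 0 then k else if vnum l <= k then (vnum l).-1 else vnum l.

Lemma vnum_bound l : l <= n -> vnum l <= n.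
Proof. by case: l => //= l /vertex_nth_vertex/mid_bounds/andP[]. Qed.

Lemma vnum_gt0 l : 0 < l <= n -> 0 < vnum l.
Proof. by case: l => //= l /vertex_nth_vertex/mid_bounds/andP[]. Qed.

Lemma vnum_inj l l' : l <= n -> l' <= n -> vnum l = vnum l' -> l = l'.
Proof.
case: l l' => [|l] [|l'] //= ln ln'.
- by have /andP[+ _] := mid_bounds (vertex_nth_vertex ln') => + E; rewrite -E.
- by have /andP[+ _] := mid_bounds (vertex_nth_vertex ln) => + E; rewrite E.
- move=> /(mid_inj (vertex_nth_vertex ln) (vertex_nth_vertex ln')) E.
  by rewrite -(index_nth_vertex ln) -(index_nth_vertex ln') E.
Qed.

Definition swap k a := if a == k then k.+1 else if a == k.+1 then k else a.

Lemma unumS k l : l <= n -> unum k.+1 l = swap k (unum k l).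
Proof.
rewrite /unum /swap; case: (posnP l) => [->|l0] ln; first by rewrite eqxx.
have := vnum_gt0 (introT andP (conj l0 ln)); move: (vnum l) => a a0.
by case: (leqP a k.+1); case: (leqP a k); do ?case: eqP; lia.
Qed.

Lemma unum0 l : l <= n -> unum 0 l = vnum l.
Proof.
by case: l => // l ln; rewrite /unum /= leqNgt (vnum_gt0 (l := l.+1)).
Qed.

Lemma unum_bound k l : k <= n -> l <= n -> unum k l <= n.
Proof.
move=> kn ln; rewrite /unum; case: ifP => // _; have := vnum_bound ln.
by case: ifP => // _; apply: leq_trans (leq_pred _).
Qed.

Lemma unum_inj k l l' : l <= n -> l' <= n -> unum k l = unum k l' -> l = l'.
Proof.
elim: k => [|k IH] ln ln'; first by rewrite !unum0 //; exact: vnum_inj.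
rewrite !unumS // => E; apply: IH => //; move: E; rewrite /swap.
by move: (unum k l) (unum k l') => a b; do 4?case: eqP; lia.
Qed.

Definition uperm_fun k (l : 'I_n.+1) : 'I_n.+1 := inord (unum (minn k n) l).

Lemma uperm_funE k (l : 'I_n.+1) : k <= n -> uperm_fun k l = unum k l :> nat.
Proof.
by move=> kn; rewrite /uperm_fun inordK (minn_idPl kn) // ltnS unum_bound // -ltnS ltn_ord.
Qed.

Lemma uperm_fun_inj k : injective (uperm_fun k).
Proof.
move=> l l' /(congr1 val) /=; have mn : minn k n <= n by rewrite geq_minr.
have ln (x : 'I_n.+1) : x <= n by rewrite -ltnS.
rewrite !inordK ?ltnS ?unum_bound // => /unum_inj E; apply/val_inj; exact: E.
Qed.

Definition uperm k : 'S_n.+1 := perm (@uperm_fun_inj k).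

Lemma upermE k (l : 'I_n.+1) : k <= n -> uperm k l = unum k l :> nat.
Proof. by move=> kn; rewrite permE uperm_funE. Qed.

Definition vperm : 'S_n.+1 := uperm 0.
Definition wperm : 'S_n.+1 := uperm n.

Lemma vpermE (l : 'I_n.+1) : vperm l = vnum l :> nat.
Proof. by rewrite upermE // unum0 // -ltnS. Qed.

Lemma wpermE (l : 'I_n.+1) : wperm l = (if l == 0 :> nat then n else (vnum l).-1) :> nat.
Proof. by rewrite upermE // /unum vnum_bound // -ltnS. Qed.

Lemma inversionsE m (s : 'S_m) :
  inversions s = #|[pred x : 'I_m * 'I_m | (x.1 < x.2) && (s x.2 < s x.1)]|.
Proof. by apply: eq_card => x; apply/asboolP/idP. Qed.

(** In [uperm k] the value k stands first and k + 1 somewhere behind it, so that exchanging them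
    creates an inversion and destroys none. *)
Lemma uperm_step k : k < n -> bruhat_step (uperm k) (uperm k.+1).
Proof.
move=> kn; have kn1 := ltnW kn; have ln (x : 'I_n.+1) : x <= n by rewrite -ltnS.
have [q vq qk] := @mid_surj t k.+1 ltac:(lia).
have ln1 := index_vertex_lt vq; pose j : 'I_n.+1 := Ordinal (ln1 : (index q (vertices t)).+1 < n.+1).
have vj : vnum j = k.+1 by rewrite /= nth_vertex_index.
have uS (x : 'I_n.+1) : uperm k.+1 x = swap k (uperm k x) :> nat by rewrite !upermE // unumS.
have u0 : uperm k ord0 = k :> nat by rewrite upermE.
have uj : uperm k j = k.+1 :> nat by rewrite upermE // /unum vj ltnn.
apply/existsP; exists ord0; apply/existsP; exists j; apply/andP; split.
  apply/eqP/permP => x; apply/val_inj; rewrite /= permM uS.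
  case: tpermP => [->|->|/eqP x0 /eqP xj].
  - by rewrite u0 uj /swap eqxx.
  - by rewrite uj u0 /swap eqxx; case: eqP => // /eqP; rewrite eqn_leq ltnn.
  - rewrite /swap; case: eqP => [E|_].
      by move: x0; rewrite -(inj_eq (@perm_inj _ (uperm k))) -val_eqE /= E u0 eqxx.
    case: eqP => [E|//].
    by move: xj; rewrite -(inj_eq (@perm_inj _ (uperm k))) -val_eqE /= E uj eqxx.
rewrite !inversionsE; apply: proper_card; apply/properP; split; last first.
  exists (ord0, j); rewrite inE /= ?uS u0 uj /swap ?eqxx.
    by case: (eqVneq k.+1 k) => [|_] /=; clear; lia.
  by rewrite ltnNge leqnSn.
apply/fintype.subsetP => -[x y]; rewrite !inE /= !uS => /andP[xy uyx]; rewrite xy /=.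
have ne : ~ (uperm k y = k :> nat /\ uperm k x = k.+1 :> nat).
  move=> [E _]; have /(@perm_inj _ (uperm k)) y0 : uperm k y = uperm k ord0.
    by apply/val_inj; rewrite /= E u0.
  by rewrite y0 ltn0 in xy.
move: uyx ne; rewrite /swap; move: (nat_of_ord (uperm k x)) (nat_of_ord (uperm k y)) => a b.
by do 4?case: eqP; lia.
Qed.

Lemma bruhat_vperm_wperm : bruhat_le vperm wperm.
Proof.
suff h k : k <= n -> bruhat_le vperm (uperm k) by exact: h.
elim: k => [|k IH] kn; first exact: connect0.
exact: connect_trans (IH (ltnW kn)) (connect1 (uperm_step kn)).
Qed.

Definition vcount l j := #|[set k : 'I_n.+1 | (k <= l) && (vperm k < j)]|.
Definition wcount l j := #|[set k : 'I_n.+1 | (k <= l) && (j <= wperm k)]|.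

(** At these columns the two rank bounds that define the Richardson variety add up to at most l + 1,
    the dimension of the space, so that both are attained. *)
Definition breakpoint l j := [\/ j = 0, j = n.+1 | exists2 k, 0 < k <= l & vnum k = j].

Lemma card_ord_le l : l <= n -> #|[set k : 'I_n.+1 | k <= l]| = l.+1.
Proof.
move=> ln; have ln1 : l.+1 <= n.+1 by [].
have -> : [set k : 'I_n.+1 | k <= l] = [set widen_ord ln1 i | i in 'I_l.+1].
  apply/setP => k; rewrite inE; apply/idP/imsetP => [kl|[i _ ->]]; last by rewrite /= -ltnS ltn_ord.
  by exists (Ordinal (kl : k < l.+1)) => //; apply/val_inj.
by rewrite card_imset ?card_ord // => i i' /(congr1 val) /= /val_inj.
Qed.

(** As w(x) = v(x) - 1 for x > 0, only position 0 can be counted twice; and a position k > 0 with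
    v(k) = j is not counted at all. *)
Lemma breakpoint_count l j : l <= n -> breakpoint l j -> vcount l j + wcount l j <= l.+1.
Proof.
move=> ln bp; set A := [set k : 'I_n.+1 | (k <= l) && (vperm k < j)].
set B := [set k : 'I_n.+1 | (k <= l) && (j <= wperm k)].
have Al : A \subset [set k : 'I_n.+1 | k <= l] by apply/fintype.subsetP => k; rewrite !inE => /andP[].
have Bl : B \subset [set k : 'I_n.+1 | k <= l] by apply/fintype.subsetP => k; rewrite !inE => /andP[].
rewrite -(card_ord_le ln) /vcount /wcount -/A -/B.
case: bp => [j0|jn|[k /andP[k0 kl] kj]].
- have -> : A = finset.set0 by apply/setP => k; rewrite !inE j0 ltn0 andbF.
  by rewrite cards0 add0n subset_leq_card.
- have -> : B = finset.set0.
    by apply/setP => k; rewrite !inE jn [n.+1 <= _]leqNgt ltn_ord andbF.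
  by rewrite cards0 addn0 subset_leq_card.
have kn : k < n.+1 by rewrite ltnS (leq_trans kl).
pose k' : 'I_n.+1 := Ordinal kn.
have AB : A :&: B \subset [set ord0].
  apply/fintype.subsetP => x; rewrite !inE => /andP[/andP[_ a] /andP[_]]; rewrite wpermE vpermE in a *.
  case: eqP => [x0 _|x0]; first by apply/eqP/val_inj.
  by move: a; move: (vnum x) => y; lia.
have AuB : A :|: B \subset [set x : 'I_n.+1 | x <= l] :\ k'.
  apply/fintype.subsetP => x; rewrite !inE wpermE vpermE -kj -val_eqE /= => xAB.
  have xl : x <= l by case/orP: xAB => /andP[].
  rewrite xl andbT; apply/eqP => xk; move: xAB; rewrite xk kl ltnn /=.
  have := vnum_gt0 (introT andP (conj k0 (leq_trans kl ln))).
  by rewrite eqn0Ngt k0 /=; move: (vnum k) => y; clear; lia.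
rewrite -cardsUI [leqRHS](cardsD1 k') inE kl /= addnC leq_add //.
  by rewrite -(cards1 (ord0 : 'I_n.+1)) subset_leq_card.
exact: subset_leq_card.
Qed.

Lemma vcount_step l a b k0 : l <= n -> a <= b -> k0 <= l ->
  (forall k, k <= l -> (a <= vnum k < b) = (k == k0)) -> vcount l b = (vcount l a).+1.
Proof.
move=> ln ab kl kE; have kn : k0 < n.+1 by rewrite ltnS (leq_trans kl).
pose k' : 'I_n.+1 := Ordinal kn.
rewrite /vcount (cardsD1 k') inE /= kl vpermE /=.
have /andP[h1 h2] : a <= vnum k0 < b by rewrite kE.
rewrite h2 add1n; congr _.+1; apply: eq_card => x; rewrite !inE vpermE -val_eqE /=.
case xl: (x <= l); rewrite ?andbF //=; have := kE x xl.
by case: eqP => //= [-> _|_]; [rewrite ltnNge h1 | move: (vnum x) => y; lia].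
Qed.

Section Birth.
Variable q : seq bool.
Hypothesis vq : vertex t q.
Local Notation l := (index q (vertices t)).+1.

Lemma birth_le : l <= n. Proof. exact: index_vertex_lt. Qed.

Lemma vnum_birth : vnum l = mid t q. Proof. by rewrite /= nth_vertex_index. Qed.

Lemma vnum_ancestor p : vertex t p -> prefix p q -> 0 < (index p (vertices t)).+1 <= l /\
  vnum (index p (vertices t)).+1 = mid t p.
Proof. by move=> vp pq; rewrite /= ltnS index_prefix // nth_vertex_index. Qed.

Lemma breakpoint_lo : breakpoint l (lo t q).
Proof.
case: (lo_breakpoint vq) => [->|[p [vp pq] [E _]]]; first by constructor 1.
have [pl pE] := vnum_ancestor vp pq.
by constructor 3; exists (index p (vertices t)).+1; rewrite // pE.
Qed.

Lemma breakpoint_mid : breakpoint l (mid t q).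
Proof. by constructor 3; exists l; rewrite ?leqnn // vnum_birth. Qed.

Lemma breakpoint_hi : breakpoint l (hi t q).
Proof.
case: (hi_breakpoint vq) => [->|[p [vp pq] [E _]]]; first by constructor 2.
have [pl pE] := vnum_ancestor vp pq.
by constructor 3; exists (index p (vertices t)).+1; rewrite // pE.
Qed.

(** A vertex whose number lies inside the interval of [q] is below [q], hence does not precede it in
    preorder. *)
Lemma vnum_inside k : k <= l -> lo t q < vnum k < hi t q -> k = l.
Proof.
case: k => [|k] kl //=; have kn : k < n by apply: leq_trans kl birth_le.
move=> h; have vk := vertex_nth_vertex kn.
have := index_prefix vk (mid_between vq vk h); rewrite index_nth_vertex // => lk.
by apply/eqP; rewrite eqn_leq kl ltnS lk.
Qed.

(** Of the values up to position l, the half-open interval from [lo] to [mid] contains only [lo],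
    which is the number of an ancestor or the value 0 at position 0. *)
Lemma vcount_left : vcount l (mid t q) = (vcount l (lo t q)).+1.
Proof.
have lm := lo_lt_mid vq; have mh := mid_lt_hi vq.
have [k0 k0l k0E] : exists2 k0, k0 <= l & vnum k0 = lo t q.
  case: (lo_breakpoint vq) => [->|[p [vp pq] [E _]]]; first by exists 0.
  by have [/andP[_ pl] pE] := vnum_ancestor vp pq; exists (index p (vertices t)).+1; rewrite // pE.
apply: (vcount_step birth_le (ltnW lm) k0l) => k kl; apply/andP/eqP => [[h1 h2]|->]; last by rewrite k0E.
apply: vnum_inj; [exact: leq_trans kl birth_le | exact: leq_trans k0l birth_le |].
apply/eqP; rewrite k0E eqn_leq h1 andbT leqNgt; apply/negP => h3.
have kE : k = l by apply: vnum_inside => //; rewrite h3 (ltn_trans h2).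
by move: h2; rewrite kE vnum_birth ltnn.
Qed.

Lemma vcount_right : vcount l (hi t q) = (vcount l (mid t q)).+1.
Proof.
have lm := lo_lt_mid vq; have mh := mid_lt_hi vq.
apply: (vcount_step birth_le (ltnW mh) (leqnn l)) => k kl; apply/andP/eqP => [[h1 h2]|->]; last by rewrite vnum_birth.
by apply: vnum_inside => //; rewrite h2 (leq_trans lm).
Qed.

End Birth.

End RichardsonPermutations.

Section PolynomialMatrices.
Local Open Scope ring_scope.
Variables (K : fieldType) (P : Type) (S : (P -> K) -> Prop).

Definition polymx m n (A : P -> 'M[K]_(m, n)) : Prop := forall i j, polyfun S (fun p => A p i j).

Lemma polymx_cst m n (A : 'M[K]_(m, n)) : polymx (fun=> A).
Proof. by move=> i j; exact: Polyfun_const. Qed.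

Lemma polymx_mul m n r (A : P -> 'M[K]_(m, n)) (B : P -> 'M[K]_(n, r)) :
  polymx A -> polymx B -> polymx (fun p => A p *m B p).
Proof.
move=> pA pB i j; have -> : (fun p => (A p *m B p) i j) = (fun p => \sum_k A p i k * B p k j).
  by apply/funext => p; rewrite mxE.
by apply: polyfun_sum => k; apply: Polyfun_mul.
Qed.

Lemma polymx_tr m n (A : P -> 'M[K]_(m, n)) : polymx A -> polymx (fun p => (A p)^T).
Proof.
move=> pA i j; have -> : (fun p => (A p)^T i j) = (fun p => A p j i) by apply/funext => p; rewrite mxE.
exact: pA.
Qed.

Lemma polyfun_det n (A : P -> 'M[K]_n) : polymx A -> polyfun S (fun p => \det (A p)).
Proof.
move=> pA; apply: polyfun_sum => s; apply: Polyfun_mul; first exact: Polyfun_const.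
by apply: polyfun_prod => i; exact: pA.
Qed.

End PolynomialMatrices.

(** * Truncations of row spaces *)

Section PidMatrices.
Local Open Scope ring_scope.
Variable K : fieldType.

Lemma mul_pid_mxE m n r (A : 'M[K]_(m, n)) i j : (pid_mx r *m A) i j = if (i < r)%N then A i j else 0.
Proof.
rewrite mxE (bigD1 i) //= mxE eqxx big1 ?addr0 => [|k ki]; last first.
  by rewrite mxE eq_sym -[_ == _ :> nat]/(k == i) (negPf ki) mul0r.
by case: ifP; rewrite ?mul1r ?mul0r.
Qed.

Lemma mulmx_pidE m n r (A : 'M[K]_(m, n)) i j : (A *m pid_mx r) i j = if (j < r)%N then A i j else 0.
Proof.
rewrite mxE (bigD1 j) //= mxE eqxx big1 ?addr0 => [|k kj]; last first.
  by rewrite mxE -[_ == _ :> nat]/(k == j) (negPf kj) mulr0.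
by case: ifP; rewrite ?mulr1 ?mulr0.
Qed.

Lemma mul_copid_mxE m n r (A : 'M[K]_(m, n)) i j : (copid_mx r *m A) i j = if (i < r)%N then 0 else A i j.
Proof.
rewrite mulmxBl mul1mx mxE [in X in _ + X]mxE mul_pid_mxE.
by case: ifP; rewrite ?subrr ?subr0.
Qed.

Lemma mulmx_copidE m n r (A : 'M[K]_(m, n)) i j : (A *m copid_mx r) i j = if (j < r)%N then 0 else A i j.
Proof.
rewrite mulmxBr mulmx1 mxE [in X in _ + X]mxE mulmx_pidE.
by case: ifP; rewrite ?subrr ?subr0.
Qed.

(** It turns a lower bound on the rank into the non-vanishing of a determinant, which is an open
    condition. *)
Lemma rank_witness m n (A : 'M[K]_(m, n)) : exists (P : 'M[K]_(\rank A, m)) (Q : 'M[K]_(n, \rank A)),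
  P *m A *m Q = 1%:M.
Proof.
exists (pinvmx (col_base A)), (pinvmx (row_base A)).
transitivity (pinvmx (col_base A) *m (col_base A *m row_base A) *m pinvmx (row_base A)).
  by rewrite mulmx_base.
by rewrite mulmxA mulVpmx ?col_base_full // mul1mx mulmxVp // row_base_free.
Qed.

Lemma sub_rank_eq m1 m2 n (A : 'M[K]_(m1, n)) (B : 'M[K]_(m2, n)) :
  (A <= B)%MS -> (\rank B <= \rank A)%N -> (B <= A)%MS.
Proof. by move=> AB rBA; have := mxrank_leqif_sup AB => /leqifP; case: (B <= A)%MS => //; rewrite ltnNge rBA. Qed.

Section Truncation.
Variables (m n : nat) (V : 'M[K]_(m, n)).
Local Notation pid j := (@pid_mx K n n j).
Local Notation copid j := (@copid_mx K n j).

(** [V] lies in the sum of its two truncations. When the bounds on their ranks add up to at most the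
    rank of [V], this sum is [V]. *)
Lemma truncation_stable j (a b : nat) : (\rank (V *m pid j) <= a)%N ->
  (\rank (V *m copid j) <= b)%N -> (a + b <= \rank V)%N ->
  (V *m pid j <= V)%MS /\ \rank (V *m pid j) = a.
Proof.
move=> ra rb ab; pose W := (V *m pid j + V *m copid j)%MS.
have VW : (V <= W)%MS.
  have -> : V = V *m pid j + V *m copid j by rewrite -mulmxDr addrC subrK mulmx1.
  exact: addmx_sub_adds.
have rW : (\rank W <= \rank (V *m pid j) + \rank (V *m copid j))%N by exact: mxrank_adds_leqif.
have rVW := mxrankS VW.
have WV : (W <= V)%MS.
  apply: sub_rank_eq VW _; apply: leq_trans rW _; apply: leq_trans ab.
  exact: leq_add.
split; first by apply: submx_trans WV; exact: addsmxSl.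
apply/eqP; rewrite eqn_leq ra /=.
have := leq_trans ab (leq_trans rVW rW) => h.
by have := leq_trans h (leq_add (leqnn _) rb); rewrite leq_add2r.
Qed.

(** The rows of [W] span the vectors of [V] supported in the columns from a to b - 1, a space whose
    dimension is the difference of the two ranks. *)
Lemma truncation_line (a b : nat) : (a <= b)%N -> (V *m pid a <= V)%MS -> (V *m pid b <= V)%MS ->
  \rank (V *m pid b) = (\rank (V *m pid a)).+1 ->
  exists f : 'rV[K]_n, [/\ f != 0, (f <= V)%MS, f *m pid b = f, f *m pid a = 0 &
    forall x : 'rV[K]_n, (x <= V)%MS -> x *m pid b = x -> x *m pid a = 0 ->
      exists c, x = c *: f].
Proof.
move=> ab Va Vb rab.
have pidab : pid b *m pid a = pid a.
  apply/matrixP => i j; rewrite mulmx_pidE !mxE.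
  case: (ltnP j a) => ja; case: (eqVneq (i : nat) j) => //= ->; first by rewrite ja (leq_trans ja ab).
  by rewrite ltnNge ja.
have pidba : pid a *m pid b = pid a.
  apply/matrixP => i j; rewrite mulmx_pidE !mxE; case: (ltnP j b) => // bj.
  by case: (eqVneq (i : nat) j) => //= ->; rewrite ltnNge (leq_trans ab bj).
have pidaa : pid a *m pid a = pid a.
  by apply/matrixP => i j; rewrite mulmx_pidE !mxE; case: (ltnP j a) => // aj;
     case: (eqVneq (i : nat) j) => //= ->; rewrite ltnNge aj.
have pidbb : pid b *m pid b = pid b.
  by apply/matrixP => i j; rewrite mulmx_pidE !mxE; case: (ltnP j b) => // bj;
     case: (eqVneq (i : nat) j) => //= ->; rewrite ltnNge bj.
pose W := V *m pid b *m copid a.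
have WE : W = V *m pid b - V *m pid a by rewrite /W mulmxBr mulmx1 -!mulmxA pidab.
have WV : (W <= V)%MS by rewrite WE addmx_sub // eqmx_opp.
have Wa : W *m pid a = 0 by rewrite WE mulmxBl -!mulmxA pidab pidaa subrr.
have Wb : W *m pid b = W by rewrite WE mulmxBl -!mulmxA pidba pidbb.
have rW : \rank W = 1%N.
  apply/eqP; rewrite eqn_leq; apply/andP; split.
    have sub : (V *m pid a + W <= V *m pid b)%MS.
      rewrite addsmx_sub; apply/andP; split.
        by rewrite -{1}pidba mulmxA submxMr.
      by rewrite -Wb submxMr.
    have cap0 : (V *m pid a :&: W)%MS = 0.
      apply/eqP; rewrite -submx0; apply/rV_subP => x; rewrite sub_capmx => /andP[/submxP[y ->] xW].
      have E : y *m (V *m pid a) *m pid a = y *m (V *m pid a) by rewrite -!mulmxA pidaa.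
      by have /submxP[y' y'E] := xW; rewrite -E {1}y'E -mulmxA Wa mulmx0 sub0mx.
    have := mxrankS sub; rewrite mxrank_disjoint_sum // rab.
    by rewrite -addn1 leq_add2l.
  have VbE : (V *m pid b <= V *m pid a + W)%MS.
    have -> : V *m pid b = V *m pid a + W by rewrite WE addrC subrK.
    exact: addmx_sub_adds.
  have := leq_trans (mxrankS VbE) (leq_of_leqif (mxrank_adds_leqif _ _)).
  by rewrite rab -addn1 leq_add2l.
have /rowV0Pn[f fW f0] : W != 0 by rewrite -mxrank_eq0 rW.
have Wf : (W <= f)%MS by apply: sub_rank_eq fW _; rewrite rW lt0n mxrank_eq0.
exists f; split=> //.
- exact: submx_trans WV.
- by have /submxP[y ->] := fW; rewrite -mulmxA Wb.
- by have /submxP[y ->] := fW; rewrite -mulmxA Wa mulmx0.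
- move=> x xV xb xa; have xW : (x <= W)%MS.
    have -> : x = x *m pid b *m copid a by rewrite xb mulmxBr mulmx1 xa subr0.
    by rewrite submxMr // submxMr.
  have /submxP[y ->] := submx_trans xW Wf.
  by exists (y 0 0); rewrite [y]mx11_scalar mul_scalar_mx mxE eqxx mulr1n.
Qed.

End Truncation.

End PidMatrices.

(** * Flags as chains of row spaces *)

Section Flags.
Local Open Scope ring_scope.
Variables (R : realType) (m : nat).
Local Notation C := R[i].
Local Notation mat := 'M[C]_m.+1.
Local Notation flags := (flag_variety R m).
Local Notation pid j := (@pid_mx C m.+1 m.+1 j).
Local Notation copid j := (@copid_mx C m.+1 j).
Implicit Types (g h b : mat) (x y : flags).

(* Its row space consists of the transposes of the vectors of the (l+1)-dimensional
   space of the flag of g. *)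
Definition span l g : mat := pid l.+1 *m g^T.

Lemma borel_pid b j : borel b -> pid j *m b^T = pid j *m b^T *m pid j.
Proof.
move=> [_ bu]; apply/matrixP => i k; rewrite mulmx_pidE mul_pid_mxE mxE.
by case: (ltnP i j) => // ij; case: (ltnP k j) => // jk; rewrite ?if_same // bu // (leq_trans ij jk).
Qed.

Lemma borel_copid b j : borel b -> b^T *m copid j = copid j *m b^T *m copid j.
Proof.
move=> [_ bu]; apply/matrixP => i k; rewrite !mulmx_copidE mul_copid_mxE mxE.
by case: (ltnP k j) => // jk; case: (ltnP i j) => // ij; rewrite bu // (leq_trans ij jk).
Qed.

Lemma span_mul l g b : borel b -> span l (g *m b) = pid l.+1 *m b^T *m span l g.
Proof. by move=> bb; rewrite /span trmx_mul mulmxA [in LHS](borel_pid _ bb) !mulmxA. Qed.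

(** Column j of g^-1 h vanishes below the diagonal exactly when column j of h is a combination of
    the first j + 1 columns of g. *)
Lemma coset_spanP g h : g \in unitmx ->
  coset g h <-> h \in unitmx /\ forall l, (span l h <= span l g)%MS.
Proof.
move=> gu; split=> [[b bb ->] | [hu hg]].
  by split=> [|l]; [rewrite unitmx_mul gu bb.1 | rewrite span_mul // submxMl].
exists (invmx g *m h); last by rewrite mulKVmx.
split; first by rewrite unitmx_mul unitmx_inv gu.
move=> i j ji; have /submxP[D DE] := hg j.
have := congr1 (fun M => (M *m invmx g^T) j i) DE.
rewrite /span -!mulmxA mulmxV ?unitmx_tr // mulmx1 mulmx_pidE ltnNge ji /=.
by rewrite mul_pid_mxE ltnSn -trmx_inv -trmx_mul mxE.
Qed.

Lemma coset_unit g h : g \in unitmx -> coset g h -> h \in unitmx.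
Proof. by move=> gu /(coset_spanP _ gu)[]. Qed.

Lemma rank_span l g : (l <= m)%N -> g \in unitmx -> \rank (span l g) = l.+1.
Proof.
move=> lm gu; rewrite mxrankMfree ?row_free_unit ?unitmx_tr // rank_pid_mx //.
Qed.

Lemma span_full l g : (m <= l)%N -> span l g = g^T.
Proof.
by move=> ml; apply/matrixP => i j; rewrite mul_pid_mxE ltnS (leq_trans _ ml) // -ltnS.
Qed.

Lemma coset_span_eq g h l : g \in unitmx -> coset g h -> (span l h :=: span l g)%MS.
Proof.
move=> gu /(coset_spanP _ gu)[hu hg]; apply/eqmxP; rewrite hg /=.
case: (leqP l m) => [lm|ml]; first by apply: sub_rank_eq (hg l) _; rewrite !rank_span.
by apply: submx_full; rewrite span_full ?(ltnW ml) // row_full_unit unitmx_tr.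
Qed.

Lemma coset_sym g h : g \in unitmx -> coset g h -> coset h g.
Proof.
move=> gu gh; apply/(coset_spanP _ (coset_unit gu gh)); split=> // l.
by rewrite (coset_span_eq l gu gh).
Qed.

Lemma coset_eq g h : g \in unitmx -> coset g h -> coset g = coset h.
Proof.
move=> gu gh; have hu := coset_unit gu gh; apply/funext => k; apply/propext.
split=> [/(coset_spanP _ gu)|/(coset_spanP _ hu)] [ku kl]; apply/coset_spanP => //; split=> // l.
  by rewrite (coset_span_eq l gu gh).
by rewrite -(coset_span_eq l gu gh).
Qed.

Lemma coset_refl g : coset g g.
Proof.
exists 1%:M; last by rewrite mulmx1.
by split=> [|i j ji]; rewrite ?unitmx1 // mxE -val_eqE gtn_eqF.
Qed.

Lemma flag_eq x y : sval x = sval y -> x = y.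
Proof.
case: x y => [x xp] [y yp] /= E; case: y / E yp => yp.
by rewrite (Prop_irrelevance xp yp).
Qed.

Lemma flag_rep x : exists g : GL R m, x = flag_proj g.
Proof. by have [g gE] := svalP x; exists g; apply: flag_eq. Qed.

Lemma flag_mem x h : sval x h -> exists2 g : GL R m, sval g = h & x = flag_proj g.
Proof.
have [g ->] := flag_rep x => /= gh; exists (exist _ h (coset_unit (svalP g) gh)) => //.
exact/flag_eq/coset_eq/gh/(svalP g).
Qed.

Lemma flag_projP (g g' : GL R m) :
  flag_proj g = flag_proj g' <-> coset (sval g) (sval g').
Proof.
split=> [/(congr1 sval) /= ->|gg']; first exact: coset_refl.
exact/flag_eq/coset_eq/gg'/(svalP g).
Qed.

Lemma polymx_span l : polymx (fun f => exists i j, forall g : GL R m, f g = sval g i j)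
  (fun g : GL R m => span l (sval g)).
Proof.
apply: polymx_mul; first exact: polymx_cst.
by apply: polymx_tr => i j; apply: Polyfun_coord; exists i, j.
Qed.

Lemma closed_span_rank l r (D : mat) (A : flags -> Prop) x g :
  (forall y h, A y -> sval y h -> (\rank (span l h *m D) <= r)%N) ->
  closure_in A x -> sval x g -> (\rank (span l g *m D) <= r)%N.
Proof.
move=> Ar clx xg; rewrite leqNgt; apply/negP => rg.
pose U : flags -> Prop := fun y => exists2 h, sval y h & (r < \rank (span l h *m D))%N.
have UE (h : GL R m) : U (flag_proj h) <-> (r < \rank (span l (sval h) *m D))%N.
  split=> [[k /= hk]|rh]; last by exists (sval h) => //; exact: coset_refl.
  by rewrite (eqmxMr _ (coset_span_eq l (svalP h) hk)).
have oU : is_open U.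
  move=> _ h /UE; move: (svalP h) => hu rh.
  have [P [Q PQ]] := rank_witness (span l (sval h) *m D).
  exists (fun k : GL R m => \det (P *m (span l (sval k) *m D) *m Q)); split.
  - apply: polyfun_det; apply: polymx_mul; last exact: polymx_cst.
    apply: polymx_mul; first exact: polymx_cst.
    by apply: polymx_mul; [exact: polymx_span | exact: polymx_cst].
  - by rewrite PQ det1 oner_neq0.
  - move=> k; rewrite -unitfE -/(_ \in unitmx) => ku; apply/UE; apply: leq_trans rh _.
    rewrite -(mxrank_unit ku).
    by apply: leq_trans (mxrankM_maxl _ _) _; exact: mxrankM_maxr.
have [y [h yh rh] Ay] := clx U oU (ex_intro2 _ _ g xg rg).
by have := Ar y h Ay yh; rewrite leqNgt rh.
Qed.

End Flags.

Lemma rank_le_rows (K : fieldType) m n (A : 'M[K]_(m, n)) (S : {set 'I_m}) :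
  (forall i, i \notin S -> row i A = 0%R) -> \rank A <= #|S|.
Proof.
move=> A0; have sub : (A <= \sum_(i in S) <<row i A>>)%MS.
  apply/row_subP => i; case: (boolP (i \in S)) => [iS|/A0 ->]; last exact: sub0mx.
  by apply: submx_trans (sumsmx_sup i iS (submx_refl _)); rewrite genmxE.
apply: leq_trans (mxrankS sub) _; apply: leq_trans (leq_of_leqif (mxrank_sum_leqif _)) _.
rewrite -sum1_card; apply: leq_sum => i _; rewrite /= genmxE; exact: rank_leq_row.
Qed.

(** * Rank conditions on Schubert varieties *)

Section SchubertRanks.
Local Open Scope ring_scope.
Variables (R : realType) (m : nat).
Local Notation C := R[i].
Local Notation mat := 'M[C]_m.+1.
Local Notation flags := (flag_variety R m).
Local Notation pid j := (@pid_mx C m.+1 m.+1 j).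
Local Notation copid j := (@copid_mx C m.+1 j).
Implicit Types (g h b : mat) (x y : flags) (v w : 'S_m.+1).

Lemma schubert_rank w x h l j : schubert w x -> sval x h ->
  (\rank (span l h *m copid j) <= #|[set k : 'I_m.+1 | (k <= l) && (j <= w k)]|)%N.
Proof.
apply: closed_span_rank => _ {}h [b [g [bb gE ->]]] [b' bb' ->].
rewrite span_mul // gE -(mulmxA _ (span l _)); apply: leq_trans (mxrankM_maxr _ _) _.
rewrite /span trmx_mul -!mulmxA borel_copid // !mulmxA.
apply: leq_trans (mxrankM_maxl _ _) _; apply: leq_trans (mxrankM_maxl _ _) _.
apply: rank_le_rows => k; rewrite inE negb_and => kl; apply/rowP => i.
rewrite [LHS]mxE [RHS]mxE mulmx_copidE mul_pid_mxE !mxE ltnS; case: (ltnP i j) => // ji.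
case: leqP => // kl'; case: eqP => // iE; move: kl; rewrite kl' -iE.
by rewrite ji.
Qed.

Lemma wmat_longest_tr : (wmat R (longest m.+1))^T = wmat R (longest m.+1).
Proof. by apply/matrixP => i j; rewrite !mxE !permE -(inj_eq rev_ord_inj) rev_ordK eq_sym. Qed.

Lemma wmat_longestE n (A : 'M[C]_(n, m.+1)) i j : (A *m wmat R (longest m.+1)) i j = A i (rev_ord j).
Proof.
rewrite mxE (bigD1 (rev_ord j)) //= big1 ?addr0 => [|k kj]; first by rewrite mxE permE eqxx mulr1.
by rewrite mxE permE (negPf kj) mulr0.
Qed.

Lemma wmat_longest_mulE n (A : 'M[C]_(m.+1, n)) i j : (wmat R (longest m.+1) *m A) i j = A (rev_ord i) j.
Proof. by rewrite -[_ *m A]trmxK trmx_mul wmat_longest_tr mxE wmat_longestE mxE. Qed.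

(** Translation by w_0 reverses the coordinates and so exchanges initial and final truncations. *)
Lemma opposite_schubert_rank v x y h l j : (j <= m.+1)%N ->
  schubert (v * longest m.+1)%g y -> translate (wmat R (longest m.+1)) y x -> sval x h ->
  (\rank (span l h *m pid j) <= #|[set k : 'I_m.+1 | (k <= l) && (v k < j)]|)%N.
Proof.
move=> jm sy yx /yx[h' yh' ->]; have E : span l (wmat R (longest m.+1) *m h') *m pid j =
    span l h' *m copid (m.+1 - j) *m wmat R (longest m.+1).
  rewrite /span trmx_mul wmat_longest_tr mulmxA.
  apply/matrixP => i k; rewrite mulmx_pidE !wmat_longestE mulmx_copidE /=.
  have -> : (m.+1 - k.+1 < m.+1 - j)%N = ~~ (k < j)%N.
    by have := ltn_ord k; move: (nat_of_ord k) jm => k'; lia.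
  by case: ltnP.
rewrite E; apply: leq_trans (mxrankM_maxl _ _) _.
apply: leq_trans (schubert_rank _ _ sy yh') _; apply: subset_leq_card; apply/fintype.subsetP => k.
rewrite !inE permM permE /= => /andP[-> /=]; by have := ltn_ord (v k); move: (nat_of_ord (v k)) jm => k'; lia.
Qed.

Lemma wmat_unit w : wmat R w *m (wmat R w)^T = 1%:M.
Proof.
apply/matrixP => i j; rewrite mxE (bigD1 ((w^-1)%g i)) //= big1 ?addr0 => [|k kj].
  by rewrite !mxE permKV eqxx mul1r eq_sym.
by rewrite !mxE; case: eqP => [iE|]; rewrite ?mul0r //; move: kj; rewrite iE permK eqxx.
Qed.

Lemma schubert_cell w (g : GL R m) : (forall i k : 'I_m.+1, (w k < i)%N -> sval g i k = 0) ->
  exists2 b, borel b & sval g = b *m wmat R w.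
Proof.
move=> g0; have := mulmx1C (wmat_unit w) => ww.
exists (sval g *m (wmat R w)^T); last by rewrite -mulmxA ww mulmx1.
split.
  by rewrite unitmx_mul (svalP g) unitmx_tr; have [] := mulmx1_unit (wmat_unit w).
move=> i j ji; rewrite mxE big1 // => k _; rewrite !mxE; case: eqP => [jE|]; last by rewrite mulr0.
by rewrite g0 ?mul0r // -jE.
Qed.

Lemma wmat_longestK : wmat R (longest m.+1) *m wmat R (longest m.+1) = 1%:M.
Proof. by rewrite -{2}wmat_longest_tr wmat_unit. Qed.

End SchubertRanks.

(** * The flag of a point of the Cox space *)

Section TreeMatrices.
Local Open Scope ring_scope.
Variables (R : realType) (t : bintree).
Local Notation C := R[i].
Local Notation n := (nb_vertices t).
Local Notation mat := 'M[C]_n.+1.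
Local Notation pid j := (@pid_mx C n.+1 n.+1 j).
Implicit Types (d : seq bool -> bool) (z : cox C t).

Definition is_slot y : Prop := y = [::] \/ exists q b, vertex t q /\ y = rcons q b.

Lemma is_slot_vertex y : vertex t y -> is_slot y.
Proof. by case/lastP: y => [|q b] vy; [left | right; exists q, b; split=> //; exact: vertex_rcons vy]. Qed.

(* The least index of a space of the flag that contains the vector attached to y. *)
Definition birth y : nat := if y is [::] then 0 else (index (take (size y).-1 y) (vertices t)).+1.

Lemma birth_rcons q b : birth (rcons q b) = (index q (vertices t)).+1.
Proof. by rewrite /birth size_rcons /= -cats1 take_size_cat //; case: q. Qed.

Lemma birth_index y : vertex t y -> (birth y <= index y (vertices t))%N.
Proof. by case/lastP: y => [|q b] // vy; rewrite birth_rcons index_child. Qed.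

(** On the chart [d] one child per vertex is enough: the vector of the child on the side [d q] is a
    combination of those of [q] and of the other child, with division by [z q (d q)]. *)
Definition slot d l : seq bool :=
  if l is l'.+1 then rcons (nth_vertex t l') (~~ d (nth_vertex t l')) else [::].

Lemma is_slot_slot d l : (l <= n)%N -> is_slot (slot d l).
Proof.
case: l => [|l] ln; [by left | right].
by exists (nth_vertex t l), (~~ d (nth_vertex t l)); rewrite vertex_nth_vertex.
Qed.

Lemma birth_slot d l : (l <= n)%N -> birth (slot d l) = l.
Proof. by case: l => // l ln; rewrite birth_rcons index_nth_vertex. Qed.

Lemma slot_index d q : vertex t q -> slot d (index q (vertices t)).+1 = rcons q (~~ d q).
Proof. by move=> vq; rewrite /= nth_vertex_index. Qed.

Lemma below_slot_bound j y : is_slot y -> below t j y -> (j < n.+1)%N.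
Proof.
case=> [->|[q [b [vq ->]]]]; first by rewrite below_root.
by rewrite below_child // => /andP[/(below_bound (erefl n) vq)].
Qed.

Lemma slot_target_bound d l : (l <= n)%N -> (target t d (slot d l) < n.+1)%N.
Proof. by move=> ln; apply: below_slot_bound (is_slot_slot d ln) (below_target _ _ _). Qed.

(** In preorder an earlier slot hangs on a node that is not below [q]. Its path can end below [q]
    only by coming from above through [q], and then it continues to the target of [q]. *)
Lemma slot_target_below d q k : vertex t q -> (k <= index q (vertices t))%N ->
  below t (target t d (slot d k)) q -> target t d (slot d k) = target t d q.
Proof.
move=> vq kq bq; case: k kq bq => [|k] kq bq; first exact: target_on_path (prefix0s _) bq.
have kn : (k < n)%N by exact: ltn_trans kq (index_vertex_lt vq).
rewrite /= in bq *; set p := nth_vertex t k in bq *; have vp : vertex t p by exact: vertex_nth_vertex.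
have bp := below_target_child d (~~ d p) vp.
case: (leqP (size q) (size p)) => [sz|sz].
  have := index_prefix vp (below_nested vq vp bq bp sz).
  by rewrite index_nth_vertex // leqNgt kq.
have /prefixP[[|e x] qE] := below_nested vp vq bp bq (ltnW sz).
  by rewrite qE cats0 ltnn in sz.
have pq : prefix (rcons p e) q by rewrite qE -cat_rcons prefix_prefix.
have := below_prefix vq pq bq; rewrite below_child // => /andP[_ /eqP eE].
have := below_target t d (rcons p (~~ d p)); rewrite below_child // => /andP[_ /eqP E].
by apply: target_on_path => //; rewrite E -eE.
Qed.

Lemma slot_target_triangular d j k : (j < k <= n)%N -> ~~ below t (target t d (slot d j)) (slot d k).
Proof.
case: k => // k /andP[jk kn]; have vq : vertex t (nth_vertex t k) by exact: vertex_nth_vertex.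
rewrite /= below_child //; apply/negP => /andP[bq].
rewrite (slot_target_below vq _ bq) ?index_nth_vertex // toward_target //.
by case: (d _).
Qed.

Definition leaf_vect (z : seq bool -> bool -> C) y : 'rV[C]_n.+1 := \row_j leaf_coord t z y j.

Definition tree_mx d z : mat := \matrix_(i, k) leaf_coord t (sval z) (slot d k) i.

(* Selects the rows numbered by the targets of the slots: those of [tree_mx]
   form a lower triangular matrix, with non-zero diagonal on the chart d. *)
Definition pivot d : mat := \matrix_(i, j) (j == target t d (slot d i) :> nat)%:R.

Lemma pivotE d (u : 'rV[C]_n.+1) (k j : 'I_n.+1) : target t d (slot d k) = j :> nat ->
  (u *m (pivot d)^T) 0 k = u 0 j.
Proof.
move=> E; rewrite mxE (bigD1 j) //= !mxE E eqxx mulr1 big1 ?addr0 // => i ij.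
by rewrite !mxE E -[_ == _ :> nat]/(i == j) (negPf ij) mulr0.
Qed.

Lemma leaf_vect_pivot d (z : seq bool -> bool -> C) y (k : 'I_n.+1) :
  (leaf_vect z y *m (pivot d)^T) 0 k = leaf_coord t z y (target t d (slot d k)).
Proof.
have kn : (k <= n)%N by rewrite -ltnS.
by rewrite (@pivotE d _ k (Ordinal (slot_target_bound d kn))) ?mxE.
Qed.

Lemma row_tree_mx d z k : row k (tree_mx d z)^T = leaf_vect (sval z) (slot d k).
Proof. by apply/rowP => j; rewrite !mxE. Qed.

Lemma tree_mx_pivotE d z (k i : 'I_n.+1) :
  ((tree_mx d z)^T *m (pivot d)^T) k i = leaf_coord t (sval z) (slot d k) (target t d (slot d i)).
Proof. by rewrite -leaf_vect_pivot -row_tree_mx -row_mul [RHS]mxE. Qed.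

Lemma tree_mx_pivot_triangular d z (k i : 'I_n.+1) : (i < k)%N ->
  ((tree_mx d z)^T *m (pivot d)^T) k i = 0.
Proof.
move=> ik; have kn : (k <= n)%N by rewrite -ltnS.
by rewrite tree_mx_pivotE /leaf_coord (negPf (slot_target_triangular d _)) // ik.
Qed.

Lemma tree_mx_pivot_diag d z (k : 'I_n.+1) : in_chart d z ->
  ((tree_mx d z)^T *m (pivot d)^T) k k != 0.
Proof.
move=> dz; rewrite tree_mx_pivotE /leaf_coord below_target walk_toward_target.
exact: walk_chart_neq0.
Qed.

Lemma det_upper (A : mat) : (forall k i : 'I_n.+1, (i < k)%N -> A k i = 0) ->
  \det A = \prod_i A i i.
Proof.
move=> A0; rewrite -det_tr det_trig; first by apply: eq_bigr => i _; rewrite mxE.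
by apply/is_trig_mxP => i j ij; rewrite mxE A0.
Qed.

Lemma tree_mx_unit d z : in_chart d z -> tree_mx d z \in unitmx.
Proof.
move=> dz; have : \det ((tree_mx d z)^T *m (pivot d)^T) != 0.
  rewrite det_upper; last exact: tree_mx_pivot_triangular.
  by apply/prodf_neq0 => i _; exact: tree_mx_pivot_diag.
by rewrite det_mulmx det_tr mulf_eq0 negb_or unitmxE unitfE => /andP[].
Qed.

Lemma span_le l l' (g : mat) : (l <= l')%N -> (span l g <= span l' g)%MS.
Proof.
move=> ll; have -> : span l g = pid l.+1 *m span l' g by
  apply/matrixP => i j; rewrite !mul_pid_mxE !ltnS; case: leqP => // il; rewrite (leq_trans il ll).
exact: submxMl.
Qed.

Lemma row_span (k : 'I_n.+1) l (g : mat) : (k <= l)%N -> (row k g^T <= span l g)%MS.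
Proof.
move=> kl; have -> : row k g^T = row k (span l g); last exact: row_sub.
by apply/rowP => j; rewrite [LHS]mxE [RHS]mxE mul_pid_mxE ltnS kl.
Qed.

Lemma leaf_vect_vertex (z : seq bool -> bool -> C) q : vertex t q ->
  leaf_vect z q = z q false *: leaf_vect z (rcons q false) + z q true *: leaf_vect z (rcons q true).
Proof. by move=> vq; apply/rowP => j; rewrite !mxE leaf_coord_vertex. Qed.

Lemma slot_span d z l : (l <= n)%N -> (leaf_vect (sval z) (slot d l) <= span l (tree_mx d z))%MS.
Proof.
move=> ln; have ln1 : (l < n.+1)%N by [].
by rewrite -[l in slot d l]/(nat_of_ord (Ordinal ln1)) -row_tree_mx row_span.
Qed.

Lemma leaf_vect_span d z y : in_chart d z -> is_slot y ->
  (leaf_vect (sval z) y <= span (birth y) (tree_mx d z))%MS.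
Proof.
move=> dz; elim/last_ind: y => [|q b IH] sy; first exact: (slot_span d z (leq0n n)).
case: sy => [|[q' [b' [vq /rcons_inj[E _]]]]]; first by case: (q).
rewrite -{q'}E in vq; rewrite birth_rcons; have ql := index_vertex_lt vq.
have hc : (leaf_vect (sval z) (rcons q (~~ d q)) <= span (index q (vertices t)).+1 (tree_mx d z))%MS.
  by have := slot_span d z ql; rewrite slot_index.
case: (eqVneq b (~~ d q)) => [->//|bd]; have {bd} -> : b = d q by case: (b) (d q) bd => [] [].
have hq : (leaf_vect (sval z) q <= span (index q (vertices t)).+1 (tree_mx d z))%MS.
  by apply: submx_trans (IH (is_slot_vertex vq)) (span_le _ _); apply: leqW (birth_index vq).
have -> : leaf_vect (sval z) (rcons q (d q)) = (sval z q (d q))^-1 *: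
    (leaf_vect (sval z) q - sval z q (~~ d q) *: leaf_vect (sval z) (rcons q (~~ d q))).
  rewrite (leaf_vect_vertex _ vq); have := dz q vq; case: (d q) => /= zd.
    by rewrite addrAC subrr add0r scalerA mulVf ?scale1r.
  by rewrite addrK scalerA mulVf ?scale1r.
by rewrite scalemx_sub // addmx_sub // -scaleNr scalemx_sub.
Qed.

Lemma tree_mx_coset d d' z : in_chart d z -> in_chart d' z -> coset (tree_mx d z) (tree_mx d' z).
Proof.
move=> dz dz'; apply/(coset_spanP _ (tree_mx_unit dz)); split=> [|l]; first exact: tree_mx_unit.
apply/row_subP => k; have -> : row k (span l (tree_mx d' z)) =
    if (k <= l)%N then leaf_vect (sval z) (slot d' k) else 0.
  by apply/rowP => j; rewrite [LHS]mxE mul_pid_mxE ltnS; case: leqP; rewrite !mxE.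
case: leqP => kl; last exact: sub0mx.
have kn : (k <= n)%N by rewrite -ltnS.
apply: submx_trans (leaf_vect_span dz (is_slot_slot d' kn)) _.
by rewrite span_le // birth_slot.
Qed.

End TreeMatrices.

Section TreeFlags.
Local Open Scope ring_scope.
Variables (R : realType) (t : bintree).
Local Notation C := R[i].
Local Notation n := (nb_vertices t).
Local Notation mat := 'M[C]_n.+1.
Local Notation flags := (flag_variety R n).
Implicit Types (d : seq bool -> bool) (z : cox C t) (a g h : mat).

Lemma translateP m (a g : 'M[C]_m.+1) (x y : flag_variety R m) : sval x = coset g ->
  translate a x y <-> sval y = coset (a *m g).
Proof.
move=> xg; rewrite /translate xg; have E (h : 'M_m.+1) : (exists2 h', coset g h' & h = a *m h') <-> coset (a *m g) h.
  split=> [[_ [b bb ->] ->]|[b bb ->]]; first by exists b; rewrite ?mulmxA.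
  by exists (g *m b); [exists b | rewrite mulmxA].
split=> [xy|-> h]; last exact: iff_sym.
by apply/funext => h; apply/propext; apply: iff_trans (xy h) (E h).
Qed.

Lemma coset_mull m (a g h : 'M[C]_m.+1) : coset g h -> coset (a *m g) (a *m h).
Proof. by move=> [b bb ->]; exists b; rewrite ?mulmxA. Qed.

Section Translated.
Variables (a : mat) (au : a \in unitmx).

(** [a] will be the identity or the matrix of w_0, as the opposite Schubert variety is a translate.
    The value 1 off the chart makes the map total. *)
Definition chart_gl d z : GL R n :=
  if pselect (in_chart d z) is left dz
  then exist _ (a *m tree_mx d z) (etrans (unitmx_mul _ _) (introT andP (conj au (tree_mx_unit dz))))
  else exist _ 1%:M (unitmx1 _ _).

Lemma chart_glE d z : in_chart d z -> sval (chart_gl d z) = a *m tree_mx d z.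
Proof. by move=> dz; rewrite /chart_gl; case: pselect => [?|/(_ dz)]. Qed.

Definition translated_flag z : flags := flag_proj (chart_gl (sval (cid (chart_exists z))) z).

Lemma translated_flagE d z : in_chart d z -> translated_flag z = flag_proj (chart_gl d z).
Proof.
move=> dz; have dz' := svalP (cid (chart_exists z)); apply/flag_projP.
by rewrite !chart_glE //; apply: coset_mull; apply: tree_mx_coset.
Qed.

Lemma regular_chart_gl d (c : GL R n -> C) : (exists i j, forall g : GL R n, c g = sval g i j) ->
  regular (in_chart d) (fun z => c (chart_gl d z)).
Proof.
move=> [i [j cE]]; apply: (@regular_eq _ _ _ _ (fun z => \sum_k a i k * leaf_coord t (sval z) (slot t d j) k)).
  by move=> z dz; rewrite cE chart_glE // mxE; apply: eq_bigr => k _; rewrite mxE.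
apply: regular_poly; apply: polyfun_sum => k; apply: Polyfun_mul; first exact: Polyfun_const.
rewrite /leaf_coord; case: below; [exact: polyfun_walk | exact: Polyfun_const].
Qed.

Lemma translated_flag_morphism : morphism_of_spaces translated_flag.
Proof.
move=> V oV; have E d z : in_chart d z -> V (translated_flag z) <-> V (flag_proj (chart_gl d z)).
  by move=> dz; rewrite (translated_flagE dz).
have oV' : is_open (fun g : GL R n => V (flag_proj g)) by exact: (oV tt).
split=> [|f rf].
  apply: zariski_open_local => z Vz; have [d dz] := chart_exists z.
  exists (fun w => in_chart d w /\ V (flag_proj (chart_gl d w))); split.
  - exact: (local_preimage_open (@regular_chart_gl d) (@open_in_chart _ t d) oV').
  - by split=> //; apply/E.
  - by move=> w [dw]; apply: (E d w dw).2.
apply: regular_local => z Vz; have [d dz] := chart_exists z; exists (in_chart d); split=> //.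
  exact: open_in_chart.
apply: (@regular_eq _ _ _ _ (fun w => f (flag_proj (chart_gl d w)))).
  by move=> w [_ dw]; rewrite (translated_flagE dw).
apply: regularS (local_pullback_regular (@regular_chart_gl d) (@open_in_chart _ t d) (rf tt)) => w [Vw dw].
by split=> //; apply: (E d w dw).1.
Qed.

(** Schubert varieties are closures, so it suffices to treat points without vanishing coordinates,
    which lie in every chart. *)
Lemma closure_translated_flag (A : flags -> Prop) z :
  (forall w, (forall q b, vertex t q -> sval w q b != 0) -> A (translated_flag w)) ->
  closure_in A (translated_flag z).
Proof.
move=> hA U oU Uz; have [|z1 z1E] := @cox_point C t (fun _ _ => 1).
  by move=> q _; left; exact: oner_neq0.
have [|c [w [c0 zw Uw]]] := orbit_closure (z := z1) _ (translated_flag_morphism oU).1 Uz.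
  by move=> q b _; rewrite z1E => /eqP; rewrite oner_eq0.
by exists (translated_flag w) => //; apply: hA => q b vq; rewrite zw // z1E mulr1.
Qed.

End Translated.

Definition tree_flag := translated_flag (unitmx1 C n.+1).

Lemma tree_flagE d z : in_chart d z -> sval (tree_flag z) = coset (tree_mx d z).
Proof. by move=> dz; rewrite /tree_flag (translated_flagE _ dz) /= chart_glE // mul1mx. Qed.

Lemma wmat_longest_unit : wmat R (longest n.+1) \in unitmx.
Proof. by have [] := mulmx1_unit (wmat_longestK R n). Qed.

(** Apart from the root, the slots of [xpredT] are left children, whose last leaf is [mid] minus 1.
    Those of [xpred0] are right children, whose first leaf is [mid]. *)
Lemma not_below_wperm i (k : 'I_n.+1) : (wperm t k < i)%N -> ~~ below t i (slot t xpredT k).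
Proof.
rewrite wpermE /below; case: k => -[|k] /= kn; first by rewrite hi_root /nb_leaves; lia.
have vk : vertex t (nth_vertex t k) by exact: vertex_nth_vertex.
by rewrite lo_left // hi_left //; have := lo_lt_mid vk; move: (mid _ _) (lo _ _) => u l; lia.
Qed.

Lemma not_below_vperm i (k : 'I_n.+1) : (i < vperm t k)%N -> ~~ below t i (slot t xpred0 k).
Proof.
rewrite vpermE /below; case: k => -[|k] //= kn ik.
by rewrite -/(mid t (nth_vertex t k)) leqNgt ik.
Qed.

Lemma tree_flag_richardson z : richardson_set (vperm t) (wperm t) (tree_flag z).
Proof.
split.
  apply: closure_translated_flag => w w0; have dw : in_chart xpredT w by move=> q vq; exact: w0.
  have gE := chart_glE (unitmx1 C n.+1) dw.
  have [|b bb gb] := @schubert_cell R n (wperm t) (chart_gl (unitmx1 C n.+1) xpredT w).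
    by move=> i k ik; rewrite gE mul1mx mxE /leaf_coord (negPf (not_below_wperm ik)).
  by exists b, (chart_gl (unitmx1 C n.+1) xpredT w); split=> //; exact: translated_flagE.
exists (translated_flag wmat_longest_unit z); last first.
  have [d dz] := chart_exists z.
  have E : sval (translated_flag wmat_longest_unit z) = coset (wmat R (longest n.+1) *m tree_mx d z).
    by rewrite (translated_flagE _ dz) /= chart_glE.
  by apply/(translateP _ _ E); rewrite mulmxA wmat_longestK mul1mx (tree_flagE dz).
apply: closure_translated_flag => w w0; have dw : in_chart xpred0 w by move=> q vq; exact: w0.
have gE := chart_glE wmat_longest_unit dw.
have [|b bb gb] := @schubert_cell R n (vperm t * longest n.+1)%g (chart_gl wmat_longest_unit xpred0 w).
  move=> i k; rewrite permM permE /= => ik; rewrite gE wmat_longest_mulE mxE /leaf_coord ifN //.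
  by apply: not_below_vperm => /=; move: ik (ltn_ord i) (ltn_ord (vperm t k)); move: (nat_of_ord (vperm t k)) (nat_of_ord i) => u l; lia.
by exists b, (chart_gl wmat_longest_unit xpred0 w); split=> //; exact: translated_flagE.
Qed.

End TreeFlags.

(** * Recovering the coordinates from a flag *)

Section RichardsonLines.
Local Open Scope ring_scope.
Variables (R : realType) (t : bintree).
Local Notation C := R[i].
Local Notation n := (nb_vertices t).
Local Notation mat := 'M[C]_n.+1.
Local Notation flags := (flag_variety R n).
Local Notation pid j := (@pid_mx C n.+1 n.+1 j).
Implicit Types (d : seq bool -> bool) (z : cox C t) (g h : mat) (u f : 'rV[C]_n.+1) (y : seq bool).

Definition supported y u : Prop := forall j : 'I_n.+1, ~~ below t j y -> u 0 j = 0.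

Lemma supportedP y u : supported y u <-> u *m pid (hi t y) = u /\ u *m pid (lo t y) = 0.
Proof.
split=> [su|[E1 E2] j].
  by split; apply/rowP => j; rewrite mulmx_pidE ?mxE; case: ltnP => // jy;
    rewrite su // /below -?ltnNge ?negb_and -?leqNgt ?jy ?orbT // -ltnNge jy.
rewrite negb_and -ltnNge -leqNgt => /orP[jy|jy].
  by have := congr1 (fun M : 'rV_n.+1 => M 0 j) E2; rewrite /= mulmx_pidE jy mxE.
by have := congr1 (fun M : 'rV_n.+1 => M 0 j) E1; rewrite /= mulmx_pidE ltnNge jy.
Qed.

Definition is_line y (V : mat) f : Prop := [/\ f != 0, (f <= V)%MS, supported y f &
  forall u, (u <= V)%MS -> supported y u -> exists c, u = c *: f].

Lemma flag_unit (x : flags) h : sval x h -> h \in unitmx.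
Proof. by move=> /flag_mem[g <- _]; exact: (svalP g). Qed.

Lemma richardson_stable (x : flags) h l j : richardson_set (vperm t) (wperm t) x -> sval x h ->
  (l <= n)%N -> (j <= n.+1)%N -> breakpoint t l j ->
  (span l h *m pid j <= span l h)%MS /\ \rank (span l h *m pid j) = vcount t l j.
Proof.
move=> [sw [x' sv xx']] xh ln jn bj; apply: (@truncation_stable _ _ _ _ _ _ (wcount t l j)).
- exact: opposite_schubert_rank sv xx' xh.
- exact: schubert_rank sw xh.
- by rewrite rank_span ?(flag_unit xh) //; exact: breakpoint_count.
Qed.

(** In the space where [y] is born, the ranks of the truncations at the two ends of its interval
    differ by one. *)
Lemma richardson_line (x : flags) h y : richardson_set (vperm t) (wperm t) x -> sval x h ->
  is_slot t y -> exists f, is_line y (span (birth t y) h) f.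
Proof.
move=> rx xh; have hu := flag_unit xh.
have mk (V : mat) : (lo t y <= hi t y)%N -> (V *m pid (lo t y) <= V)%MS -> (V *m pid (hi t y) <= V)%MS ->
    \rank (V *m pid (hi t y)) = (\rank (V *m pid (lo t y))).+1 -> exists f, is_line y V f.
  move=> lh Vl Vh rV; have [f [f0 fV f1 f2 fu]] := truncation_line lh Vl Vh rV.
  exists f; split=> //; first exact/supportedP.
  by move=> u uV /supportedP[u1 u2]; apply: fu.
case=> [yE|[q [b [vq yE]]]].
  rewrite {}yE in mk *; apply: mk; rewrite ?lo_root ?hi_root ?pid_mx_0 ?pid_mx_1 ?mulmx0 ?mulmx1 ?sub0mx ?submx_refl //.
  by rewrite mxrank0 rank_span.
rewrite yE birth_rcons -yE; set l := (index q (vertices t)).+1.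
have ln : (l <= n)%N by exact: birth_le.
have stable j := richardson_stable (l := l) (j := j) rx xh ln.
have hn : (hi t q <= n.+1)%N by exact: hi_le.
have mn : (mid t q <= n.+1)%N by apply: leq_trans (ltnW (mid_lt_hi vq)) hn.
have l_n : (lo t q <= n.+1)%N by apply: leq_trans (ltnW (lo_lt_mid vq)) mn.
have [Vl rl] := stable _ l_n (breakpoint_lo vq).
have [Vm rm] := stable _ mn (breakpoint_mid vq).
have [Vh rh] := stable _ hn (breakpoint_hi vq).
rewrite yE in mk *; case: b yE mk => yE mk; apply: mk; rewrite ?lo_right ?hi_right ?lo_left ?hi_left //.
- exact/ltnW/mid_lt_hi.
- by rewrite rh rm vcount_right.
- exact/ltnW/lo_lt_mid.
- by rewrite rm rl vcount_left.
Qed.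

Lemma lo_slot_bound y : is_slot t y -> (lo t y < n.+1)%N.
Proof. by move=> sy; apply: below_slot_bound sy _; rewrite /below leqnn lo_lt_hi. Qed.

Lemma is_line_scale y V f c : c != 0 -> is_line y V f -> is_line y V (c *: f).
Proof.
move=> c0 [f0 fV sf fu]; split.
- by rewrite scaler_eq0 negb_or c0.
- exact: scalemx_sub.
- by move=> j jy; rewrite mxE sf ?mulr0.
- by move=> u uV /(fu u uV)[a ->]; exists (a / c); rewrite scalerA mulfVK.
Qed.

(** At a leaf the line is a coordinate axis; its generator is normalised as in [leaf_coord_leaf],
    where weights are 1. *)
Lemma richardson_line_leaf (x : flags) h y : richardson_set (vperm t) (wperm t) x -> sval x h ->
  is_slot t y -> exists2 f, is_line y (span (birth t y) h) f &
    ~~ vertex t y -> forall j : 'I_n.+1, f 0 j = (j == lo t y :> nat)%:R.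
Proof.
move=> rx xh sy; have [f lf] := richardson_line rx xh sy.
case: (boolP (vertex t y)) => [vy|vy]; first by exists f.
have [f0 _ sf _] := lf; pose j0 := Ordinal (lo_slot_bound sy).
have fE (j : 'I_n.+1) : j != j0 -> f 0 j = 0.
  by move=> jj; apply: sf; rewrite /below hi_leaf // ltnS -eqn_leq eq_sym.
have fj : f 0 j0 != 0.
  apply: contraNneq f0 => E; apply/eqP/rowP => j; rewrite mxE.
  by case: (eqVneq j j0) => [->|/fE].
exists ((f 0 j0)^-1 *: f); first by apply: is_line_scale lf; rewrite invr_eq0.
move=> _ j; rewrite mxE -[_ == _ :> nat]/(j == j0); case: (eqVneq j j0) => [->|/fE ->]; last by rewrite mulr0.
by rewrite mulVf.
Qed.

Lemma is_slot_child q b : vertex t q -> is_slot t (rcons q b).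
Proof. by move=> vq; right; exists q, b. Qed.

Lemma supported_leaf_vect (z : seq bool -> bool -> C) y : supported y (leaf_vect t z y).
Proof. by move=> j jy; rewrite mxE /leaf_coord (negPf jy). Qed.

Lemma leaf_vect_neq0 z y : is_slot t y -> leaf_vect t (sval z) y != 0.
Proof.
move=> sy; have [d dz] := chart_exists z; have ty := below_target t d y.
apply: contraNneq (walk_chart_neq0 y dz) => /rowP/(_ (Ordinal (below_slot_bound sy ty))).
by rewrite !mxE /leaf_coord ty walk_toward_target => ->.
Qed.

Lemma tree_mx_span d (g : mat) z :
  (forall y, is_slot t y -> (leaf_vect t (sval z) y <= span (birth t y) g)%MS) ->
  forall l, (span l (tree_mx d z) <= span l g)%MS.
Proof.
move=> zg l; apply/row_subP => k; have kn : (k <= n)%N by rewrite -ltnS.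
case: (leqP k l) => kl; last first.
  suff -> : row k (span l (tree_mx d z)) = 0 by exact: sub0mx.
  by apply/rowP => j; rewrite [LHS]mxE [RHS]mxE mul_pid_mxE ltnS leqNgt kl.
have -> : row k (span l (tree_mx d z)) = leaf_vect t (sval z) (slot t d k).
  by apply/rowP => j; rewrite [LHS]mxE mul_pid_mxE ltnS kl !mxE.
apply: submx_trans (zg _ (is_slot_slot d kn)) _.
by rewrite span_le // birth_slot.
Qed.

(** Cutting the vector of [q] at [mid] gives vectors supported below its two children, in the space
    where these are born. By uniqueness of the lines they are multiples of the chosen generators,
    and the factors are the coordinates at [q]. *)
Lemma tree_flag_surj (x : flags) : richardson_set (vperm t) (wperm t) x -> exists z, tree_flag z = x.
Proof.
move=> rx; have [g xE] := flag_rep x; set h := sval g.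
have xh : sval x h by rewrite xE; exact: coset_refl.
have [|f fP] := @choice _ _ (fun y f => is_slot t y -> is_line y (span (birth t y) h) f /\
    (~~ vertex t y -> forall j : 'I_n.+1, f 0 j = (j == lo t y :> nat)%:R)).
  move=> y; case: (pselect (is_slot t y)) => [sy|sy]; last by exists 0.
  by have [f f1 f2] := richardson_line_leaf rx xh sy; exists f.
have [|z zP] := @choice _ _ (fun q (c : C * C) => vertex t q ->
    f q = c.1 *: f (rcons q false) + c.2 *: f (rcons q true)).
  move=> q.
  case vq: (vertex t q); last by exists (0, 0).
  have [[f0 fV sf _] _] := fP q (is_slot_vertex vq).
  have [[_ F0 _ fu0] _] := fP _ (is_slot_child false vq); have [[_ F1 _ fu1] _] := fP _ (is_slot_child true vq).
  rewrite !birth_rcons in F0 F1 fu0 fu1; set V := span _ h in F0 F1 fu0 fu1.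
  have qV : (f q <= V)%MS.
    by apply: submx_trans fV (span_le _ _); apply: leqW (birth_index vq).
  have mn : (mid t q <= n.+1)%N by apply: leq_trans (ltnW (mid_lt_hi vq)) (hi_le vq).
  have [mV _] := richardson_stable rx xh (birth_le vq) mn (breakpoint_mid vq).
  pose u := f q *m pid (mid t q).
  have uV : (u <= V)%MS by apply: submx_trans mV; exact: submxMr.
  have uE j : u 0 j = if toward t j q then 0 else f q 0 j.
    by rewrite mulmx_pidE /toward; case: ltnP.
  have [|c0 c0E] := fu0 u uV.
    by move=> j; rewrite below_child // uE; case: toward => //=; rewrite andbT => /sf.
  have [||c1 c1E] := fu1 (f q - u); first by rewrite addmx_sub // eqmx_opp.
    move=> j; rewrite below_child // mxE [X in _ + X]mxE uE.
    by case: toward => /=; rewrite ?subrr // andbT subr0 => /sf.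
  by exists (c0, c1) => _; rewrite /= -c0E -c1E addrC subrK.
pose Z q b := if b then (z q).2 else (z q).1.
(* If both factors were 0, the vector of [q] would be 0. *)
have [|w wE] := @cox_point C t Z.
  move=> q vq; have [[f0 _ _ _] _] := fP q (is_slot_vertex vq).
  have := zP q vq; rewrite /Z; case: (eqVneq (z q).1 0) => [->|]; last by left.
  case: (eqVneq (z q).2 0) => [->|]; last by right.
  by rewrite !scale0r addr0 => E; rewrite E eqxx in f0.
have fE y : is_slot t y -> leaf_vect t (sval w) y = f y.
  rewrite wE; elim/(@path_ind t): y => y vy.
    move=> sy; have [_ fy] := fP y sy; apply/rowP => j.
    by rewrite mxE leaf_coord_leaf // fy.
  by move=> IH _; rewrite (zP y vy) leaf_vect_vertex // !(IH _ (is_slot_child _ vy)).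
exists w; have [d dw] := chart_exists w; apply: flag_eq; rewrite (tree_flagE dw) xE /=.
apply/esym/coset_eq; first exact: (svalP g).
apply/(coset_spanP _ (svalP g)); split; first exact: tree_mx_unit.
by apply: tree_mx_span => y sy; rewrite fE //; have [[]] := fP y sy.
Qed.

Lemma tree_flag_fiber z z' : tree_flag z = tree_flag z' <-> cox_equiv t (sval z) (sval z').
Proof.
have [d dz] := chart_exists z; split=> [zz'|zz'].
  have xh : sval (tree_flag z) (tree_mx d z) by rewrite (tree_flagE dz); exact: coset_refl.
  have hu := flag_unit xh.
  have [d' dz'] := chart_exists z'.
  have hh' : coset (tree_mx d z) (tree_mx d' z').
    by rewrite -(tree_flagE dz) zz' (tree_flagE dz'); exact: coset_refl.
  have line y : is_slot t y -> exists c, leaf_vect t (sval z') y = c *: leaf_vect t (sval z) y.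
    move=> sy; have [f [_ _ _ fu]] := richardson_line (tree_flag_richardson z) xh sy.
    have [|a aE] := fu _ (leaf_vect_span dz sy); first exact: supported_leaf_vect.
    have [||b bE] := fu (leaf_vect t (sval z') y).
    - by rewrite -(coset_span_eq _ hu hh') leaf_vect_span.
    - exact: supported_leaf_vect.
    exists (b / a); rewrite aE bE scalerA mulfVK //.
    by apply: contraNneq (leaf_vect_neq0 z sy) => a0; rewrite aE a0 scale0r.
  have [|c cE] := @choice _ _ (fun y c => is_slot t y ->
      leaf_vect t (sval z') y = c *: leaf_vect t (sval z) y).
    move=> y.
    by case: (pselect (is_slot t y)) => [/line[c]|]; [exists c | exists 0].
  have c0 y : is_slot t y -> c y != 0.
    by move=> sy; apply: contraNneq (leaf_vect_neq0 z' sy) => c0; rewrite cE // c0 scale0r.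
  (* At a leaf both vectors are the same coordinate vector, so the factor 1 is correct there. *)
  pose lam y := if vertex t y then c y else 1.
  have lamE y : is_slot t y -> leaf_vect t (sval z') y = lam y *: leaf_vect t (sval z) y.
    rewrite /lam; case vy: (vertex t y); first exact: cE.
    by move=> _; rewrite scale1r; apply/rowP => j; rewrite !mxE !leaf_coord_leaf ?vy.
  exists lam; split=> [y|y /negPf vy|q b vq].
  - by rewrite /lam; case: ifP => vy; [apply: c0; exact: is_slot_vertex | exact: oner_neq0].
  - by rewrite /lam vy.
  have sc := is_slot_child b vq.
  have tb := below_target t d (rcons q b); pose j := Ordinal (below_slot_bound sc tb).
  have jE : toward t j q = b by have := tb; rewrite below_child // => /andP[_ /eqP ->].
  have sq := is_slot_vertex vq; have := congr1 (fun u : 'rV_n.+1 => u 0 j) (lamE q sq).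
  have coordE (x : cox C t) : leaf_vect t (sval x) q 0 j = sval x q b * leaf_vect t (sval x) (rcons q b) 0 j.
    rewrite !mxE /leaf_coord tb -[(j : nat)]/(target t d (rcons q b)) below_target_child //.
    by rewrite walk_vertex // jE.
  rewrite /= [RHS]mxE !coordE lamE // mxE; set w := leaf_vect t (sval z) (rcons q b) 0 j.
  have w0 : w != 0 by rewrite /w mxE /leaf_coord tb walk_toward_target walk_chart_neq0.
  by rewrite !mulrA => /(mulIf w0).
have dz' := in_chart_equiv zz' dz.
apply: flag_eq; rewrite (tree_flagE dz) (tree_flagE dz'); apply: coset_eq (tree_mx_unit dz) _.
apply/(coset_spanP _ (tree_mx_unit dz)); split; first exact: tree_mx_unit.
apply: tree_mx_span => y sy; have [lam [l0 l1 lE]] := zz'.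
suff -> : leaf_vect t (sval z') y = lam y *: leaf_vect t (sval z) y.
  by apply: scalemx_sub; exact: leaf_vect_span.
apply/rowP => j; rewrite !mxE /leaf_coord; case: below; last by rewrite mulr0.
exact: walk_equiv.
Qed.

End RichardsonLines.

Lemma invmx_cancel (K : fieldType) n (B N N' A A' : 'M[K]_n) : N \in unitmx -> N' \in unitmx ->
  (N' = B *m N -> A' = B *m A -> invmx N' *m A' = invmx N *m A)%R.
Proof.
move=> Nu Nu' NE ->; rewrite -{1}(mulKVmx Nu A) (mulmxA B) -NE.
by rewrite mulKmx.
Qed.

(** * Chart coordinates as functions of a matrix *)

Section Cells.
Local Open Scope ring_scope.
Variables (R : realType) (t : bintree).
Local Notation C := R[i].
Local Notation n := (nb_vertices t).
Local Notation mat := 'M[C]_n.+1.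
Local Notation pid j := (@pid_mx C n.+1 n.+1 j).
Local Notation copid j := (@copid_mx C n.+1 j).
Implicit Types (d : seq bool -> bool) (z : cox C t) (g h : mat) (u : 'rV[C]_n.+1) (q : seq bool).

Lemma pid_idem l : pid l *m pid l = pid l.
Proof.
by apply/matrixP => i j; rewrite mul_pid_mxE !mxE; case: (ltnP i l) => // il; rewrite andbF.
Qed.

Lemma pid_copid l : pid l *m copid l = 0.
Proof. by rewrite mulmxBr mulmx1 pid_idem subrr. Qed.

Lemma copid_pid l : copid l *m pid l = 0.
Proof. by rewrite mulmxBl mul1mx pid_idem subrr. Qed.

Definition pivot_rows d g : mat := g^T *m (pivot R t d)^T.

(** Completing the leading block by an identity block keeps all matrices of one size, so that the
    block is invertible exactly when this matrix is. *)
Definition corner l (A : mat) : mat := pid l *m A *m pid l + copid l.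

(** Non-vanishing of the leading minors depends on the flag only, since an element of [borel]
    multiplies each leading block by an invertible one. *)
Definition in_cell d g : Prop := forall l, (l <= n)%N -> corner l (pivot_rows d g) \in unitmx.

(* It expresses the columns of a vector of the span of the first l rows in
   terms of the first l columns. *)
Definition cell_mx d l g : mat :=
  pid l *m (invmx (corner l (pivot_rows d g)) *m (pid l *m pivot_rows d g)).

(** It recovers [chart_coord] from the matrix alone, on a whole open set of [GL]. The sum picks the
    slot from which the path along [d] runs through [q]. *)
Definition cell_coord d g q : C :=
  if vertex t q then
    \sum_(k : 'I_n.+1 | target t d (slot t d k) == target t d q)
      cell_mx d (index q (vertices t)).+1 g k (inord (index q (vertices t)).+1)
  else 0.

Lemma corner_mull l (A B : mat) : pid l *m B = pid l *m B *m pid l ->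
  corner l (B *m A) = corner l B *m corner l A.
Proof.
have QQ : copid l *m copid l = copid l by rewrite {1}/copid_mx mulmxBl mul1mx pid_copid subr0.
rewrite /corner; move: (pid_idem l) (pid_copid l) (copid_pid l) QQ.
move: (copid l) => Q; move: (pid l) => P PP PQ QP QQ E.
rewrite mulmxDl !mulmxDr QQ !(mulmxA Q) QP !mul0mx add0r -(mulmxA (P *m B) P Q) PQ mulmx0 addr0.
by rewrite !mulmxA -(mulmxA (P *m B) P P) PP -E.
Qed.

Lemma pivot_rows_mul d g b : pivot_rows d (g *m b) = b^T *m pivot_rows d g.
Proof. by rewrite /pivot_rows trmx_mul mulmxA. Qed.

Lemma in_cell_coset d g h : g \in unitmx -> coset g h -> in_cell d g -> in_cell d h.
Proof.
move=> gu gh; have [b bb ->] := coset_sym gu gh => cg l ln.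
have := cg l ln; rewrite pivot_rows_mul corner_mull ?unitmx_mul; first by case/andP.
exact: borel_pid.
Qed.

Lemma cell_mx_coset d g h l : g \in unitmx -> coset g h -> in_cell d g -> (l <= n)%N ->
  cell_mx d l h = cell_mx d l g.
Proof.
move=> gu gh cg ln; have gl := cg l ln; have hl := in_cell_coset gu gh cg ln.
have [b bb hE] := gh; have Eb := borel_pid l bb.
have NE : corner l (pivot_rows d h) = corner l b^T *m corner l (pivot_rows d g).
  by rewrite hE pivot_rows_mul corner_mull.
have GE : pid l *m pivot_rows d h = corner l b^T *m (pid l *m pivot_rows d g).
  rewrite hE pivot_rows_mul /corner mulmxDl (mulmxA (copid l)) copid_pid mul0mx addr0.
  by rewrite !mulmxA -(mulmxA (pid l *m b^T) (pid l) (pid l)) pid_idem -Eb.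
exact: (congr1 (mulmx (pid l)) (invmx_cancel gl hl NE GE)).
Qed.

Lemma cell_coord_coset d g h : g \in unitmx -> coset g h -> in_cell d g ->
  cell_coord d h = cell_coord d g.
Proof.
move=> gu gh cg; apply/funext => q; rewrite /cell_coord; case vq: (vertex t q); last by [].
by apply: eq_bigr => k _; rewrite (cell_mx_coset gu gh cg (index_vertex_lt vq)).
Qed.

(** A vector in the span of the first l rows is determined by its entries at the first l pivots. If
    it is supported below [q], only the entry at the target of [q] can be non-zero among them, and
    [cell_mx] computes the next pivot entry from it. *)
Lemma cell_coordP d g u q : in_cell d g -> vertex t q ->
  (u <= span (index q (vertices t)) g)%MS -> supported q u ->
  (forall j : 'I_n.+1, j = target t d q :> nat -> u 0 j = 0 -> u = 0) /\
  forall j i : 'I_n.+1, j = target t d q :> nat -> i = target t d (rcons q (~~ d q)) :> nat ->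
    u 0 i = u 0 j * cell_coord d g q.
Proof.
move=> cg vq /submxP[y uE] su; set l := (index q (vertices t)).+1.
have ln : (l <= n)%N by exact: index_vertex_lt.
have Nu := cg l ln; set G := pivot_rows d g in Nu; set N := corner l G in Nu.
set u' := u *m (pivot R t d)^T.
have u'E : u' = y *m pid l *m G by rewrite /u' uE /span /G /pivot_rows !mulmxA.
have yE : y *m pid l = u' *m pid l *m invmx N.
  have -> : u' *m pid l = y *m pid l *m N.
    rewrite u'E /N /corner mulmxDr -(mulmxA y _ (copid l)) pid_copid mulmx0 addr0.
    by rewrite !mulmxA -(mulmxA y (pid l) (pid l)) pid_idem.
  by rewrite mulmxK.
have u'k (j k : 'I_n.+1) : j = target t d q :> nat -> (u' *m pid l) 0 k =
    if (k < l)%N && (target t d (slot t d k) == target t d q) then u 0 j else 0.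
  move=> jE; rewrite mulmx_pidE; case: ltnP => //= kl; have kn : (k <= n)%N by rewrite -ltnS.
  rewrite /u' (@pivotE R t d _ k (Ordinal (slot_target_bound d kn))) //.
  case: eqP => [E|E]; first by congr (u _ _); apply/val_inj; rewrite /= E jE.
  by apply: su; apply/negP => bq; apply: E; apply: slot_target_below.
split=> [j jE u0|j i jE iE].
  have -> : u = y *m pid l *m g^T by rewrite uE /span mulmxA.
  rewrite yE; suff -> : u' *m pid l = 0 by rewrite !mul0mx.
  by apply/rowP => k; rewrite (u'k j) // u0 if_same mxE.
have slotl : slot t d l = rcons q (~~ d q) by exact: slot_index.
have il : u 0 i = u' 0 (inord l).
  by rewrite /u' (@pivotE R t d u (inord l) i) // inordK ?ltnS // slotl -iE.
have u'M : u' = u' *m pid l *m cell_mx d l g.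
  rewrite /cell_mx -/G -/N !mulmxA -(mulmxA u' (pid l) (pid l)) pid_idem -yE.
  by rewrite -(mulmxA y (pid l) (pid l)) pid_idem u'E /G /pivot_rows !mulmxA.
rewrite il {1}u'M mxE /cell_coord vq mulr_sumr [RHS]big_mkcond; apply: eq_bigr => k _.
rewrite (u'k j) //; case: eqP => _; last by rewrite andbF mul0r.
rewrite andbT; case: ltnP => // lk; rewrite mul0r /cell_mx mul_pid_mxE ltnNge lk mulr0 //.
Qed.

End Cells.

Section CellSections.
Local Open Scope ring_scope.
Variables (R : realType) (t : bintree).
Local Notation C := R[i].
Local Notation n := (nb_vertices t).
Local Notation mat := 'M[C]_n.+1.
Local Notation pid j := (@pid_mx C n.+1 n.+1 j).
Local Notation copid j := (@copid_mx C n.+1 j).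
Implicit Types (d : seq bool -> bool) (z : cox C t) (g : GL R n) (q : seq bool).

Lemma cornerE l (A : mat) k i :
  corner l A k i = (if (k < l)%N && (i < l)%N then A k i else 0) + (if (k < l)%N then 0 else (k == i)%:R).
Proof.
rewrite /corner mxE mulmx_pidE mul_pid_mxE -(mulmx1 (copid l)) mul_copid_mxE.
by case: (ltnP k l); case: (ltnP i l); rewrite ?mxE.
Qed.

Lemma tree_mx_in_cell d z : in_chart d z -> in_cell d (tree_mx d z).
Proof.
move=> dz l ln; rewrite unitmxE unitfE det_upper => [|k i ik].
  apply/prodf_neq0 => k _; rewrite cornerE eqxx andbb; case: ifP => _; rewrite ?addr0 ?add0r ?oner_neq0 //.
  exact: tree_mx_pivot_diag.
rewrite cornerE -val_eqE gtn_eqF // !if_same addr0; case: ifP => // _.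
exact: tree_mx_pivot_triangular.
Qed.

Lemma cell_coord_tree_flag d z g : tree_flag z = flag_proj g -> in_cell d (sval g) ->
  in_chart d z /\ cell_coord d (sval g) = chart_coord d z.
Proof.
move=> zg cg; have [e ez] := chart_exists z.
have zg' : coset (sval g) (tree_mx e z).
  by rewrite -[coset _]/(sval (flag_proj g)) -zg (tree_flagE ez); exact: coset_refl.
have uP q : vertex t q -> _ := fun vq => cell_coordP (u := leaf_vect t (sval z) q) cg vq.
have uV q : vertex t q -> (leaf_vect t (sval z) q <= span (index q (vertices t)) (sval g))%MS.
  move=> vq; rewrite -(coset_span_eq _ (svalP g) zg').
  apply: submx_trans (leaf_vect_span ez (is_slot_vertex vq)) _.
  exact/span_le/birth_index.
have tb q e' : is_slot t q -> (target t e' q < n.+1)%N.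
  by move=> sq; apply: below_slot_bound sq (below_target _ _ _).
(* The vector of [q] is not 0, so its entry at the target is not 0 either; this entry is the walk
   along [d]. *)
have w0 q : vertex t q -> walk t (sval z) d q != 0.
  move=> vq; have sq := is_slot_vertex vq; have [h _] := uP q vq (uV q vq) (@supported_leaf_vect _ _ _ _).
  apply: contraNneq (leaf_vect_neq0 z sq) => w0; apply/eqP/(h (Ordinal (tb q d sq))) => //.
  by rewrite mxE /leaf_coord below_target walk_toward_target.
split=> [q vq|].
  by have := w0 q vq; rewrite walk_vertex // mulf_eq0 negb_or => /andP[].
apply/funext => q; case vq: (vertex t q); last by rewrite /cell_coord /chart_coord vq.
have [_ h] := uP q vq (uV q vq) (@supported_leaf_vect _ _ _ _).
have sq := is_slot_vertex vq; have sc := is_slot_child (~~ d q) vq.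
have := h (Ordinal (tb q d sq)) (Ordinal (tb _ d sc)) erefl erefl.
rewrite !mxE /leaf_coord /= below_target below_target_child // walk_toward_target walk_toward_child //.
by rewrite /chart_coord vq => ->; rewrite mulrC mulKf // w0.
Qed.

Lemma polymx_corner d l : polymx (fun f => exists i j, forall g : GL R n, f g = sval g i j)
  (fun g : GL R n => corner l (pivot_rows d (sval g))).
Proof.
move=> k i; have -> : (fun g : GL R n => corner l (pivot_rows d (sval g)) k i) =
    fun g => (pid l *m ((sval g)^T *m (pivot R t d)^T) *m pid l) k i + copid l k i.
  by apply/funext => g; rewrite mxE.
apply: Polyfun_add; last exact: Polyfun_const.
apply: polymx_mul; last exact: polymx_cst.
apply: polymx_mul; first exact: polymx_cst.
apply: polymx_mul; last exact: polymx_cst.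
by apply: polymx_tr => i' j'; apply: Polyfun_coord; exists i', j'.
Qed.

Definition cell d : GL R n -> Prop := fun g => in_cell d (sval g).

Lemma open_cell d : is_open (@cell d).
Proof.
move=> g cg; exists (fun h : GL R n => \prod_(l < n.+1) \det (corner l (pivot_rows d (sval h)))); split.
- by apply: polyfun_prod => l; apply: polyfun_det; exact: polymx_corner.
- by apply/prodf_neq0 => l _; rewrite -unitfE -unitmxE; apply: cg; rewrite -ltnS.
- move=> h /prodf_neq0 h0 l ln; rewrite unitmxE unitfE.
  exact: (h0 (Ordinal (ln : (l < n.+1)%N))).
Qed.

Lemma polyfun_adj (P : Type) (S : (P -> C) -> Prop) m (A : P -> 'M[C]_m) :
  polymx S A -> polymx S (fun p => \adj (A p)).
Proof.
move=> pA i j; have -> : (fun p => (\adj (A p)) i j) =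
    fun p => (-1) ^+ (j + i) * \det (row' j (col' i (A p))) by apply/funext => p; rewrite mxE.
apply: Polyfun_mul; first exact: Polyfun_const.
apply: polyfun_det => k l; have -> : (fun p => row' j (col' i (A p)) k l) =
  fun p => A p (lift j k) (lift i l) by apply/funext => p; rewrite !mxE.
exact: pA.
Qed.

(** The inverse in [cell_mx] is the adjugate divided by a determinant that does not vanish on the
    cell. *)
Lemma regular_cell_coord d q : regular (@cell d) (fun g : GL R n => cell_coord d (sval g) q).
Proof.
rewrite /cell_coord; case vq: (vertex t q); last exact: regular_cst.
set l := (index q (vertices t)).+1; have ln : (l <= n)%N by exact: index_vertex_lt.
have reg k i : regular (@cell d) (fun g : GL R n => cell_mx d l (sval g) k i).
  apply: (@regular_eq _ _ _ _ (fun g : GL R n => (\det (corner l (pivot_rows d (sval g))))^-1 *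
     (pid l *m (\adj (corner l (pivot_rows d (sval g))) *m (pid l *m ((sval g)^T *m (pivot R t d)^T)))) k i)).
    move=> g cg; rewrite /cell_mx /invmx (cg l ln) -scalemxAl -scalemxAr [RHS]mxE.
    by [].
  apply: regularM.
    apply: regularV => [g cg|]; first by rewrite -unitfE -unitmxE; apply: cg.
    by apply/regular_poly/polyfun_det; exact: polymx_corner.
  apply: regular_poly; apply: polymx_mul; first exact: polymx_cst.
  apply: polymx_mul; first exact/polyfun_adj/polymx_corner.
  apply: polymx_mul; first exact: polymx_cst.
  apply: polymx_mul; last exact: polymx_cst.
  by apply: polymx_tr => i' j'; apply: Polyfun_coord; exists i', j'.
apply: (@regular_eq _ _ _ _ (fun g => \sum_(k : 'I_n.+1)
   (target t d (slot t d k) == target t d q)%:R * cell_mx d l (sval g) k (inord l))).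
  move=> g _; rewrite [RHS]big_mkcond; apply: eq_bigr => k _.
  by case: eqP; rewrite ?mul1r ?mul0r.
by apply: regular_sum => k; apply: regularM; first exact: regular_cst.
Qed.

Definition cell_section d g : cox C t := chart_map t d (cell_coord d (sval g)).

Lemma regular_cell_section d c : cox_coord (t := t) c ->
  regular (@cell d) (fun g => c (cell_section d g)).
Proof.
move=> [q [b [vq ->]]] /=; rewrite /chart_fun.
by case: (b == d q); [exact: regular_cst | exact: regular_cell_coord].
Qed.

Lemma cell_coset d g g' : coset (sval g) (sval g') -> cell d g -> cell d g' /\ cell_section d g' = cell_section d g.
Proof.
move=> gg' cg; split; first exact: in_cell_coset (svalP g) gg' cg.
by rewrite /cell_section (cell_coord_coset (svalP g) gg' cg).
Qed.

Lemma tree_flag_section d z g : tree_flag z = flag_proj g -> cell d g ->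
  in_chart d z /\ tree_flag (cell_section d g) = tree_flag z.
Proof.
move=> zg /(cell_coord_tree_flag zg)[dz E]; split=> //.
by apply/esym/tree_flag_fiber; rewrite /= E; exact: chart_coordK.
Qed.

Lemma tree_flag_cell d z : in_chart d z -> exists2 g : GL R n, tree_flag z = flag_proj g & cell d g.
Proof.
move=> dz; exists (exist _ (tree_mx d z) (tree_mx_unit dz)); last exact: tree_mx_in_cell.
by apply: flag_eq; rewrite (tree_flagE dz).
Qed.

End CellSections.

(** * The Richardson variety as a quotient of the Cox space *)

Section RichardsonPresentation.
Local Open Scope ring_scope.
Variables (R : realType) (t : bintree).
Local Notation C := R[i].
Local Notation n := (nb_vertices t).
Local Notation flags := (flag_variety R n).
Local Notation Y := (richardson R (vperm t) (wperm t)).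
Implicit Types (d : seq bool -> bool) (z : cox C t) (c : seq bool -> bool -> C) (q y : seq bool).

Definition cox_to_richardson z : Y := exist _ (tree_flag z) (tree_flag_richardson z).

Local Notation r := cox_to_richardson.

Lemma richardson_eq (x x' : Y) : sval x = sval x' -> x = x'.
Proof.
case: x x' => [x xp] [x' xp'] /= E; case: x' / E xp' => xp'.
by rewrite (Prop_irrelevance xp xp').
Qed.

Lemma cox_to_richardson_surj (x : Y) : exists z, r z = x.
Proof. by have [z zE] := tree_flag_surj (svalP x); exists z; apply: richardson_eq. Qed.

Lemma cox_to_richardson_fiber z z' : r z = r z' <-> cox_equiv t (sval z) (sval z').
Proof.
by rewrite -tree_flag_fiber; split=> [/(congr1 sval)|zz'] //; apply: richardson_eq.
Qed.

(** [cell_section] makes sense also for flags outside the Richardson variety. It therefore extends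
    open sets and regular functions to the flag variety, as the structure of a subvariety
    demands. *)
Definition cell_flags d (A : cox C t -> Prop) : flags -> Prop :=
  fun x => exists g : GL R n, [/\ x = flag_proj g, cell d g & A (cell_section d g)].

Lemma cell_flagsE d A (g : GL R n) : cell_flags d A (flag_proj g) <-> cell d g /\ A (cell_section d g).
Proof.
split=> [[g' [/esym/flag_projP gg' cg' Ag']]|[cg Ag]]; last by exists g.
have [cg sE] := cell_coset gg' cg'; split; first exact: cg.
by move: Ag'; rewrite -sE.
Qed.

Lemma open_cell_flags d A : is_open A -> is_open (cell_flags d A).
Proof.
move=> oA _; have -> : (fun g : GL R n => cell_flags d A (flag_proj g)) =
    (fun g => cell d g /\ A (cell_section d g)).
  by apply/funext => g; apply/propext; exact: cell_flagsE.
exact: (local_preimage_open (@regular_cell_section _ t d) (@open_cell _ t d) oA).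
Qed.

Lemma cell_flags_tree_flag d (A : Y -> Prop) z :
  cell_flags d (fun w => A (r w)) (tree_flag z) <-> in_chart d z /\ A (r z).
Proof.
split=> [[g [zg cg Ag]]|[dz Az]].
  have [dz E] := tree_flag_section zg cg; split=> //.
  by have -> : r z = r (cell_section d g) by apply: richardson_eq; rewrite /= E.
have [g zg cg] := tree_flag_cell dz; exists g; split=> //.
have [_ E] := tree_flag_section zg cg.
by have -> : r (cell_section d g) = r z by apply: richardson_eq.
Qed.

Lemma cox_to_richardson_open (A : Y -> Prop) : is_open A <-> is_open (fun z => A (r z)).
Proof.
split=> [[A' oA' AE]|oA].
  have -> : (fun z => A (r z)) = (fun z => A' (tree_flag z)).
    by apply/funext => z; apply/propext; exact: (AE (r z)).
  exact: (translated_flag_morphism _ oA').1.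
exists (fun x => exists d, cell_flags d (fun z => A (r z)) x).
  move=> _; apply: zariski_open_local => g [d Ag].
  exists (fun h : GL R n => cell_flags d (fun z => A (r z)) (flag_proj h)); split=> //.
    by have := @open_cell_flags d _ oA tt.
  by move=> h; exists d.
move=> x; have [z <-] := cox_to_richardson_surj x; split=> [Az|[d]] /=.
  by have [d dz] := chart_exists z; exists d; apply/cell_flags_tree_flag.
by move=> /(@cell_flags_tree_flag d A)[].
Qed.

Lemma cox_to_richardson_regular (U : Y -> Prop) f : is_open U ->
  regular U f <-> regular (fun z => U (r z)) (fun z => f (r z)).
Proof.
move=> oU; split=> [rf|rf x Ux].
  apply: regular_local => z Uz; have [A [g [oA Az rg fE]]] := rf (r z) Uz.
  have [oA' rg'] := translated_flag_morphism (unitmx1 C n.+1) oA.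
  exists (fun w => A (tree_flag w)); split=> //.
  apply: (@regular_eq _ _ _ _ (fun w => g (tree_flag w))); first by move=> w [Uw Aw]; rewrite fE.
  by apply: regularS (rg' g rg) => w [].
have [z zE] := cox_to_richardson_surj x; rewrite -{x}zE in Ux *; have [d dz] := chart_exists z.
have oUr : is_open (fun w => U (r w)) by apply/cox_to_richardson_open.
have [rep repE] := choice (@flag_rep R n).
have secE (g : GL R n) : cell d g -> cell_section d (rep (flag_proj g)) = cell_section d g.
  by move=> cg; have [] := cell_coset (g' := rep (flag_proj g)) _ cg; first exact/flag_projP.
exists (cell_flags d (fun w => U (r w))), (fun p => f (r (cell_section d (rep p)))); split.
- exact: open_cell_flags.
- exact/cell_flags_tree_flag.
- move=> _; apply: (@regular_eq _ _ _ _ (fun g => f (r (cell_section d g)))).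
    by move=> g /cell_flagsE[cg _]; rewrite secE.
  apply: regularS (local_pullback_regular (@regular_cell_section _ t d) (@open_cell _ t d) rf) => g.
  by move=> /cell_flagsE.
- move=> p _; have [w <-] := cox_to_richardson_surj p => -[g [/= wg cg _]].
  have [_ E] := tree_flag_section wg cg; congr f; apply: richardson_eq.
  by rewrite /= wg secE // E wg.
Qed.

Lemma walk_scaled c z z' e y :
  scaled c z z' -> walk t (sval z') e y = walk t c e y * walk t (sval z) e y.
Proof.
move=> zz'; elim/(@path_ind t): y => y vy; first by rewrite !walk_leaf // mulr1.
by move=> IH; rewrite !(walk_vertex _ _ vy) IH zz' // mulrACA.
Qed.

(** Scaling multiplies the entry at a leaf j of the vector of [y] by the walk of [c] from [y] to j.
    Where this is proportional to [tau] for every slot, the two matrices differ by [tau] on the rows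
    and a diagonal matrix on the columns. *)
Lemma tree_flag_scaled (tau : 'rV[C]_n.+1) c z z' : (forall j, tau 0 j != 0) ->
  (forall y, is_slot t y -> exists k, forall j : 'I_n.+1, below t j y ->
     tau 0 j = k * walk t c (toward t j) y) ->
  (forall q b, c q b != 0) -> scaled c z z' ->
  translate (diag_mx tau) (tree_flag z) (tree_flag z').
Proof.
move=> tau0 tauE c0 zz'; have [d dz] := chart_exists z.
have dz' : in_chart d z' by move=> q vq; rewrite zz' // mulf_neq0 ?dz.
have [|k kE] := @choice _ _ (fun y k => is_slot t y -> forall j : 'I_n.+1, below t j y ->
     tau 0 j = k * walk t c (toward t j) y).
  by move=> y; case: (pselect (is_slot t y)) => [/tauE[k]|]; [exists k | exists 0].
apply/(translateP _ _ (tree_flagE dz)); rewrite (tree_flagE dz').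
apply: coset_eq (tree_mx_unit dz') _.
have ks (l : 'I_n.+1) : is_slot t (slot t d l) by apply: is_slot_slot; rewrite -ltnS.
exists (diag_mx (\row_l k (slot t d l))).
  split; last by move=> i j ji; rewrite mxE -val_eqE gtn_eqF.
  rewrite unitmxE unitfE det_diag; apply/prodf_neq0 => l _; rewrite mxE.
  have tl := below_target t d (slot t d l); pose j := Ordinal (below_slot_bound (ks l) tl).
  by have := tau0 j; rewrite (kE _ (ks l) j tl) mulf_eq0 negb_or => /andP[].
apply/matrixP => i l; rewrite mul_diag_mx mul_mx_diag !mxE /leaf_coord.
case bi: (below t i _); last by rewrite mulr0 mul0r.
by rewrite (walk_scaled _ _ zz') (kE _ (ks l) i bi) [RHS]mulrC mulrA.
Qed.

Lemma cox_to_richardson_torus (s : Y -> Y) : torus s <->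
  exists2 c : seq bool -> bool -> C, forall q b, c q b != 0 &
    forall z z', (forall q b, vertex t q -> sval z' q b = c q b * sval z q b) -> s (r z) = r z'.
Proof.
split=> [[T [Tu /diag_mxP[tau TE]] sT]|[c c0 sc]].
  have tau0 j : tau 0 j != 0.
    by move: Tu; rewrite TE unitmxE unitfE det_diag => /prodf_neq0; apply.
  (* The entries of [tau] are placed on the slots that end at leaves, and 1 on all others, so that a
     path picks up exactly the factor of its leaf. *)
  pose k y : C := if vertex t y then 1 else tau 0 (inord (lo t y)).
  pose c q b := k (rcons q b).
  have c0 q b : c q b != 0 by rewrite /c /k; case: ifP; rewrite ?oner_neq0.
  exists c => // z z' zz'; apply: richardson_eq; apply: flag_eq; have [d dz] := chart_exists z.
  have /(translateP _ _ (tree_flagE dz)) -> := sT (r z).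
  suff /(translateP _ _ (tree_flagE dz)) -> : translate T (tree_flag z) (tree_flag z') by [].
  rewrite TE; apply: (tree_flag_scaled tau0 _ c0 zz') => y _; exists (k y) => j.
  elim/(@path_ind t): y => y vy => [|IH].
    by rewrite walk_leaf // mulr1 /k (negPf vy) /below hi_leaf // ltnS -eqn_leq => /eqP ->; rewrite inord_val.
  move=> bj; rewrite walk_vertex // {1}/k vy mul1r; apply: IH.
  by rewrite below_child // bj eqxx.
(* Conversely, the entry at a leaf is the product of the scaling along the path from the root. *)
pose tau : 'rV[C]_n.+1 := \row_j walk t c (toward t j) [::].
have walk0 e y : walk t c e y != 0.
  elim/(@path_ind t): y => y vy; first by rewrite walk_leaf // oner_neq0.
  by move=> IH; rewrite walk_vertex // mulf_neq0.
have tau0 j : tau 0 j != 0 by rewrite mxE.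
exists (diag_mx tau).
  split; last exact: diag_mx_is_diag.
  by rewrite unitmxE unitfE det_diag; apply/prodf_neq0 => j _.
move=> x; have [z <-] := cox_to_richardson_surj x.
have [|z' zE'] := @cox_point C t (fun q b => c q b * sval z q b).
  by move=> q vq; case: (svalP z q vq) => ?; [left|right]; rewrite mulf_neq0.
have zz' : scaled c z z' by move=> q b _; rewrite zE'.
rewrite (sc z z' zz'); apply: (tree_flag_scaled tau0 _ c0 zz') => y sy.
suff [k kE] : exists k, forall j, below t j y -> walk t c (toward t j) [::] = k * walk t c (toward t j) y.
  by exists k => j bj; rewrite mxE kE.
elim/last_ind: y sy => [|q b IH] sy; first by exists 1 => j _; rewrite mul1r.
have vq : vertex t q by case: sy => [|[q' [b' [vq' /rcons_inj[-> _]]]]] //; case: (q).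
have [k kE] := IH (is_slot_vertex vq); exists (k * c q b) => j.
by rewrite below_child // => /andP[bj /eqP bE]; rewrite kE // walk_vertex // -bE mulrA.
Qed.

Lemma richardson_presentable : presentable t Y.
Proof.
exists cox_to_richardson; split.
- exact: cox_to_richardson_surj.
- exact: cox_to_richardson_fiber.
- exact: cox_to_richardson_open.
- exact: cox_to_richardson_regular.
- exact: cox_to_richardson_torus.
Qed.

End RichardsonPresentation.

(** * Classification *)

Section Classification.
Variable R : realType.
Implicit Types (X Y : tspace R[i]) (t : bintree).

Lemma presentable_of_toric_iso t X Y : toric_iso X Y -> presentable t Y -> presentable t X.
Proof.
move=> [F [G iFG]] [r pr]; have [FG GF mF mG tor] := iFG.
exists (fun z => G (r z)); split.
- by move=> x; have [z zE] := presents_surj pr (F x); exists z; rewrite zE FG.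
- by move=> z z'; rewrite -(presents_fiber pr); split=> [/(can_inj GF)|->].
- move=> A; split=> oA; first exact: (presents_open pr (fun y => A (G y))).1 (mG _ oA).1.
  have -> : A = (fun x => A (G (F x))) by apply/funext => x; rewrite FG.
  by apply: (mF (fun y => A (G y)) _).1; apply/(presents_open pr).
- move=> U f oU; have oU' := (mG _ oU).1.
  rewrite -(presents_regular pr (fun y => f (G y)) oU'); split=> rf.
    exact: (mG _ oU).2.
  have := (mF _ oU').2 (fun y => f (G y)) rf.
  have -> : (fun x => U (G (F x))) = U by apply/funext => x; rewrite FG.
  by have -> : (fun x => f (G (F x))) = f by apply/funext => x; rewrite FG.
- move=> s; have [_ _ _ _ tor'] := iso_pair_sym iFG.
  rewrite tor' (presents_torus pr); split=> -[c c0 cE]; exists c => // z z' zz'.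
    by rewrite -(cE _ _ zz') FG.
  by rewrite (cE _ _ zz') GF.
Qed.

Lemma toric_iso_refl X : toric_iso X X.
Proof.
by exists id, id; split.
Qed.

(** The set of all presenting trees requires no choice of a tree, makes sense for every variety and
    depends only on its isomorphism class. *)
Definition tree_class X : set bintree := [set t | presentable t X].

Lemma tree_class_presentable t X : presentable t X -> tree_class X = unordered_class t.
Proof.
move=> pX; apply/seteqP; split=> t' /=.
  move=> pX'; apply/unordered_isoP.
  exact: presentable_iso_eqv pX pX' (toric_iso_refl X).
by move=> /unordered_isoP tt'; apply: presentable_eqv pX; rewrite tree_eqv_sym.
Qed.

Lemma krull_dim_unique X n m : krull_dim X n -> krull_dim X m -> n = m.
Proof.
move=> [[Z cZ] hn] [[Z' cZ'] hm].
by apply/eqP; rewrite eqn_leq (hm _ _ cZ) (hn _ _ cZ').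
Qed.

Lemma catalan_type_presentable n X : catalan_type X -> krull_dim X n ->
  exists2 t, nb_vertices t = n & presentable t X.
Proof.
move=> [m [T [m0 trT iX]]] dX.
have pX := presentable_of_toric_iso iX (catalan_variety_presentable m0 trT R).
exists (triangle_tree T) => //.
exact: krull_dim_unique (presentable_krull_dim pX) dX.
Qed.

Lemma catalan_variety_tree n t : (0 < n)%N -> nb_vertices t = n ->
  exists2 T : {set 'I_n.+2 * 'I_n.+2}, triangulation T & presentable t (catalan_variety R T).
Proof.
move=> n0 nt; have trT := tree_edges_triangulation nt n0.
exists (tree_edges t n) => //.
by have := catalan_variety_presentable n0 trT R; rewrite triangle_tree_edges.
Qed.

(** Catalan type and dimension give the invariants and their injectivity for both families at once;
    what differs is the variety that realises a given tree. *)
Lemma classifies_catalan n (D : tspace R[i] -> Prop) :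
  (forall X, D X -> catalan_type X /\ krull_dim X n) ->
  (forall t, nb_vertices t = n -> exists2 X, D X & presentable t X) ->
  classifies (unordered_bintrees n) D tree_class.
Proof.
move=> Dcat Dex; split.
- move=> X /Dcat[cX dX]; have [t tn pX] := catalan_type_presentable cX dX.
  by exists t => //; exact: tree_class_presentable.
- move=> X Y /Dcat[cX dX] /Dcat[cY dY].
  have [t tn pX] := catalan_type_presentable cX dX.
  have [t' tn' pY] := catalan_type_presentable cY dY.
  rewrite (tree_class_presentable pX) (tree_class_presentable pY) unordered_class_eq.
  split=> [tt'|]; last exact: presentable_iso_eqv.
  by apply: (presentable_toric_iso pX); exact: presentable_eqv pY.
- move=> U [t tn ->]; have [X DX pX] := Dex t tn.
  by exists X => //; exact: tree_class_presentable.
Qed.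

End Classification.

Local Open Scope classical_set_scope.
Local Open Scope card_scope.

Theorem theorem1p1 (R : realType) (n : nat) (hn : (1 <= n)%N) :
  (exists f : tspace R[i] -> set bintree,
     [/\ forall T : {set 'I_n.+2 * 'I_n.+2}, triangulation T ->
           f (catalan_variety R T) = unordered_class (triangle_tree T),
         classifies (unordered_bintrees n)
           (fun X => catalan_type X /\ krull_dim X n) f &
         classifies (unordered_bintrees n)
           (fun X => [/\ toric_richardson X, catalan_type X & krull_dim X n])
           f]) /\
  unordered_bintrees n #= `I_(wedderburn_etherington n.+1).
Proof.
split; last exact: card_unordered_bintrees.
exists (@tree_class R); split.
- by move=> T trT; apply: tree_class_presentable; exact: catalan_variety_presentable.
- apply: classifies_catalan => // t tn.
  have [T trT pT] := catalan_variety_tree R hn tn.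
  exists (catalan_variety R T) => //; split; last by have := presentable_krull_dim pT; rewrite tn.
  by exists n, T; split=> //; exact: toric_iso_refl.
- apply: classifies_catalan => [X []|t tn] //.
  have pX := richardson_presentable R t.
  have [T trT pT] := catalan_variety_tree R hn tn.
  exists (richardson R (vperm t) (wperm t)) => //; split.
  + exists (nb_vertices t), (vperm t), (wperm t); split=> //; first exact: bruhat_vperm_wperm.
    exact: presentable_dense_orbit pX.
  + by exists n, T; split=> //; exact: presentable_toric_iso pX pT.
  + by rewrite -tn; exact: presentable_krull_dim pX.
Qed.
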